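(* Let $0\le\theta\le 1$, let $q,r\in[2,\infty]$ be defined by $$\left(\frac1q,\frac1r\right)=\left(\frac{\theta}{6}+\frac{1-\theta}{4},\ \frac{\theta}{6}\right),$$ and let $\alpha\in\mathbb{R}$ be defined by $-\alpha+\frac1q+\frac3r=\frac12$. Then there is a constant $C>0$, depending only on $\theta$, such that for all $0<M\le N$ and all $f,g\in L^2(\mathbb{R})$ with $\operatorname{supp}\widehat f\subset\{\xi:|\xi|\le 2M\}$ and $\operatorname{supp}\widehat g\subset\{\xi:N\le|\xi|\le 2N\}$, $$\left\|\left(D^\alpha e^{-t\partial_x^3}f\right)\left(D^\alpha e^{-t\partial_x^3}g\right)\right\|_{L^{q/2}_xL^{r/2}_t}\le C\left(\frac MN\right)^{5\theta/12}\|f\|_{L^2_x}\|g\|_{L^2_x}.$$ In particular, there is an absolute constant $C>0$ such that, for all such $M,N,f,g$, $$\left\|\left(e^{-t\partial_x^3}f\right)\left(e^{-t\partial_x^3}g\right)\right\|_{L^{5/2}_xL^{5}_t}\le C\left(\frac MN\right)^{1/4}\|f\|_{L^2_x}\|g\|_{L^2_x}.$$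
   Context: Functions are complex valued, $x\in\mathbb{R}$ and $t\in\mathbb{R}$. The Fourier transform is $\widehat f(\xi)=\int_{\mathbb{R}}e^{-ix\xi}f(x)\,dx$. The Airy propagator $e^{-t\partial_x^3}$, giving the solution of $\partial_t u+\partial_x^3u=0$ with initial data $u_0$, is $$e^{-t\partial_x^3}u_0(x)=\frac1{2\pi}\int_{\mathbb{R}} e^{it\xi^3+ix\xi}\,\widehat{u_0}(\xi)\,d\xi.$$ The homogeneous fractional derivative $D^s$ acts in $x$ and is defined by $\widehat{D^sf}(\xi)=|\xi|^s\widehat f(\xi)$. The mixed norm is $$\|u\|_{L^q_xL^r_t}=\Big(\int_{\mathbb{R}}\Big(\int_{\mathbb{R}}|u(t,x)|^r\,dt\Big)^{q/r}dx\Big)^{1/q},$$ with the usual essential supremum modification when an exponent is $\infty$ (when $\theta=0$ one has $r=\infty$ and $r/2=\infty$). *)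

(* Defs.v *)
From HB Require Import structures.
From mathcomp Require Import all_boot all_order all_algebra.
From mathcomp Require Import complex.
From mathcomp Require Import all_classical all_reals all_analysis.
Set Implicit Arguments.
Unset Strict Implicit.
Unset Printing Implicit Defensive.
Import Order.TTheory GRing.Theory Num.Theory.
Import numFieldNormedType.Exports.
Local Open Scope classical_set_scope.
Local Open Scope ring_scope.

Definition normc {R : realType} (z : R[i]) : R := ComplexField.Normc.normc z.

Definition expi {R : realType} (y : R) : R[i] := Complex (cos y) (sin y).

(* The library integrates only (extended-)real valued functions. *)
Definition Cintegral {R : realType} (A : set R) (f : R -> R[i]) : R[i] :=
  Complex (Rintegral (@lebesgue_measure R) A (fun x => complex.Re (f x)))
          (Rintegral (@lebesgue_measure R) A (fun x => complex.Im (f x))).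

Definition Cmeasurable {R : realType} (f : R -> R[i]) : Prop :=
  measurable_fun [set: R] (fun x => complex.Re (f x)) /\
  measurable_fun [set: R] (fun x => complex.Im (f x)).

Definition Lpnorm {R : realType} (p : \bar R) (f : R -> R[i]) : \bar R :=
  Lnorm (@lebesgue_measure R) p (fun x => (normc (f x))%:E).

Definition L2 {R : realType} (f : R -> R[i]) : Prop :=
  Cmeasurable f /\ (Lpnorm 2%:E f < +oo)%E.

(* [u] takes the time variable first: [u t x]. *)
Definition mixed_norm {R : realType} (q r : \bar R) (u : R -> R -> R[i])
    : \bar R :=
  Lnorm (@lebesgue_measure R) q (fun x => Lpnorm r (fun t => u t x)).

Definition truncated_fourier {R : realType} (A : R) (f : R -> R[i]) (xi : R)
    : R[i] :=
  Cintegral `[- A, A] (fun x => expi (- (x * xi)) * f x).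

(* For f in L^2 the integral defining the Fourier transform need not converge
   absolutely; it is understood, as usual, as the L^2 limit of the integrals
   over [-A, A]. *)
Definition is_fourier {R : realType} (f F : R -> R[i]) : Prop :=
  L2 F /\
  Lpnorm 2%:E (fun xi => F xi - truncated_fourier A f xi) @[A --> +oo%R]
    --> 0%E.

(* A representative of the Fourier transform of f, which exists for every f in
   L^2 by Plancherel's theorem and is unique up to a null set. *)
Definition fourier {R : realType} (f : R -> R[i]) : R -> R[i] :=
  xget (fun=> 0) [set F | is_fourier f F].

(* The complement of the largest open set on which F vanishes almost
   everywhere; it does not depend on the representative F. *)
Definition ess_support {R : realType} (F : R -> R[i]) : set R :=
  ~` \bigcup_(U in [set U : set R | open U /\
        {ae @lebesgue_measure R, forall xi, U xi -> F xi = 0}]) U.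

Definition inv_fourier {R : realType} (F : R -> R[i]) (x : R) : R[i] :=
  Complex (2 * pi)^-1 0 * Cintegral [set: R] (fun xi => expi (x * xi) * F xi).

Definition airy_mult {R : realType} (t : R) (F : R -> R[i]) (xi : R) : R[i] :=
  expi (t * xi ^+ 3) * F xi.

Definition D_mult {R : realType} (s : R) (F : R -> R[i]) (xi : R) : R[i] :=
  Complex (`|xi| `^ s) 0 * F xi.

Definition airy {R : realType} (t : R) (u0 : R -> R[i]) : R -> R[i] :=
  inv_fourier (airy_mult t (fourier u0)).

(* D^s e^{-t d_x^3} u0.  The two multipliers are composed before the Fourier
   inversion because for s < 0 the function |xi|^s F(xi), F in L^2, may fail to
   be square integrable at 0.  When F has bounded support and s > -1/2 it is
   integrable, so that the inversion integral converges absolutely. *)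
Definition D_airy {R : realType} (s t : R) (u0 : R -> R[i]) : R -> R[i] :=
  inv_fourier (D_mult s (airy_mult t (fourier u0))).

(* Main.v *)
(* Write u, v for the two factors D^alpha e^(-t d_x^3) f and D^alpha e^(-t d_x^3) g, and
   gamma = alpha + 1/4 = 5 theta / 12.

   Maximal estimate: |u(t, x)| <= H(x) for all t, with H in L^4_x bounded by
   M^gamma |f|_2, and similarly for v with N.  It follows by linearising the supremum in t
   and TT*, since the kernel of |D|^(-1/2) e^(-t d_x^3) is O(|x|^(-1/2)) uniformly in t by
   van der Corput's lemma.

   Smoothing estimate: the L^2_t norm of v(., x) is at most N^(alpha - 1) |g|_2 for every
   x, by Plancherel in t, since xi^3 separates points at speed N^2 where |xi| >= N.  Here
   and for the Fourier transform itself only the upper bound in Plancherel's theorem is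
   needed, and it comes from Schur's test.

   With b = r/2 and p = q/2, bounding |u v|^b by (sup |u|)^b (sup |v|)^(b-2) |v|^2 uses the
   smoothing estimate in t; what remains is an integral in x of H_u^p H_v^(4-p), which the
   two maximal estimates control.  The power of N that is left is -gamma. *)

Require Import Defs.
From HB Require Import structures.
From mathcomp Require Import all_boot all_order all_algebra.
From mathcomp Require Import complex.
From mathcomp Require Import all_classical all_reals all_analysis.
From mathcomp Require Import measurable_realfun ess_sup_inf.
From mathcomp Require Import ring lra.
Set Implicit Arguments.
Unset Strict Implicit.
Unset Printing Implicit Defensive.
Import Order.TTheory GRing.Theory Num.Theory.
Import numFieldNormedType.Exports.
Local Open Scope classical_set_scope.
Local Open Scope ring_scope.

(** * Integrals over the line *)

(** Exponents: with e = 1/b = theta / 3, the definition of q reads p (2 - 2 e) = 4. After smoothing,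
    H_v is left with the power p (1 - 2 e) = 4 - p, so the total degree in H_u and H_v is 4 for
    every theta. In N, each use of smoothing gains N^(-5/4) over the maximal estimate, and it enters
    with power 2 e; since 5/4 * 2 e = 2 gamma, the factor N^gamma becomes N^(-gamma).

    The low-frequency obstacle is that alpha < 0 for theta < 3/5. Hence |xi|^alpha is always split
    as |xi|^gamma |xi|^(-1/4): as gamma >= 0, the first factor is bounded by a power of the support
    radius B, and the second, whose square is the weight in van der Corput's lemma, does not depend
    on theta. Cutting at |xi| <= B makes every integral absolutely convergent; the kernel bounds are
    uniform in B.

    Integrals are real, so a complex exponential becomes a pair of cosines with phase shifts 0 and
    -pi/2. TT* needs both: only the sum of their squares produces a function of the difference of
    two phases.

    The supremum over t is taken over rational times, where it is measurable, and extends to all t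
    because a band-limited wave is Lipschitz in t. *)

Section basics.
Context {R : realType}.
Notation mu := (@lebesgue_measure R).
Implicit Types f g h : R -> R.

(** [Rintegral] turns an infinite integral into 0, so linearity asks for [integ]; bounds that may be
    infinite are stated in the extended reals. *)
Definition Int (f : R -> R) : R := Rintegral mu setT f.
Definition integ (f : R -> R) : Prop := mu.-integrable setT (EFin \o f).

Lemma integ_meas f : integ f -> measurable_fun setT f.
Proof. by move=> /measurable_int/measurable_EFinP. Qed.

Lemma EFin_Int f : integ f -> ((Int f)%:E = \int[mu]_x (f x)%:E)%E.
Proof. by move=> h; rewrite /Int /Rintegral fineK//; exact: integrable_fin_num. Qed.

Lemma eq_integ f g : f =1 g -> integ f -> integ g.
Proof. by move=> fg; apply: eq_integrable => // x _ /=; rewrite fg. Qed.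

Lemma eq_Int f g : f =1 g -> Int f = Int g.
Proof. by move=> fg; apply: eq_Rintegral => x _; rewrite fg. Qed.

Lemma integ_le f g : measurable_fun setT f -> (forall x, `|f x| <= g x) ->
  integ g -> integ f.
Proof.
move=> mf fg; apply: le_integrable => //; first exact/measurable_EFinP.
by move=> x _ /=; rewrite lee_fin (le_trans (fg x))// ler_norm.
Qed.

Lemma integ_ge0P f : measurable_fun setT f -> (forall x, 0 <= f x) ->
  (\int[mu]_x (f x)%:E < +oo)%E -> integ f.
Proof.
move=> mf f0 h; apply/integrableP; split; first exact/measurable_EFinP.
by under eq_integral do rewrite /= ger0_norm//.
Qed.

Lemma integMbd f h M : integ f -> measurable_fun setT h ->
  (forall x, `|h x| <= M) -> integ (fun x => f x * h x).
Proof.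
move=> fi mh hM; have M0 : 0 <= M by apply: le_trans (hM 0).
apply: (@integ_le _ (fun x => M * `|f x|)).
- by apply: measurable_funM => //; exact: integ_meas.
- by move=> x; rewrite normrM mulrC ler_wpM2r.
- by exact: (@integrableZl _ _ _ mu setT measurableT M (EFin \o (fun x => `|f x|)) (integrable_norm fi)).
Qed.

Lemma integZ k f : integ f -> integ (fun x => k * f x).
Proof. by move=> h; exact: (@integrableZl _ _ _ mu setT measurableT k (EFin \o f) h). Qed.

Lemma integD f g : integ f -> integ g -> integ (fun x => f x + g x).
Proof. by move=> hf hg; exact: (@integrableD _ _ _ mu setT measurableT (EFin \o f) (EFin \o g) hf hg). Qed.

Lemma integB f g : integ f -> integ g -> integ (fun x => f x - g x).
Proof. by move=> hf hg; exact: (@integrableB _ _ _ mu setT measurableT (EFin \o f) (EFin \o g) hf hg). Qed.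

Lemma integ_norm f : integ f -> integ (fun x => `|f x|).
Proof. exact: integrable_norm. Qed.

Lemma IntZ k f : integ f -> Int (fun x => k * f x) = k * Int f.
Proof. by move=> h; exact: RintegralZl. Qed.

Lemma IntD f g : integ f -> integ g -> Int (fun x => f x + g x) = Int f + Int g.
Proof. by move=> *; exact: RintegralD. Qed.

Lemma IntB f g : integ f -> integ g -> Int (fun x => f x - g x) = Int f - Int g.
Proof. by move=> *; exact: RintegralB. Qed.

Lemma le_Int f g : integ f -> integ g -> (forall x, f x <= g x) -> Int f <= Int g.
Proof. by move=> hf hg fg; apply: le_Rintegral. Qed.

Lemma Int_ge0 f : (forall x, 0 <= f x) -> 0 <= Int f.
Proof. by move=> h; exact: Rintegral_ge0. Qed.

Lemma norm_Int f : integ f -> `|Int f| <= Int (fun x => `|f x|).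
Proof. by move=> h; exact: le_normr_Rintegral. Qed.

Lemma measurable_pair1 (k : R * R -> R) x : measurable_fun setT k ->
  measurable_fun setT (fun y => k (x, y)).
Proof. by move=> mk; exact: (measurableT_comp mk). Qed.

Lemma measurable_pair2 (k : R * R -> R) y : measurable_fun setT k ->
  measurable_fun setT (fun x => k (x, y)).
Proof. by move=> mk; exact: (measurableT_comp mk). Qed.

Section swap.
Variables (f g : R -> R) (k : R * R -> R) (M : R).
Hypotheses (fi : integ f) (gi : integ g) (mk : measurable_fun setT k)
  (maximal_const : forall z, `|k z| <= M).

Let h z := f z.1 * (g z.2 * k z).

Let mh : measurable_fun setT h.
Proof.
apply: measurable_funM; first exact: (measurableT_comp (integ_meas fi)).
by apply: measurable_funM => //; exact: (measurableT_comp (integ_meas gi)).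
Qed.

Let M0 : 0 <= M. Proof. exact: le_trans (maximal_const (0, 0)). Qed.

Let hint : (mu \x mu)%E.-integrable setT (EFin \o h).
Proof.
apply/integrable12ltyP; first exact/measurable_EFinP.
apply: (@le_lt_trans _ _ (\int[mu]_x (`|f x| * (M * Int (fun y => `|g y|)))%:E)%E).
  apply: ge0_le_integral => //=.
  - by move=> x _; exact: integral_ge0.
  - apply: (@measurable_fun_fubini_tonelli_F _ _ _ _ _ mu
      (fun z => (`|h z|)%:E)) => //.
    by apply/measurable_EFinP; exact: measurableT_comp.
  - by apply/measurable_EFinP; apply: measurable_funM => //; apply: measurableT_comp => //; exact: integ_meas.
  - move=> x _; rewrite -IntZ; last exact: integ_norm.
    rewrite -IntZ; last by apply: integZ; exact: integ_norm.
    rewrite EFin_Int; last by do 2 apply: integZ; exact: integ_norm.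
    apply: ge0_le_integral => //=.
    + by apply/measurable_EFinP; apply: measurableT_comp => //; exact: measurable_pair1.
    + by apply/measurable_EFinP; apply: measurable_funM => //; apply: measurable_funM => //; apply: measurableT_comp => //; exact: integ_meas.
    + move=> y _; rewrite lee_fin /h !normrM ler_wpM2l// mulrC ler_wpM2r//.
apply: integrable_lty => //.
apply: (@eq_integ (fun x => M * Int (fun y => `|g y|) * `|f x|)) => [x|]; first by rewrite mulrC.
by apply: integZ; exact: integ_norm.
Qed.

Lemma integ_kernelr x : integ (fun y => g y * k (x, y)).
Proof. by apply: integMbd gi _ _ => //; exact: measurable_pair1. Qed.

Lemma integ_kernell y : integ (fun x => f x * k (x, y)).
Proof. by apply: integMbd fi _ _ => //; exact: measurable_pair2. Qed.

(** Fubini, the integrand being dominated by M |f x| |g y|. In this form it exchanges an operator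
    with kernel [k] and its adjoint. *)
Lemma Int_swap :
  Int (fun x => f x * Int (fun y => g y * k (x, y))) =
  Int (fun y => g y * Int (fun x => f x * k (x, y))).
Proof.
have FE x : f x * Int (fun y => g y * k (x, y)) = fine (\int[mu]_y (h (x, y))%:E)%E.
  by rewrite -IntZ//; exact: integ_kernelr.
have GE y : g y * Int (fun x => f x * k (x, y)) = fine (\int[mu]_x (h (x, y))%:E)%E.
  rewrite -IntZ; last exact: integ_kernell.
  by rewrite /Int /Rintegral; congr fine; apply: eq_integral => x _; rewrite /h/= mulrCA.
have hx x : integ (fun y => h (x, y)) by rewrite /h/=; apply: integZ; exact: integ_kernelr.
have hy y : integ (fun x => h (x, y)).
  by apply: (@eq_integ (fun x => g y * (f x * k (x, y)))) => [x|]; [rewrite /h/= mulrCA|apply: integZ; exact: integ_kernell].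
under eq_Int do rewrite FE.
under [RHS]eq_Int do rewrite GE.
rewrite /Int /Rintegral; congr fine.
transitivity (\int[mu]_x \int[mu]_y (h (x, y))%:E)%E.
  by apply: eq_integral => x _; rewrite fineK//; exact: (integrable_fin_num _ (hx x)).
transitivity (\int[mu]_y \int[mu]_x (h (x, y))%:E)%E; last first.
  by apply: eq_integral => x _; rewrite fineK//; exact: (integrable_fin_num _ (hy x)).
exact: (@Fubini _ _ _ _ _ mu mu (EFin \o h)).
Qed.

End swap.

(** No integrability in y is assumed: positive and negative parts go through Tonelli separately, and
    [fine] is measurable. *)
Lemma meas_Int d (T : measurableType d) (h : T * R -> R) : measurable_fun setT h ->
  measurable_fun setT (fun x => Int (fun y => h (x, y))).
Proof.
move=> mh; rewrite /Int /Rintegral; apply: (measurableT_comp (fine_measurable measurableT)) => //.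
under eq_fun do rewrite integralE.
have mE : measurable_fun setT (EFin \o h) by exact/measurable_EFinP.
have h1 := @measurable_fun_fubini_tonelli_F _ _ _ _ _ mu ((EFin \o h)^\+)%E
  (measurable_funepos mE) (fun=> funepos_ge0 _ _).
have h2 := @measurable_fun_fubini_tonelli_F _ _ _ _ _ mu ((EFin \o h)^\-)%E
  (measurable_funeneg mE) (fun=> funeneg_ge0 _ _).
have h12 := emeasurable_funB h1 h2.
apply: (eq_measurable_fun _ _ h12) => x _ /=; rewrite /fubini_F.
by congr (_ - _)%E; apply: eq_integral => y _; rewrite ?funeposE ?funenegE.
Qed.

Lemma norm_Int_le f : measurable_fun setT f ->
  (`|Int f|%:E <= \int[mu]_x `|f x|%:E)%E.
Proof.
move=> mf; have [|] := ltP (\int[mu]_x `|f x|%:E)%E +oo%E; last first.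
  by rewrite leye_eq => /eqP ->; rewrite leey.
move=> fy; have fi : integ f by apply/integrableP; split=> //; exact/measurable_EFinP.
by rewrite -EFin_Int ?lee_fin ?norm_Int//; exact: integ_norm.
Qed.

Lemma norm_Int_kernel f g M : integ f -> measurable_fun setT g ->
  (forall x, `|g x| <= M) -> `|Int (fun x => f x * g x)| <= M * Int (fun x => `|f x|).
Proof.
move=> fi mg gM; rewrite (le_trans (norm_Int _))//; first exact: integMbd fi mg gM.
rewrite -IntZ; last exact: integ_norm.
apply: le_Int.
- by apply: integ_norm; exact: integMbd fi mg gM.
- by apply: integZ; exact: integ_norm.
- by move=> x; rewrite normrM mulrC ler_wpM2r.
Qed.

Lemma meas_swap (k : R * R -> R) : measurable_fun setT k ->
  measurable_fun setT (fun z => k (z.2, z.1)).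
Proof. by move=> mk; apply: (measurableT_comp mk); exact: measurable_swap. Qed.

Lemma integ_swap f g (k : R * R -> R) M : integ f -> integ g ->
  measurable_fun setT k -> (forall z, `|k z| <= M) ->
  integ (fun y => g y * Int (fun x => f x * k (x, y))).
Proof.
move=> fi gi mk maximal_const; apply: (integMbd gi).
  apply: (@meas_Int _ _ (fun z => f z.2 * k (z.2, z.1))).
  apply: measurable_funM; last exact: meas_swap.
  exact: (measurableT_comp (integ_meas fi)).
move=> y; apply: (norm_Int_kernel fi _ (fun x => maximal_const (x, y))).
exact: measurable_pair2.
Qed.

Lemma measurable_cosT : measurable_fun setT (@cos R).
Proof. by apply: continuous_measurable_fun; exact: continuous_cos. Qed.

Lemma measurable_sinT : measurable_fun setT (@sin R).
Proof. by apply: continuous_measurable_fun; exact: continuous_sin. Qed.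

Lemma norm_cos_le1 (x : R) : `|cos x| <= 1.
Proof. by rewrite ler_norml cos_geN1 cos_le1. Qed.

Lemma norm_sin_le1 (x : R) : `|sin x| <= 1.
Proof. by rewrite ler_norml sin_geN1 sin_le1. Qed.

(** * The TT* identity for real oscillatory integrals *)

Section TTstar.
Variables (w a : R -> R).
Hypotheses (wi : integ w) (ai : integ a).

Section half.
Variable c : R * R -> R.
Hypotheses (mc : measurable_fun setT c) (c1 : forall z, `|c z| <= 1).

Let P xi := Int (fun x => a x * c (xi, x)).

Let mP : measurable_fun setT P.
Proof.
apply: (@meas_Int _ _ (fun z => a z.2 * c z)).
by apply: measurable_funM => //; exact: (measurableT_comp (integ_meas ai)).
Qed.

Let Pbd xi : `|P xi| <= 1 * Int (fun x => `|a x|).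
Proof. by apply: norm_Int_kernel => //; exact: measurable_pair1. Qed.

Let wPi : integ (fun xi => w xi * P xi).
Proof. exact: integMbd wi mP Pbd. Qed.

Let mcc x : measurable_fun setT (fun z : R * R => c z * c (z.1, x)).
Proof.
apply: measurable_funM => //; apply: (measurableT_comp mc).
by apply: measurable_fun_pair => //; exact: measurable_fst.
Qed.

Let cc1 x (z : R * R) : `|c z * c (z.1, x)| <= 1.
Proof. by rewrite normrM -[leRHS]mulr1 ler_pM. Qed.

(** [c] stands for the cosine or the sine of [Phi]. Of the two factors of P^2 one is unfolded and
    exchanged with the integral in xi here, the other in [TTstar_half2]. *)
Lemma TTstar_half1 :
  Int (fun xi => w xi * P xi ^+ 2) =
  Int (fun x => a x * Int (fun xi => w xi * P xi * c (xi, x))).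
Proof.
under eq_Int do rewrite expr2 mulrA.
exact: Int_swap wPi ai mc c1.
Qed.

Lemma TTstar_half1i :
  integ (fun x => a x * Int (fun xi => w xi * P xi * c (xi, x))).
Proof. exact: integ_swap wPi ai mc c1. Qed.

Lemma TTstar_half2 x : Int (fun xi => w xi * P xi * c (xi, x)) =
  Int (fun y => a y * Int (fun xi => w xi * (c (xi, y) * c (xi, x)))).
Proof.
rewrite -(Int_swap wi ai (mcc x) (cc1 x)) /=; apply: eq_Int => xi.
rewrite -mulrA; congr (_ * _); rewrite mulrC /P -IntZ; last first.
  by apply: integMbd ai _ (fun y => c1 (xi, y)); exact: measurable_pair1.
by apply: eq_Int => y; ring.
Qed.

Lemma TTstar_half2i x :
  integ (fun y => a y * Int (fun xi => w xi * (c (xi, y) * c (xi, x)))).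
Proof. exact: integ_swap wi ai (mcc x) (cc1 x). Qed.

Lemma TTstar_half3i x y : integ (fun xi => w xi * (c (xi, y) * c (xi, x))).
Proof. exact: (integ_kernell wi (mcc x) (cc1 x) y). Qed.

Lemma TTstar_int : integ (fun xi => w xi * P xi ^+ 2).
Proof.
apply: (@eq_integ (fun xi => w xi * P xi * P xi)) => [xi|].
  by rewrite -mulrA.
exact: integMbd wPi mP Pbd.
Qed.

End half.

Variable Phi : R * R -> R.
Hypothesis mPhi : measurable_fun setT Phi.

Let Pc xi := Int (fun x => a x * cos (Phi (xi, x))).
Let Ps xi := Int (fun x => a x * sin (Phi (xi, x))).
(** Kernel of TT*, where T* a is the integral of a(x) exp(i Phi(xi, x)), with real part [Pc] and
    imaginary part [Ps], measured in L^2 with weight [w]. The difference of phases comes from cos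
    cos + sin sin. *)
Definition TTker x y := Int (fun xi => w xi * cos (Phi (xi, x) - Phi (xi, y))).

Let mc : measurable_fun setT (fun z => cos (Phi z)).
Proof. exact: (measurableT_comp measurable_cosT). Qed.
Let ms : measurable_fun setT (fun z => sin (Phi z)).
Proof. exact: (measurableT_comp measurable_sinT). Qed.

Let c1 z : `|cos (Phi z)| <= 1. Proof. exact: norm_cos_le1. Qed.
Let s1 z : `|sin (Phi z)| <= 1. Proof. exact: norm_sin_le1. Qed.

Lemma TTstar : Int (fun xi => w xi * (Pc xi ^+ 2 + Ps xi ^+ 2)) =
  Int (fun x => a x * Int (fun y => a y * TTker x y)).
Proof.
under eq_Int do rewrite mulrDr.
rewrite IntD; [|exact: (TTstar_int mc c1)|exact: (TTstar_int ms s1)].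
rewrite (TTstar_half1 mc c1)//(TTstar_half1 ms s1)//.
rewrite -IntD; [|exact: (TTstar_half1i mc c1)|exact: (TTstar_half1i ms s1)].
apply: eq_Int => x; rewrite -mulrDr; congr (_ * _).
rewrite (TTstar_half2 mc c1)// (TTstar_half2 ms s1)//.
rewrite -IntD; [|exact: (TTstar_half2i mc c1)|exact: (TTstar_half2i ms s1)].
apply: eq_Int => y; rewrite -mulrDr; congr (_ * _).
rewrite -IntD; [|exact: (TTstar_half3i mc c1)|exact: (TTstar_half3i ms s1)].
by apply: eq_Int => xi; rewrite cosB; ring.
Qed.

Let mPhi1 : measurable_fun setT (fun z : R * R * R => Phi (z.2, z.1.1)).
Proof.
apply: (measurableT_comp mPhi); apply: measurable_fun_pair; first exact: measurable_snd.
by apply: measurableT_comp; exact: measurable_fst.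
Qed.

Let mPhi2 : measurable_fun setT (fun z : R * R * R => Phi (z.2, z.1.2)).
Proof.
apply: (measurableT_comp mPhi); apply: measurable_fun_pair; first exact: measurable_snd.
by apply: measurableT_comp; [exact: measurable_snd|exact: measurable_fst].
Qed.

Lemma TTker_meas : measurable_fun setT (fun z => TTker z.1 z.2).
Proof.
apply: (@meas_Int _ _ (fun z : R * R * R => w z.2 * cos (Phi (z.2, z.1.1) - Phi (z.2, z.1.2)))).
apply: measurable_funM; first by apply: (measurableT_comp (integ_meas wi)); exact: measurable_snd.
by apply: (measurableT_comp measurable_cosT); exact: measurable_funB.
Qed.

(** Oscillation is spent inside [TTker] only. With absolute values outside, Tonelli applies
    unconditionally, and both Schur's test and fractional integration start from this bound. *)
Lemma TTstar_le : ((Int (fun xi => w xi * (Pc xi ^+ 2 + Ps xi ^+ 2)))%:E <=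
  \int[mu]_x \int[mu]_y (`|a x| * `|a y| * `|TTker x y|)%:E)%E.
Proof.
have mK := TTker_meas; have ma := integ_meas ai.
have mh : measurable_fun setT (fun z => a z.2 * TTker z.1 z.2).
  by apply: measurable_funM => //; apply: (measurableT_comp ma); exact: measurable_snd.
have mI : measurable_fun setT (fun x => Int (fun y => a y * TTker x y)).
  exact: (@meas_Int _ _ (fun z => a z.2 * TTker z.1 z.2)).
have mN : measurable_fun setT (fun z => `|a z.1| * `|a z.2| * `|TTker z.1 z.2|).
  apply: measurable_funM; last exact: measurableT_comp.
  apply: measurable_funM; apply: measurableT_comp => //.
    by apply: (measurableT_comp ma); exact: measurable_fst.
  by apply: (measurableT_comp ma); exact: measurable_snd.
rewrite TTstar; apply: (@le_trans _ _ (`|Int (fun x => a x * Int (fun y => a y * TTker x y))|%:E)).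
  by rewrite lee_fin ler_norm.
apply: (le_trans (norm_Int_le _)); first exact: measurable_funM.
apply: ge0_le_integral => //=.
- by apply/measurable_EFinP; apply: measurableT_comp => //; exact: measurable_funM.
- apply: (@measurable_fun_fubini_tonelli_F _ _ _ _ _ mu
      (fun z => (`|a z.1| * `|a z.2| * `|TTker z.1 z.2|)%:E)).
    exact/measurable_EFinP.
  by move=> z; rewrite lee_fin !mulr_ge0.
- move=> x _; rewrite normrM EFinM.
  under eq_integral do rewrite -mulrA EFinM.
  rewrite ge0_integralZl//; last first.
    apply/measurable_EFinP; apply: measurable_funM.
      exact: measurableT_comp.
    by apply: measurableT_comp => //; exact: (measurable_pair1 x mK).
  apply: lee_wpmul2l => //.
  apply: (le_trans (norm_Int_le _)).
    by apply: measurable_funM => //; exact: (measurable_pair1 x mK).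
  by rewrite le_eqVlt; apply/orP; left; apply/eqP/eq_integral => y _; rewrite normrM.
Qed.

End TTstar.

End basics.

(** * Nonnegative integrals and the fundamental theorem of calculus *)

Section tools.
Context {R : realType}.
Notation mu := (@lebesgue_measure R).
Implicit Types f g h F : R -> R.

Lemma Int_indic (D : set R) f : measurable D ->
  Int (fun x => \1_D x * f x) = Rintegral mu D f.
Proof.
move=> mD; rewrite Rintegral_mkcond; apply: eq_Int => x.
by rewrite patchE indicE; case: ifPn => _; rewrite ?mul1r ?mul0r.
Qed.

Lemma integ_indic (D : set R) f : measurable D ->
  integ (fun x => \1_D x * f x) <-> mu.-integrable D (EFin \o f).
Proof.
move=> mD; have e : (EFin \o f) \_ D = EFin \o (fun x => \1_D x * f x).
  by apply/funext => x; rewrite /= patchE indicE; case: ifPn => _ /=; rewrite ?mul1r ?mul0r.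
rewrite /integ -e; split=> h.
  exact: ((@integrable_mkcond _ _ _ mu D (EFin \o f) mD).2 h).
exact: ((@integrable_mkcond _ _ _ mu D (EFin \o f) mD).1 h).
Qed.

Lemma meas_indic (D : set R) : measurable D -> measurable_fun setT (\1_D : R -> R).
Proof. by move=> mD; exact: measurable_indic. Qed.

Lemma indic_le1 (D : set R) x : 0 <= (\1_D x : R) <= 1.
Proof. by rewrite indicE; case: (_ \in _); rewrite /= ?lexx ler01. Qed.

Lemma integ_indic_itv (a b : R) : integ (\1_`[a, b]).
Proof. exact: (@integrable_indic_itv R a b true false). Qed.

Lemma integ_itv_bd f (a b M : R) : measurable_fun setT f ->
  (forall x, `|f x| <= M) -> integ (fun x => \1_`[a, b] x * f x).
Proof. by move=> mf fM; exact: integMbd (integ_indic_itv a b) mf fM. Qed.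

Lemma scaleRE (a b : R) : a *: b = a * b.
Proof. by []. Qed.

Lemma derivable_cont f x : derivable f x 1 -> {for x, continuous f}.
Proof. by move=> ?; apply/differentiable_continuous/derivable1_diffP. Qed.

Lemma is_derive_cont f (x d : R) : is_derive x 1 f d -> {for x, continuous f}.
Proof. by case=> h _; exact: derivable_cont. Qed.

Lemma meas_tonelli (h : R * R -> \bar R) : measurable_fun setT h ->
  (forall z, 0 <= h z)%E -> measurable_fun setT (fun x => \int[mu]_y h (x, y))%E.
Proof. by move=> mh h0; exact: (@measurable_fun_fubini_tonelli_F _ _ _ _ _ mu h mh h0). Qed.

Lemma tonelli (h : R * R -> \bar R) : measurable_fun setT h -> (forall z, 0 <= h z)%E ->
  (\int[mu]_x \int[mu]_y h (x, y) = \int[mu]_y \int[mu]_x h (x, y))%E.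
Proof. by move=> mh h0; exact: (@fubini_tonelli _ _ _ _ _ mu mu h mh h0). Qed.

(** The integral of a nonnegative function is a supremum over the simple functions below it, so no
    measurability is required. This is what allows the inner norm of the mixed norm to be bounded
    pointwise in x. *)
Lemma nnint_le (f g : R -> \bar R) : (forall x, 0 <= f x)%E ->
  (forall x, f x <= g x)%E -> (\int[mu]_x f x <= \int[mu]_x g x)%E.
Proof.
move=> f0 fg; rewrite !ge0_integralTE//; last by move=> x; exact: le_trans (fg x).
by apply: le_ereal_sup => _ [h hf <-]; exists h => // x; exact: le_trans (fg x).
Qed.

Lemma nnintZle (k : R) (f : R -> \bar R) : measurable_fun setT f -> (forall x, 0 <= f x)%E -> 0 <= k ->
  (\int[mu]_x (k%:E * f x) = k%:E * \int[mu]_x f x)%E.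
Proof. by move=> mf f0 k0; rewrite ge0_integralZl. Qed.

Lemma nnintZl (k : R) f : measurable_fun setT f -> (forall x, 0 <= f x) -> 0 <= k ->
  (\int[mu]_x (k * f x)%:E = k%:E * \int[mu]_x (f x)%:E)%E.
Proof.
move=> mf f0 k0; rewrite -(@nnintZle k (EFin \o f))//; exact/measurable_EFinP.
Qed.

Lemma nnintDe (f g : R -> \bar R) : measurable_fun setT f -> measurable_fun setT g ->
  (forall x, 0 <= f x)%E -> (forall x, 0 <= g x)%E ->
  (\int[mu]_x (f x + g x) = \int[mu]_x f x + \int[mu]_x g x)%E.
Proof. by move=> mf mg f0 g0; rewrite ge0_integralD. Qed.

Lemma nnintD f g : measurable_fun setT f -> measurable_fun setT g ->
  (forall x, 0 <= f x) -> (forall x, 0 <= g x) ->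
  (\int[mu]_x (f x + g x)%:E = \int[mu]_x (f x)%:E + \int[mu]_x (g x)%:E)%E.
Proof.
move=> mf mg f0 g0; rewrite -(@nnintDe (EFin \o f) (EFin \o g))//; exact/measurable_EFinP.
Qed.

Lemma nnint_ge0 (f : R -> \bar R) : (forall x, 0 <= f x)%E -> (0 <= \int[mu]_x f x)%E.
Proof. by move=> f0; exact: integral_ge0. Qed.

Lemma Rintegral_FTC f F (a b : R) : a <= b ->
  (forall x, a <= x <= b -> is_derive x 1 F (f x)) ->
  (forall x, a <= x <= b -> {for x, continuous f}) ->
  Rintegral mu `[a, b] f = F b - F a /\ mu.-integrable `[a, b] (EFin \o f).
Proof.
move=> ab dF cf.
have cfw : {within `[a, b], continuous f}.
  apply: continuous_in_subspaceT => x; rewrite inE/= in_itv/= => xab; exact: cf.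
split; last by apply: continuous_compact_integrable => //; exact: segment_compact.
move: ab; rewrite le_eqVlt => /predU1P[->|ab].
  by rewrite set_itv1 Rintegral_set1 subrr.
have cF x : a <= x <= b -> {for x, continuous F}.
  by move=> /dF h; apply/differentiable_continuous/derivable1_diffP; case: h.
rewrite /Rintegral (@continuous_FTC2 _ f F)//.
  split.
  - by move=> x /[!in_itv]/= /andP[ax xb]; have [] := dF x; rewrite ?(ltW ax) ?(ltW xb).
  - by apply: cvg_at_right_filter; apply: cF; rewrite lexx ltW.
  - by apply: cvg_at_left_filter; apply: cF; rewrite lexx ltW.
move=> x /[!in_itv]/= /andP[ax xb].
by rewrite derive1E; have dFx := dF x; rewrite (ltW ax) (ltW xb) in dFx; have [_ ->] := dFx isT.
Qed.

Lemma integral_bigcup_le (f : R -> R) (D : (set R)^nat) (L : \bar R) :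
  measurable_fun setT f -> (forall x, 0 <= f x) -> (forall n, measurable (D n)) ->
  nondecreasing_seq D ->
  (forall n, \int[mu]_(x in D n) (f x)%:E <= L)%E ->
  (\int[mu]_(x in \bigcup_n D n) (f x)%:E <= L)%E.
Proof.
move=> mf f0 mD ndD fL.
have h : (\int[mu]_(x in D n) (f x)%:E @[n --> \oo] --> \int[mu]_(x in \bigcup_i D i) (f x)%:E)%E.
  apply: ge0_nondecreasing_set_cvg_integral => //.
    by move=> i; exact/measurable_EFinP/measurable_funTS.
  by move=> i x _; rewrite lee_fin.
rewrite -(cvg_lim _ h)//; apply: lime_le; first by apply/cvg_ex; eexists; exact: h.
by apply: nearW.
Qed.

(** Each increment F n - F (- n) is at most 2 L, which avoids computing limits of the primitive at
    infinity. *)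
Lemma integral_FTC_le f F (L : R) : (forall x, 0 <= f x) -> continuous f ->
  (forall x : R, is_derive x 1 F (f x)) -> (forall x, `|F x| <= L) ->
  (\int[mu]_x (f x)%:E <= (2 * L)%:E)%E.
Proof.
move=> f0 cf dF FL.
have mf : measurable_fun setT f by exact: continuous_measurable_fun.
have UT : \bigcup_n `[- n%:R, n%:R]%classic = [set: R].
  apply/seteqP; split=> // x _; exists (Num.truncn `|x|).+1 => //=.
  by rewrite in_itv/= -ler_norml ltW// truncnS_gt.
rewrite -UT; apply: integral_bigcup_le => //.
  move=> m n mn; apply/subsetPset => x /=; rewrite !in_itv/= -!ler_norml => h.
  by rewrite (le_trans h)// ler_nat.
move=> n; have n0 : - n%:R <= n%:R :> R by rewrite ge0_cp.
have [e i] := @Rintegral_FTC f F _ _ n0 (fun x _ => dF x) (fun x _ => cf x).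
rewrite -[X in (X <= _)%E]fineK; last exact: (integrable_fin_num _ i).
rewrite lee_fin -/(Rintegral _ _ _) e.
rewrite (le_trans (ler_norm _))// (le_trans (ler_normB _ _))//.
by rewrite mulr_natl mulr2n lerD.
Qed.

(** The Lorentzian, with its arctangent primitive, is the majorant used twice: for the kernel in
    Schur's test and for the tail |y - x|^(-2) in [hls_point]. *)
Lemma integral_lorentz_le (b x : R) : 0 < b ->
  (\int[mu]_y (1 + (b * (y - x)) ^+ 2)^-1%:E <= (pi / b)%:E)%E.
Proof.
move=> b0.
have -> : pi / b = 2 * (pi / 2 / b) by field; rewrite gt_eqF.
apply: (@integral_FTC_le _ (fun y => b^-1 * atan (b * (y - x)))).
- by move=> y; rewrite invr_ge0 addr_ge0// sqr_ge0.
- move=> y; apply: derivable_cont; apply: derivableV.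
    by rewrite gt_eqF// ltr_pwDl// sqr_ge0.
  exact: ex_derive.
- move=> y; apply: is_derive_eq.
  rewrite -[b *: _]/(b * _) -[_ *: _]/(_ * _) subr0 mulr1 mulrCA mulVf ?mulr1//.
  by rewrite gt_eqF.
- move=> y; rewrite normrM gtr0_norm ?invr_gt0// mulrC ler_pM2r ?invr_gt0//.
  by rewrite ler_norml ltW ?atan_gtNpi2//= ltW// atan_ltpi2.
Qed.

End tools.

(** * Schur's test *)

Section schur.
Context {R : realType}.
Notation mu := (@lebesgue_measure R).

Lemma amgm_norm (u v : R) : `|u| * `|v| <= 2^-1 * u ^+ 2 + 2^-1 * v ^+ 2.
Proof.
rewrite -(real_normK (num_real u)) -(real_normK (num_real v)).
have := sqr_ge0 (`|u| - `|v|); nra.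
Qed.

(** |a x| |a y| is at most the mean of the two squares, and the two resulting integrals agree by
    Tonelli and the symmetry of [kap]. The kernel is bounded only where [a] does not vanish, since
    phases are separated only on the support of [a]. *)
Lemma schur (a : R -> R) (kap K : R * R -> R) (c : R) :
  measurable_fun setT a -> measurable_fun setT kap -> measurable_fun setT K ->
  (forall z, 0 <= kap z) -> (forall x y, kap (x, y) = kap (y, x)) -> 0 <= c ->
  (forall x, \int[mu]_y (kap (x, y))%:E <= c%:E)%E ->
  (forall z, a z.1 != 0 -> a z.2 != 0 -> `|K z| <= kap z) ->
  (\int[mu]_x \int[mu]_y (`|a x| * `|a y| * `|K (x, y)|)%:E <=
   c%:E * \int[mu]_x (a x ^+ 2)%:E)%E.
Proof.
move=> ma mk mK k0 ks c0 kc Kk.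
pose h1 (z : R * R) := 2^-1 * a z.1 ^+ 2 * kap z.
pose h2 (z : R * R) := 2^-1 * a z.2 ^+ 2 * kap z.
have ha0 x : 0 <= 2^-1 * a x ^+ 2 by rewrite mulr_ge0 ?invr_ge0 ?sqr_ge0.
have ma1 : measurable_fun setT (fun z : R * R => a z.1) by apply: (measurableT_comp ma); exact: measurable_fst.
have ma2 : measurable_fun setT (fun z : R * R => a z.2) by apply: (measurableT_comp ma); exact: measurable_snd.
have mh1 : measurable_fun setT h1.
  apply: measurable_funM mk; apply: measurable_funM; first exact: measurable_cst.
  exact: measurable_funX ma1.
have mh2 : measurable_fun setT h2.
  apply: measurable_funM mk; apply: measurable_funM; first exact: measurable_cst.
  exact: measurable_funX ma2.
have h10 z : (0 <= (h1 z)%:E)%E by rewrite lee_fin; exact: mulr_ge0.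
have h20 z : (0 <= (h2 z)%:E)%E by rewrite lee_fin; exact: mulr_ge0.
have mE1 : measurable_fun setT (fun z => (h1 z)%:E) by exact/measurable_EFinP.
have mE2 : measurable_fun setT (fun z => (h2 z)%:E) by exact/measurable_EFinP.
have e12 : (\int[mu]_x \int[mu]_y (h2 (x, y))%:E = \int[mu]_x \int[mu]_y (h1 (x, y))%:E)%E.
  rewrite (tonelli mE2 h20); apply: eq_integral => x _.
  by apply: eq_integral => y _; rewrite /h1/h2/= ks.
have b1 : (\int[mu]_x \int[mu]_y (h1 (x, y))%:E <= (2^-1)%:E * (c%:E * \int[mu]_x (a x ^+ 2)%:E))%E.
  rewrite muleA -EFinM -nnintZl; last 3 first.
  - exact: measurable_funX.
  - by move=> x; exact: sqr_ge0.
  - by rewrite mulr_ge0.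
  apply: nnint_le => x; first exact: nnint_ge0.
  rewrite /h1/= nnintZl; last 3 first.
  - exact: (measurable_pair1 x mk).
  - by [].
  - exact: ha0.
  rewrite [2^-1 * c * _]mulrAC [leRHS]EFinM; apply: lee_wpmul2l; last exact: kc.
  by rewrite lee_fin.
apply: (@le_trans _ _ (\int[mu]_x (\int[mu]_y (h1 (x, y))%:E + \int[mu]_y (h2 (x, y))%:E))%E); last first.
  rewrite nnintDe; last 4 first.
  - exact: meas_tonelli mE1 h10.
  - exact: meas_tonelli mE2 h20.
  - by move=> x; exact: nnint_ge0.
  - by move=> x; exact: nnint_ge0.
  rewrite e12; apply: (le_trans (leeD b1 b1)).
  rewrite -ge0_muleDl; [|by rewrite lee_fin invr_ge0|by rewrite lee_fin invr_ge0].
  by rewrite -EFinD -div1r -splitr mul1e.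
apply: nnint_le => x.
  by apply: nnint_ge0 => y; rewrite lee_fin !mulr_ge0.
rewrite -nnintD; last 4 first.
- exact: (measurable_pair1 x mh1).
- exact: (measurable_pair1 x mh2).
- by move=> y; exact: mulr_ge0.
- by move=> y; exact: mulr_ge0.
apply: nnint_le => y; first by rewrite lee_fin !mulr_ge0.
rewrite /h1 /h2 lee_fin/= -mulrDl.
have hs : 0 <= 2^-1 * a x ^+ 2 + 2^-1 * a y ^+ 2 by exact: addr_ge0.
have [->|ax] := eqVneq (a x) 0; first by rewrite normr0 !mul0r expr0n/= mulr0 add0r mulr_ge0.
have [->|ay] := eqVneq (a y) 0; first by rewrite normr0 mulr0 mul0r expr0n/= mulr0 addr0 mulr_ge0.
apply: ler_pM; [exact: mulr_ge0|exact: normr_ge0| |exact: (Kk (x, y))].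
exact: amgm_norm.
Qed.
End schur.

(** * L^2 bounds for separated phases *)

Section weight.
Context {R : realType}.
Notation mu := (@lebesgue_measure R).
Implicit Types (x B t tau beta : R).

(* The cut-off is chosen so that its cosine transform decays quadratically,
   hence is an admissible kernel for the Schur test. *)
Definition bochner_riesz B t : R := \1_`[- B, B] t * (1 - (t / B) ^+ 2).

Lemma bochner_riesz_ge0 B t : 0 < B -> 0 <= bochner_riesz B t.
Proof.
move=> B0; rewrite /bochner_riesz indicE; have [|_] := boolP (_ \in _); last by rewrite mul0r.
rewrite inE/= in_itv/= -ler_norml => tB; rewrite mul1r subr_ge0 -real_normK ?num_real//.
by rewrite expr_le1// normrM normfV (gtr0_norm B0) ler_pdivrMr// mul1r.
Qed.

Lemma bochner_riesz_ge_half B t : 0 < B -> `|t| <= B / 2 -> 2^-1 <= bochner_riesz B t.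
Proof.
move=> B0 tB; rewrite /bochner_riesz indicE mem_set/=; last first.
  by rewrite /= in_itv/= -ler_norml (le_trans tB)//; lra.
rewrite mul1r -real_normK ?num_real// normrM normfV (gtr0_norm B0).
have h : `|t| / B <= 2^-1 by rewrite ler_pdivrMr// mulrC.
have h0 : 0 <= `|t| / B by rewrite mulr_ge0// invr_ge0 ltW.
nra.
Qed.

Lemma bochner_riesz_meas B : measurable_fun setT (bochner_riesz B).
Proof.
apply: measurable_funM; first exact: measurable_indic.
by apply: measurable_funB => //; apply: measurable_funX; exact: measurable_funM.
Qed.

Lemma bochner_riesz_integ B : 0 < B -> integ (bochner_riesz B).
Proof.
move=> B0; apply: (@integ_le _ _ (\1_`[- B, B])); last exact: integ_indic_itv.
  exact: bochner_riesz_meas.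
move=> t; rewrite ger0_norm ?bochner_riesz_ge0// /bochner_riesz ler_piMr//.
  by rewrite lerBlDr lerDl sqr_ge0.
Qed.

Lemma bochner_riesz_le B t : 0 < B -> `|bochner_riesz B t| <= \1_`[- B, B] t.
Proof.
move=> B0; rewrite ger0_norm ?bochner_riesz_ge0// /bochner_riesz ler_piMr//.
  by rewrite lerBlDr lerDl sqr_ge0.
Qed.

Lemma norm_sin_le x : `|sin x| <= `|x|.
Proof.
wlog x0 : x / 0 <= x => [h|].
  have [/h//|/ltW x0] := leP 0 x.
  by have := h (- x); rewrite oppr_ge0 sinN !normrN; exact.
move: x0; rewrite le_eqVlt => /predU1P[<-|x0]; first by rewrite sin0.
have [|c _ ] := @MVT R sin cos 0 x x0 (fun y _ => is_derive_sin y).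
  by apply: continuous_subspaceT => y; exact: continuous_sin.
by rewrite sin0 !subr0 => ->; rewrite normrM ler_piMl// norm_cos_le1.
Qed.

(** Two integrations by parts: the terms carry the weight, its first and its second derivative, over
    tau, tau^2 and tau^3. *)
Let prim B tau beta t : R := (1 - (t / B) ^+ 2) * sin (t * tau + beta) / tau
  - 2 * t / B ^+ 2 * cos (t * tau + beta) / tau ^+ 2
  + 2 * sin (t * tau + beta) / (B ^+ 2 * tau ^+ 3).

Let prim_derive B tau beta t : 0 < B -> tau != 0 ->
  is_derive t 1 (prim B tau beta) ((1 - (t / B) ^+ 2) * cos (t * tau + beta)).
Proof.
move=> B0 t0; apply: is_derive_eq.
rewrite !scaleRE; move: (sin _) (cos _) => S C.
by field; rewrite t0 gt_eqF.
Qed.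

(** The integral is at most 2 B trivially, and at most 8 / (B tau^2) by the primitive, whose
    tau^(-1) term drops out because the weight vanishes at -B and B. Hence its product with 1 + (B
    tau)^2 is at most 2 B + 8 B. *)
Lemma bochner_riesz_kernel B tau beta : 0 < B ->
  `|Int (fun t => bochner_riesz B t * cos (t * tau + beta))| <= 10 * B / (1 + (B * tau) ^+ 2).
Proof.
move=> B0.
have BB : - B <= B by rewrite ge0_cp// ltW.
have mc : measurable_fun setT (fun t => cos (t * tau + beta)).
  apply: (measurableT_comp (@measurable_cosT R)); apply: measurable_funD => //.
  exact: measurable_funM.
have b1 : `|Int (fun t => bochner_riesz B t * cos (t * tau + beta))| <= 2 * B.
  apply: (le_trans (norm_Int_kernel (bochner_riesz_integ B0) mc (fun t => norm_cos_le1 _))).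
  rewrite mul1r; apply: (@le_trans _ _ (Int (\1_`[- B, B]))).
    apply: le_Int.
    - exact: integ_norm (bochner_riesz_integ B0).
    - exact: integ_indic_itv.
    - by move=> t; exact: bochner_riesz_le.
  rewrite (@eq_Int _ _ (fun t => \1_`[- B, B] t * 1)); last by move=> t; rewrite mulr1.
  rewrite Int_indic// Rintegral_cst//= lebesgue_measure_itv/= lte_fin.
  by case: ifPn => _ /=; lra.
rewrite ler_pdivlMr; last by rewrite ltr_pwDl// sqr_ge0.
have [t0|t0] := eqVneq tau 0.
  by rewrite {2}t0 mulr0 expr0n/= addr0 mulr1 (le_trans b1)// ler_pM2r// ler_nat.
have b2 : `|Int (fun t => bochner_riesz B t * cos (t * tau + beta))| <= 8 / (B * tau ^+ 2).
  rewrite (@eq_Int _ _ (fun t => \1_`[- B, B] t * ((1 - (t / B) ^+ 2) * cos (t * tau + beta)))); last first.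
    by move=> t; rewrite /bochner_riesz mulrA.
  rewrite Int_indic//.
  have [|-> _] := Rintegral_FTC BB (fun t _ => prim_derive beta t B0 t0).
    by move=> t _; apply: derivable_cont; apply: ex_derive.
  rewrite /prim mulNr divff ?gt_eqF// sqrrN expr1n subrr !mul0r !add0r.
  set X := (X in `|X| <= _).
  (* The two sines combine into 2 cos beta sin (B tau); the last factor is at most B |tau|, which
     turns tau^(-3) into tau^(-2). *)
  have -> : X = - (2 / (B * tau ^+ 2)) * (cos (B * tau + beta) + cos (- (B * tau) + beta))
      + 2 / (B ^+ 2 * tau ^+ 3) * (2 * cos beta * sin (B * tau)).
    rewrite /X [- B * tau]mulNr.
    rewrite !cosD !sinD cosN sinN.
    move: (sin (B * tau)) (cos (B * tau)) (sin beta) (cos beta) => S C S' C'; field.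
    by rewrite t0 gt_eqF.
  have tt : 0 < tau ^+ 2 by rewrite exprn_even_gt0.
  apply: (le_trans (ler_normD _ _)).
  have -> : 8 / (B * tau ^+ 2) = 2 / (B * tau ^+ 2) * 2 + 4 / (B * tau ^+ 2).
    by field; rewrite t0 gt_eqF.
  apply: lerD.
    rewrite normrM normrN [`|2 / _|]ger0_norm; last by rewrite divr_ge0// mulr_ge0// ltW.
    rewrite ler_wpM2l//; first by rewrite divr_ge0// mulr_ge0// ltW.
    by rewrite (le_trans (ler_normD _ _))// -[leRHS]/(1 + 1) lerD// norm_cos_le1.
  rewrite !normrM.
  have h1 := norm_sin_le (B * tau); have h2 := norm_cos_le1 beta.
  rewrite normfV normrM !normrX (gtr0_norm B0) normr_nat.
  apply: (@le_trans _ _ (2 / (B ^+ 2 * `|tau| ^+ 3) * (2 * 1 * (B * `|tau|)))).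
    rewrite ler_wpM2l//.
      by rewrite divr_ge0// mulr_ge0// ?exprn_ge0// ltW.
    apply: ler_pM => //; last by rewrite -{2}(gtr0_norm B0) -normrM.
    by rewrite ler_wpM2l.
  rewrite -(real_normK (num_real tau)).
  rewrite le_eqVlt; apply/orP; left; apply/eqP; field.
  by rewrite normr_eq0 t0 gt_eqF.
have := b2; rewrite ler_pdivlMr; last by rewrite mulr_gt0// exprn_even_gt0.
move: b1; move: `|Int _| => K b1; rewrite exprMn.
move=> h; have : K * (B * tau ^+ 2) * B <= 8 * B by rewrite ler_wpM2r// ltW.
lra.
Qed.

End weight.

Section separated.
Context {R : realType}.
Notation mu := (@lebesgue_measure R).
Variables (phi beta a : R -> R) (D : set R) (c : R).
Hypotheses (mphi : measurable_fun setT phi) (mbeta : measurable_fun setT beta)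
  (c0 : 0 < c) (sep : forall x y, D x -> D y -> c * `|x - y| <= `|phi x - phi y|)
  (ai : integ a) (aD : forall x, a x != 0 -> D x).

Let Phi (z : R * R) := z.1 * phi z.2 + beta z.2.

Let mPhi : measurable_fun setT Phi.
Proof.
apply: measurable_funD; last by apply: (measurableT_comp mbeta); exact: measurable_snd.
apply: measurable_funM; first exact: measurable_fst.
by apply: (measurableT_comp mphi); exact: measurable_snd.
Qed.

Let Q t := Int (fun x => a x * cos (t * phi x + beta x)) ^+ 2 +
           Int (fun x => a x * sin (t * phi x + beta x)) ^+ 2.

Lemma sep_meas : measurable_fun setT Q.
Proof.
have ma2 : measurable_fun setT (fun z : R * R => a z.2).
  by apply: (measurableT_comp (integ_meas ai)); exact: measurable_snd.
apply: measurable_funD; apply: measurable_funX.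
  apply: (@meas_Int _ _ _ (fun z : R * R => a z.2 * cos (Phi z))).
  by apply: measurable_funM ma2 _; apply: (measurableT_comp (@measurable_cosT R)).
apply: (@meas_Int _ _ _ (fun z : R * R => a z.2 * sin (Phi z))).
by apply: measurable_funM ma2 _; apply: (measurableT_comp (@measurable_sinT R)).
Qed.

Let Q0 t : 0 <= Q t. Proof. by rewrite addr_ge0 ?sqr_ge0. Qed.

(** The TT* kernel at (x, y) is the cosine transform of the weight at phi x - phi y. Separation
    makes it at most a Lorentzian of height 10 B and width 1 / (B c), whose integral 10 pi / c does
    not depend on B. *)
Lemma sep_weight B : 0 < B -> (\int[mu]_t (bochner_riesz B t * Q t)%:E <=
  (10 * pi / c)%:E * \int[mu]_x (a x ^+ 2)%:E)%E.
Proof.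
move=> B0; have wi := bochner_riesz_integ B0.
have Qb t : `|Q t| <= Int (fun x => `|a x|) ^+ 2 + Int (fun x => `|a x|) ^+ 2.
  rewrite ger0_norm// lerD//.
    rewrite -real_normK ?num_real// ler_sqr ?nnegrE ?Int_ge0//.
    have := @norm_Int_kernel _ a (fun x => cos (Phi (t, x))) 1 ai.
    rewrite mul1r; apply; last by move=> x; exact: norm_cos_le1.
    by apply: (measurableT_comp (@measurable_cosT R)); exact: measurable_pair1.
  rewrite -real_normK ?num_real// ler_sqr ?nnegrE ?Int_ge0//.
  have := @norm_Int_kernel _ a (fun x => sin (Phi (t, x))) 1 ai.
  rewrite mul1r; apply; last by move=> x; exact: norm_sin_le1.
  by apply: (measurableT_comp (@measurable_sinT R)); exact: measurable_pair1.
rewrite -EFin_Int; last exact: integMbd wi sep_meas Qb.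
apply: (le_trans (TTstar_le wi ai mPhi)).
pose kap (z : R * R) := 10 * B / (1 + (B * c * (z.2 - z.1)) ^+ 2).
have den0 u : 0 < 1 + u ^+ 2 :> R by rewrite ltr_pwDl// sqr_ge0.
have Kmeas := TTker_meas wi mPhi.
apply: (@schur _ a kap (fun z => TTker (bochner_riesz B) Phi z.1 z.2) (10 * pi / c)) => //.
- exact: integ_meas.
- apply: measurable_funM; first exact: measurable_cst.
  apply: (measurableT_comp (f := fun u : R => (1 + u ^+ 2)^-1)).
    apply: continuous_measurable_fun => u; apply: derivable_cont; apply: derivableV.
      by rewrite gt_eqF.
    exact: ex_derive.
  apply: measurable_funM; first exact: measurable_cst.
  by apply: measurable_funB; [exact: measurable_snd|exact: measurable_fst].
- by move=> z; apply: divr_ge0; [rewrite mulr_ge0// ltW|exact: ltW].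
- move=> x y; rewrite /kap/=; congr (_ / (1 + _)).
  by rewrite -[in RHS]opprB mulrN sqrrN.
- by rewrite divr_ge0 ?mulr_ge0 ?pi_ge0 ?ltW.
- move=> x; rewrite /kap/=.
  rewrite nnintZl; last 3 first.
  + apply: continuous_measurable_fun => u; apply: derivable_cont; apply: derivableV.
      by rewrite gt_eqF.
    exact: ex_derive.
  + by move=> y; rewrite invr_ge0 ltW.
  + by rewrite mulr_ge0// ltW.
  have -> : 10 * pi / c = 10 * B * (pi / (B * c)) by field; rewrite !gt_eqF.
  rewrite [leRHS]EFinM; apply: lee_wpmul2l; first by rewrite lee_fin mulr_ge0// ltW.
  by apply: integral_lorentz_le; rewrite mulr_gt0.
move=> [x y]/= ax ay; rewrite /TTker /kap/=.
rewrite (@eq_Int _ _ (fun t => bochner_riesz B t * cos (t * (phi x - phi y) + (beta x - beta y)))); last first.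
  by move=> t; rewrite /Phi/=; congr (_ * cos _); ring.
apply: (le_trans (bochner_riesz_kernel _ _ B0)).
rewrite ler_wpM2l//; first by rewrite mulr_ge0// ltW.
rewrite lef_pV2 ?posrE// lerD2l.
rewrite -mulrA !exprMn ler_wpM2l ?sqr_ge0// -exprMn.
rewrite -(real_normK (num_real (phi x - phi y))) -(real_normK (num_real (c * _))).
rewrite ler_sqr ?nnegrE// normrM (gtr0_norm c0) distrC.
by apply: sep; exact: aD.
Qed.

(** Uniformity in B lets the cut-off be removed. The weight is at least 1/2 on [-B/2, B/2], whence
    20 instead of 10; B is built from n + 1 in order to be positive for n = 0. *)
Lemma sep_L2 : (\int[mu]_t (Q t)%:E <= (20 * pi / c)%:E * \int[mu]_x (a x ^+ 2)%:E)%E.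
Proof.
have UT : \bigcup_n `[- n%:R, n%:R]%classic = [set: R].
  apply/seteqP; split=> // x _; exists (Num.truncn `|x|).+1 => //=.
  by rewrite in_itv/= -ler_norml ltW// truncnS_gt.
rewrite -[in leLHS]UT; apply: integral_bigcup_le => //.
- exact: sep_meas.
- move=> m n mn; apply/subsetPset => x /=; rewrite !in_itv/= -!ler_norml => h.
  by rewrite (le_trans h)// ler_nat.
move=> n; pose B : R := 2 * n.+1%:R.
have B0 : 0 < B by rewrite mulr_gt0.
apply: (@le_trans _ _ (\int[mu]_t (2 * (bochner_riesz B t * Q t))%:E)%E).
  rewrite integral_mkcond; apply: nnint_le => t; rewrite patchE; case: ifPn => // tn.
  - by rewrite lee_fin.
  - have hB : `|t| <= B / 2.
      move: tn; rewrite inE/= in_itv/= -ler_norml => h; rewrite (le_trans h)//.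
      by rewrite /B mulrAC divff// mul1r ler_nat.
    have := bochner_riesz_ge_half B0 hB; have := Q0 t; rewrite lee_fin mulrA => q0 h.
    by rewrite ler_peMl//; lra.
  (* Outside the interval the restricted integrand takes the default value of the extended reals,
     which is 0. *)
  - have -> : (point : \bar R) = 0%E by [].
    by rewrite lee_fin; apply: mulr_ge0 => //; apply: mulr_ge0 => //; exact: bochner_riesz_ge0.
rewrite nnintZl; last 3 first.
- by apply: measurable_funM sep_meas; exact: bochner_riesz_meas.
- by move=> t; rewrite mulr_ge0// bochner_riesz_ge0.
- by [].
have -> : 20 * pi / c = 2 * (10 * pi / c) by ring.
by rewrite [(2 * (_ / c))%:E]EFinM -muleA; apply: lee_wpmul2l => //; exact: sep_weight.
Qed.

End separated.

(** * The van der Corput estimate *)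

Section vdc.
Context {R : realType}.
Notation mu := (@lebesgue_measure R).
Implicit Types (F f J phi : R -> R) (a b x y z : R).

Lemma derive_MVT F f a b : a <= b ->
  (forall z, a <= z <= b -> is_derive z 1 F (f z)) ->
  exists2 c, a <= c <= b & F b - F a = f c * (b - a).
Proof.
move=> ab dF; have [||c cab ->] := @MVT_segment R F f a b ab.
- by move=> z /[!in_itv]/= /andP[az zb]; apply: dF; rewrite !ltW.
- apply: continuous_in_subspaceT => z; rewrite inE/= in_itv/= => zab.
  by apply: is_derive_cont; exact: dF.
- by exists c => //; rewrite in_itv in cab.
Qed.

Lemma derive_ge0_le F f a b : a <= b ->
  (forall z, a <= z <= b -> is_derive z 1 F (f z)) ->
  (forall z, a <= z <= b -> 0 <= f z) -> F a <= F b.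
Proof.
move=> ab dF f0; have [c cab e] := derive_MVT ab dF.
by rewrite -subr_ge0 e mulr_ge0 ?f0// subr_ge0.
Qed.

(* The derivatives of J - sin phi / phi1 -+ 1 / phi1 are (sin phi +- 1) phi2 / phi1^2:
   since they have a sign, no integral has to be estimated. *)
Lemma vdc_mono J phi (phi1 phi2 : R -> R) a b (l : R) : a <= b -> 0 < l ->
  (forall z, a <= z <= b -> is_derive z 1 J (cos (phi z))) ->
  (forall z, a <= z <= b -> is_derive z 1 phi (phi1 z)) ->
  (forall z, a <= z <= b -> is_derive z 1 phi1 (phi2 z)) ->
  (forall z, a <= z <= b -> l <= `|phi1 z|) ->
  (forall z, a <= z <= b -> 0 <= phi2 z) ->
  `|J b - J a| <= 4 / l.
Proof.
move=> ab l0 dJ dp dp1 hl h2.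
have p0 z : a <= z <= b -> phi1 z != 0.
  by move=> /hl h; rewrite -normr_gt0 (lt_le_trans l0).
have e z : a <= z <= b ->
  is_derive z 1 (fun u => sin (phi u) / phi1 u)
    (cos (phi z) - sin (phi z) * phi2 z / phi1 z ^+ 2).
  move=> zab; have := dp _ zab; have := dp1 _ zab; have := p0 _ zab => q0 d1 d0.
  have dV := is_deriveV q0 d1.
  apply: is_derive_eq; rewrite !scaleRE; field; exact: q0.
have eV z : a <= z <= b -> is_derive z 1 (fun u => (phi1 u)^-1) (- phi2 z / phi1 z ^+ 2).
  move=> zab; have := dp1 _ zab; have := p0 _ zab => q0 d1.
  have dV := is_deriveV q0 d1.
  by apply: is_derive_eq; rewrite !scaleRE; field; exact: q0.
have m1 : J a - sin (phi a) / phi1 a - (phi1 a)^-1 <= J b - sin (phi b) / phi1 b - (phi1 b)^-1.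
  apply: (@derive_ge0_le (fun u => J u - sin (phi u) / phi1 u - (phi1 u)^-1)
    (fun z => (sin (phi z) + 1) * phi2 z / phi1 z ^+ 2)) => // z zab.
    have h1 := dJ _ zab; have h3 := e _ zab; have h4 := eV _ zab.
    by apply: is_derive_eq; ring.
  apply: divr_ge0; last exact: sqr_ge0.
  apply: mulr_ge0; last exact: h2.
  by have := sin_geN1 (phi z); lra.
have m2 : - (J a - sin (phi a) / phi1 a + (phi1 a)^-1) <= - (J b - sin (phi b) / phi1 b + (phi1 b)^-1).
  apply: (@derive_ge0_le (fun u => - (J u - sin (phi u) / phi1 u + (phi1 u)^-1))
    (fun z => (1 - sin (phi z)) * phi2 z / phi1 z ^+ 2)) => // z zab.
    have h1 := dJ _ zab; have h3 := e _ zab; have h4 := eV _ zab.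
    by apply: is_derive_eq; ring.
  apply: divr_ge0; last exact: sqr_ge0.
  apply: mulr_ge0; last exact: h2.
  by have := sin_le1 (phi z); lra.
have aab : a <= a <= b by rewrite lexx ab.
have bab : a <= b <= b by rewrite lexx ab.
have q z : a <= z <= b -> `|(phi1 z)^-1| <= l^-1 /\ `|sin (phi z) / phi1 z| <= l^-1.
  move=> zab; have h : `|(phi1 z)^-1| <= l^-1.
    by rewrite normfV lef_pV2 ?hl// posrE// normr_gt0 p0.
  by split=> //; rewrite normrM (le_trans _ h)// ler_piMl// norm_sin_le1.
have [] := q _ aab; have [] := q _ bab; rewrite !ler_norml.
by move=> /andP[? ?] /andP[? ?] /andP[? ?] /andP[? ?]; apply/andP; split; lra.
Qed.

(** Since the cosine is even, the phase may be replaced by its opposite. *)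
Lemma vdc_monoN J phi (phi1 phi2 : R -> R) a b (l : R) : a <= b -> 0 < l ->
  (forall z, a <= z <= b -> is_derive z 1 J (cos (phi z))) ->
  (forall z, a <= z <= b -> is_derive z 1 phi (phi1 z)) ->
  (forall z, a <= z <= b -> is_derive z 1 phi1 (phi2 z)) ->
  (forall z, a <= z <= b -> l <= `|phi1 z|) ->
  (forall z, a <= z <= b -> phi2 z <= 0) ->
  `|J b - J a| <= 4 / l.
Proof.
move=> ab l0 dJ dp dp1 hl h2.
apply: (@vdc_mono J (fun z => - phi z) (fun z => - phi1 z) (fun z => - phi2 z)) => // z zab.
- by rewrite cosN; exact: dJ.
- by have := dp _ zab => ?; apply: is_derive_eq.
- by have := dp1 _ zab => ?; apply: is_derive_eq.
- by rewrite normrN; exact: hl.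
- by rewrite oppr_ge0; exact: h2.
Qed.

(** The cut points of the range do not depend on b and may lie beyond it. Clipping them at b lets
    the increments telescope without a case analysis on the position of b. *)
Lemma clip_step J p q b (L : R) : 0 <= L -> p <= q ->
  (forall a' b', p <= a' -> a' <= b' -> b' <= q -> `|J b' - J a'| <= L) ->
  `|J (Num.min b q) - J (Num.min b p)| <= L.
Proof.
move=> L0 pq h; have [bp|pb] := leP b p.
  by rewrite !min_l ?subrr ?normr0// (le_trans bp).
apply: h => //; first by rewrite le_min (ltW pb).
by rewrite ge_min lexx orbT.
Qed.

(** For t >= 0 the phase is convex and 0 is its only stationary point: [0, 1/k] is estimated by its
    length, and beyond it the derivative is at least 2 k^2 z >= k. This gives 5 / k; the constant 15
    is the one of the opposite sign. *)
Lemma vdc_pos J (k t b : R) : 0 < k -> 0 <= b -> 0 <= t ->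
  (forall z, 0 <= z -> is_derive z 1 J (cos (t * z ^+ 6 + k ^+ 2 * z ^+ 2))) ->
  `|J b - J 0| <= 15 / k.
Proof.
move=> k0 b0 t0 dJ.
have kV0 : 0 < k^-1 by rewrite invr_gt0.
have len a' b' : 0 <= a' -> a' <= b' -> `|J b' - J a'| <= b' - a'.
  move=> a0 ab; have [|c _ ->] := @derive_MVT J (fun z => cos (t * z ^+ 6 + k ^+ 2 * z ^+ 2)) a' b' ab.
    by move=> z /andP[az _]; apply: dJ; rewrite (le_trans a0).
  by rewrite normrM [X in _ * X]ger0_norm ?subr_ge0// ler_piMl ?subr_ge0// norm_cos_le1.
have h1 : `|J (Num.min b k^-1) - J 0| <= k^-1.
  apply: (le_trans (len _ _ _ _)) => //; first by rewrite le_min b0 ltW.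
  by rewrite subr0 ge_min lexx orbT.
have h2 : `|J b - J (Num.min b k^-1)| <= 4 / k.
  have [bk|kb] := leP b k^-1; first by rewrite subrr normr0 divr_ge0// ltW.
  apply: (@vdc_mono _ (fun z => t * z ^+ 6 + k ^+ 2 * z ^+ 2)
    (fun z => 6 * t * z ^+ 5 + 2 * k ^+ 2 * z) (fun z => 30 * t * z ^+ 4 + 2 * k ^+ 2)) => //.
  - exact: ltW.
  - by move=> z /andP[kz _]; apply: dJ; rewrite (le_trans (ltW kV0)).
  - by move=> z _; apply: is_derive_eq; rewrite !scaleRE; ring.
  - by move=> z _; apply: is_derive_eq; rewrite !scaleRE; ring.
  - move=> z /andP[kz _]; apply: le_trans (ler_norm _).
    have z0 : 0 <= z by rewrite (le_trans (ltW kV0)).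
    have kz1 : 1 <= k * z by rewrite -ler_pdivrMl// mulr1.
    have : 0 <= 6 * t * z ^+ 5 by rewrite !mulr_ge0// exprn_ge0.
    have : k <= k * (k * z) by rewrite ler_peMr// ltW.
    have : 0 <= k * (k * z) by rewrite !mulr_ge0// ltW.
    by rewrite expr2; lra.
  - move=> z _; apply: addr_ge0; last by rewrite mulr_ge0// exprn_even_ge0.
    by apply: mulr_ge0; [exact: mulr_ge0|exact: exprn_even_ge0].
have -> : J b - J 0 = (J b - J (Num.min b k^-1)) + (J (Num.min b k^-1) - J 0) by ring.
by rewrite (le_trans (ler_normD _ _))//; lra.
Qed.

(* With 15 s e0^4 = 3 s e1^4 = k^2, the phase has its inflexion at e0 and its
   stationary point at e1.  Outside of [0, 1/k] and of the 1/k-neighbourhood of e1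
   its derivative is at least k; the remaining range is cut at e0. *)
Lemma vdc_neg J (k s b : R) : 0 < k -> 0 <= b -> 0 < s ->
  (forall z, 0 <= z -> is_derive z 1 J (cos (- s * z ^+ 6 + k ^+ 2 * z ^+ 2))) ->
  `|J b - J 0| <= 15 / k.
Proof.
move=> k0 b0 s0 dJ.
have kV0 : 0 < k^-1 by rewrite invr_gt0.
have len a' b' : 0 <= a' -> a' <= b' -> `|J b' - J a'| <= b' - a'.
  move=> a0 ab; have [|c _ ->] := @derive_MVT J (fun z => cos (- s * z ^+ 6 + k ^+ 2 * z ^+ 2)) a' b' ab.
    by move=> z /andP[az _]; apply: dJ; rewrite (le_trans a0).
  by rewrite normrM [X in _ * X]ger0_norm ?subr_ge0// ler_piMl ?subr_ge0// norm_cos_le1.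
have root4 (u : R) : 0 < u -> exists2 e : R, 0 < e & e ^+ 4 = u.
  move=> u0; exists (Num.sqrt (Num.sqrt u)); first by rewrite !sqrtr_gt0.
  by rewrite (exprM _ 2 2) sqr_sqrtr ?sqrtr_ge0// sqr_sqrtr// ltW.
have [|e0 e00 e0E] := root4 (k ^+ 2 / (15 * s)); first by rewrite divr_gt0 ?exprn_gt0 ?mulr_gt0.
have [|e1 e10 e1E] := root4 (k ^+ 2 / (3 * s)); first by rewrite divr_gt0 ?exprn_gt0 ?mulr_gt0.
have E0 : 15 * s * e0 ^+ 4 = k ^+ 2 by rewrite e0E mulrC divfK// gt_eqF// mulr_gt0.
have E1 : 3 * s * e1 ^+ 4 = k ^+ 2 by rewrite e1E mulrC divfK// gt_eqF// mulr_gt0.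
have lepow (u v : R) : 0 <= u -> 0 <= v -> (u ^+ 4 <= v ^+ 4) = (u <= v).
  by move=> u0 v0; rewrite ler_pXn2r// nnegrE.
(* From e1^4 = 5 e0^4 <= 16 e0^4. Between e0 and e1 this gives z >= e1 / 2, hence a lower bound for
   the derivative in terms of e1. *)
have e01 : e1 <= 2 * e0.
  rewrite -lepow; [|exact: ltW|by rewrite mulr_ge0// ltW].
  rewrite exprMn e0E e1E.
  have -> : k ^+ 2 / (3 * s) = 5 * (k ^+ 2 / (15 * s)) by field; rewrite gt_eqF.
  have : 0 <= k ^+ 2 / (15 * s) by rewrite divr_ge0 ?sqr_ge0// mulr_ge0// ltW.
  lra.
pose p1 := k^-1; pose p2 := Num.max p1 e0; pose p3 := Num.max p2 (e1 - k^-1).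
pose p4 := Num.max p3 (e1 + k^-1).
have p12 : p1 <= p2 by rewrite le_max lexx.
have p23 : p2 <= p3 by rewrite le_max lexx.
have p34 : p3 <= p4 by rewrite le_max lexx.
have d0 z : is_derive z 1 (fun z => - s * z ^+ 6 + k ^+ 2 * z ^+ 2)
    (- 6 * s * z ^+ 5 + 2 * k ^+ 2 * z).
  by apply: is_derive_eq; rewrite !scaleRE; ring.
have d1 z : is_derive z 1 (fun z => - 6 * s * z ^+ 5 + 2 * k ^+ 2 * z)
    (- 30 * s * z ^+ 4 + 2 * k ^+ 2).
  by apply: is_derive_eq; rewrite !scaleRE; ring.
(* Replacing k^2 by 3 s e1^4 exhibits the zero of the derivative at e1. *)
have f1 z : - 6 * s * z ^+ 5 + 2 * k ^+ 2 * z =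
    6 * s * z * ((e1 - z) * ((e1 + z) * (e1 ^+ 2 + z ^+ 2))) by rewrite -E1; ring.
have h1 : `|J (Num.min b p1) - J 0| <= 1 / k.
  apply: (le_trans (len _ _ _ _)) => //; first by rewrite le_min b0 ltW.
  by rewrite subr0 ge_min div1r lexx orbT.
have h2 : `|J (Num.min b p2) - J (Num.min b p1)| <= 4 / k.
  apply: clip_step => //; first by rewrite divr_ge0// ltW.
  move=> a' b' pa ab bp.
  have [ep|pe] := leP e0 p1.
    have -> : a' = b'.
      apply/eqP; rewrite eq_le ab (le_trans bp)//.
      by rewrite /p2 max_l.
    by rewrite subrr normr0 divr_ge0// ltW.
  rewrite /p2 max_r ?(ltW pe)// in bp.
  apply: (vdc_mono ab k0 _ (fun z _ => d0 z) (fun z _ => d1 z)).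
  - by move=> z /andP[az _]; apply: dJ; rewrite (le_trans (ltW kV0))// (le_trans pa).
  - move=> z /andP[az zb]; apply: le_trans (ler_norm _).
    have kz : 1 <= k * z by rewrite -ler_pdivrMl// mulr1 (le_trans pa).
    have z0 : 0 <= z by rewrite (le_trans (ltW kV0))// (le_trans pa).
    have ze : z ^+ 4 <= e0 ^+ 4 by rewrite lepow// ?(ltW e00)// (le_trans zb).
    have h5 : 15 * s * z ^+ 4 <= k ^+ 2 by rewrite -E0 ler_wpM2l// mulr_ge0// ltW.
    have h6 : 6 * s * z ^+ 5 <= k ^+ 2 * z.
      rewrite exprSr mulrA ler_wpM2r//.
      by apply: le_trans h5; rewrite ler_wpM2r ?exprn_ge0// ler_wpM2r ?ler_nat// ltW.
    have h7 : k <= k ^+ 2 * z by rewrite expr2 -mulrA ler_peMr// ltW.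
    by lra.
  - move=> z /andP[az zb].
    have z0 : 0 <= z by rewrite (le_trans (ltW kV0))// (le_trans pa).
    have ze : z ^+ 4 <= e0 ^+ 4 by rewrite lepow// ?(ltW e00)// (le_trans zb).
    have h5 : 15 * s * z ^+ 4 <= k ^+ 2 by rewrite -E0 ler_wpM2l// mulr_ge0// ltW.
    by lra.
have curv z : e0 <= z -> - 30 * s * z ^+ 4 + 2 * k ^+ 2 <= 0.
  move=> ez; have ze : e0 ^+ 4 <= z ^+ 4 by rewrite lepow// ?(ltW e00)// (le_trans (ltW e00)).
  have h5 : k ^+ 2 <= 15 * s * z ^+ 4 by rewrite -E0 ler_wpM2l// mulr_ge0// ltW.
  by lra.
have h3 : `|J (Num.min b p3) - J (Num.min b p2)| <= 4 / k.
  apply: clip_step => //; first by rewrite divr_ge0// ltW.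
  move=> a' b' pa ab bp.
  have [ep|pe] := leP (e1 - k^-1) p2.
    have -> : a' = b'.
      apply/eqP; rewrite eq_le ab (le_trans bp)//.
      by rewrite /p3 max_l.
    by rewrite subrr normr0 divr_ge0// ltW.
  rewrite /p3 max_r ?(ltW pe)// in bp.
  apply: (vdc_monoN ab k0 _ (fun z _ => d0 z) (fun z _ => d1 z)).
  - move=> z /andP[az _]; apply: dJ; rewrite (le_trans (ltW kV0))//.
    by rewrite (le_trans p12)// (le_trans pa).
  - move=> z /andP[az zb]; apply: le_trans (ler_norm _); rewrite f1.
    have ez : e0 <= z by rewrite (le_trans _ az)// (le_trans _ pa)// le_max lexx orbT.
    have z0 : 0 <= z by rewrite (le_trans (ltW e00)).
    have ez1 : e1 / 2 <= z by lra.
    have dz : k^-1 <= e1 - z by have := le_trans zb bp; lra.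
    (* Each factor is bounded below: z by e1 / 2, e1 - z by 1/k, e1 + z by e1 and e1^2 + z^2 by
       e1^2. The product is 3 s e1^4 / k = k. *)
    have -> : k = 6 * s * (e1 / 2) * (k^-1 * (e1 * (e1 ^+ 2))).
      transitivity (3 * s * e1 ^+ 4 * k^-1); last by field; rewrite gt_eqF.
      by rewrite E1 expr2 mulfK// gt_eqF.
    have sq0 : 0 <= e1 ^+ 2 by rewrite sqr_ge0.
    apply: ler_pM.
    + by rewrite !mulr_ge0// ?ltW// invr_ge0.
    + by rewrite !mulr_ge0// ltW.
    + by rewrite ler_wpM2l// mulr_ge0// ltW.
    apply: ler_pM => //; [exact: ltW|by rewrite mulr_ge0// ltW|].
    apply: ler_pM => //; [exact: ltW|by rewrite lerDl|by rewrite lerDl sqr_ge0].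
  - move=> z /andP[az zb]; apply: curv.
    by rewrite (le_trans _ az)// (le_trans _ pa)// le_max lexx orbT.
have h4 : `|J (Num.min b p4) - J (Num.min b p3)| <= 2 / k.
  apply: clip_step => //; first by rewrite divr_ge0// ltW.
  move=> a' b' pa ab bp.
  have pp : 0 <= p3 by rewrite (le_trans (ltW kV0))// (le_trans p12).
  apply: (le_trans (len _ _ _ _)) => //; first exact: le_trans pa.
  have q3 : e1 - k^-1 <= p3 by rewrite le_max lexx orbT.
  have : p4 <= p3 + 2 / k.
    rewrite ge_max; apply/andP; split; last by lra.
    by rewrite lerDl divr_ge0// ltW.
  lra.
have h5 : `|J b - J (Num.min b p4)| <= 4 / k.
  have [bk|kb] := leP b p4; first by rewrite subrr normr0 divr_ge0// ltW.
  have pp : 0 <= p4 by rewrite (le_trans (ltW kV0))// (le_trans p12)// (le_trans p23).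
  apply: (vdc_monoN (ltW kb) k0 _ (fun z _ => d0 z) (fun z _ => d1 z)).
  - by move=> z /andP[az _]; apply: dJ; rewrite (le_trans pp).
  - move=> z /andP[az zb]; rewrite -normrN; apply: le_trans (ler_norm _); rewrite f1.
    have dz : k^-1 <= z - e1.
      have : e1 + k^-1 <= p4 by rewrite le_max lexx orbT.
      by have := az; lra.
    have ez : e1 <= z by lra.
    have z0 : 0 <= z by rewrite (le_trans pp).
    have -> : - (6 * s * z * ((e1 - z) * ((e1 + z) * (e1 ^+ 2 + z ^+ 2)))) =
       6 * s * z * ((z - e1) * ((e1 + z) * (e1 ^+ 2 + z ^+ 2))) by ring.
    have e5 : 6 * s * e1 * (k^-1 * (e1 * (e1 ^+ 2))) = 2 * k.
      transitivity (2 * (3 * s * e1 ^+ 4) * k^-1); first by ring.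
      by rewrite E1 expr2 mulrA mulfK// gt_eqF.
    apply: (@le_trans _ _ (2 * k)); first by lra.
    rewrite -e5; have sq0 : 0 <= e1 ^+ 2 by rewrite sqr_ge0.
    apply: ler_pM.
    + by rewrite !mulr_ge0// ?ltW// invr_ge0.
    + by rewrite !mulr_ge0// ltW.
    + by rewrite ler_wpM2l// mulr_ge0// ltW.
    apply: ler_pM => //; [exact: ltW|by rewrite mulr_ge0// ltW|].
    apply: ler_pM => //; [exact: ltW|by rewrite lerDl|by rewrite lerDl sqr_ge0].
  - move=> z /andP[az zb]; apply: curv; rewrite (le_trans _ az)//.
    by rewrite (le_trans _ p34)// (le_trans _ p23)// le_max lexx orbT.
have -> : J b - J 0 = (J b - J (Num.min b p4)) + ((J (Num.min b p4) - J (Num.min b p3)) +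
  ((J (Num.min b p3) - J (Num.min b p2)) + ((J (Num.min b p2) - J (Num.min b p1)) +
  (J (Num.min b p1) - J 0)))) by ring.
(* The constant is 15 = 1 + 4 + 4 + 2 + 4: lengths 1/k and 2/k where the phase is nearly stationary,
   and 4/k for each monotone piece. *)
apply: (@le_trans _ _ (4 / k + (2 / k + (4 / k + (4 / k + 1 / k))))); last by lra.
by do 4 (apply: (le_trans (ler_normD _ _)); apply: lerD => //).
Qed.

Lemma vdc_bound J (x t b : R) : x != 0 -> 0 <= b ->
  (forall z, 0 <= z -> is_derive z 1 J (cos (t * z ^+ 6 + x * z ^+ 2))) ->
  `|J b - J 0| <= 15 / Num.sqrt `|x|.
Proof.
move=> x0 b0.
wlog xp : x t x0 / 0 < x => [h dJ|dJ].
  have [xp|xn] := ltP 0 x; first exact: (h x t).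
  have -> : `|x| = `|- x| by rewrite normrN.
  apply: (h (- x) (- t)); first by rewrite oppr_eq0.
    by rewrite oppr_gt0 lt_neqAle x0.
  by move=> z z0; rewrite -cosN opprD !mulNr !opprK; exact: dJ.
rewrite (gtr0_norm xp).
have k0 : 0 < Num.sqrt x by rewrite sqrtr_gt0.
have k2 : Num.sqrt x ^+ 2 = x by rewrite sqr_sqrtr// ltW.
have [t0|t0] := leP 0 t.
  by apply: (vdc_pos k0 b0 t0) => z z0; rewrite k2; exact: dJ.
apply: (@vdc_neg J _ (- t)) => //; first by rewrite oppr_gt0.
by move=> z z0; rewrite k2 opprK; exact: dJ.
Qed.

End vdc.

(** * The kernel of |D|^(-1/2) e^(-t d_x^3) *)

Section kernel.
Context {R : realType}.
Notation mu := (@lebesgue_measure R).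
Implicit Types (x y z a b : R).

(* The substitution xi = z^2 turns |xi|^(-1/2) cos (t xi^3 + x xi) dxi into
   2 cos (t z^6 + x z^2) dz.  The primitive starts at -1, and not at 0, in order to be
   differentiable at 0. *)
Definition vdcJ (t x y : R) : R :=
  Rintegral mu `[-1, y] (fun z => cos (t * z ^+ 6 + x * z ^+ 2)).

Lemma vdcJ_derive t x y : 0 <= y ->
  is_derive y 1 (vdcJ t x) (cos (t * y ^+ 6 + x * y ^+ 2)).
Proof.
move=> y0.
have cf z : {for z, continuous (fun z => cos (t * z ^+ 6 + x * z ^+ 2))}.
  by apply: derivable_cont; exact: ex_derive.
have [] := @continuous_FTC1_closed R (fun z => cos (t * z ^+ 6 + x * z ^+ 2)) (-1) y (y + 1).
- by rewrite ltrDl.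
- apply: continuous_compact_integrable; first exact: segment_compact.
  by apply: continuous_in_subspaceT => z _; exact: cf.
- by rewrite (lt_le_trans _ y0)// oppr_lt0.
- exact: cf.
by move=> h1 h2; rewrite -h2 derive1E; exact: derivableP.
Qed.

Lemma vdcJ_bound t (x a b : R) : x != 0 -> 0 <= a -> 0 <= b ->
  `|vdcJ t x b - vdcJ t x a| <= 30 / Num.sqrt `|x|.
Proof.
move=> x0 a0 b0.
have -> : vdcJ t x b - vdcJ t x a = (vdcJ t x b - vdcJ t x 0) - (vdcJ t x a - vdcJ t x 0) by ring.
apply: (le_trans (ler_normB _ _)).
have h := vdc_bound x0 _ (vdcJ_derive t x).
have := h _ a0; have := h _ b0; lra.
Qed.

(** |xi|^(-1/2), with value 0 at 0. It serves in frequency as the weight and in space as the bound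
    on the TT* kernel. *)
Definition ws (xi : R) : R := (Num.sqrt `|xi|)^-1.

Lemma ws_ge0 xi : 0 <= ws xi.
Proof. by rewrite invr_ge0 sqrtr_ge0. Qed.

Lemma ws_meas : measurable_fun setT ws.
Proof.
have ms : measurable_fun setT (fun xi : R => Num.sqrt `|xi|).
  apply: continuous_measurable_fun => z; apply: continuous_comp; first exact: norm_continuous.
  exact: sqrt_continuous.
rewrite (_ : ws = fun xi => (Num.sqrt `|xi|) `^ (-1)); last first.
  by apply/funext => xi; rewrite powR_inv1// sqrtr_ge0.
exact: (measurableT_comp (measurable_powR _) ms).
Qed.

Lemma ws_pos_derive (t x xi : R) : 0 < xi -> is_derive xi 1 (fun z => 2 * vdcJ t x (Num.sqrt z))
  (ws xi * cos (t * xi ^+ 3 + x * xi)).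
Proof.
move=> xi0; rewrite /ws gtr0_norm//.
have s0 : 0 < Num.sqrt xi by rewrite sqrtr_gt0.
have d1 := vdcJ_derive t x (ltW s0).
have d2 := is_derive1_sqrt xi0.
have d3 := is_derive1_comp d1 d2.
have d4 : is_derive xi 1 (fun z => vdcJ t x (Num.sqrt z))
  ((2 * Num.sqrt xi)^-1 * cos (t * Num.sqrt xi ^+ 6 + x * Num.sqrt xi ^+ 2)).
  by rewrite mulrC; exact: d3.
apply: is_derive_eq; rewrite !scaleRE.
rewrite (exprM _ 2 3) sqr_sqrtr ?ltW//.
by rewrite invfM mulrA mulrA divff// mul1r.
Qed.

Lemma ws_neg_derive (t x xi : R) : xi < 0 -> is_derive xi 1 (fun z => - 2 * vdcJ t x (Num.sqrt (- z)))
  (ws xi * cos (t * xi ^+ 3 + x * xi)).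
Proof.
move=> xi0; have h : 0 < - xi by rewrite oppr_gt0.
have d1 := ws_pos_derive t x h.
have d2 : is_derive xi 1 (fun z : R => - z) (-1) by apply: is_derive_eq.
have d3 := is_derive1_comp d1 d2.
have d4 : is_derive xi 1 (fun z => 2 * vdcJ t x (Num.sqrt (- z)))
  (- (ws xi * cos (t * xi ^+ 3 + x * xi))).
  apply: is_derive_eq d3 _; rewrite /ws normrN mulrN1; congr (- (_ * _)).
  by rewrite -cosN; congr cos; ring.
have -> : (fun z => - 2 * vdcJ t x (Num.sqrt (- z))) = (fun z => - (2 * vdcJ t x (Num.sqrt (- z)))).
  by apply/funext => z; rewrite mulNr.
by apply: is_derive_eq; rewrite opprK.
Qed.

Lemma ws_cont xi : xi != 0 -> {for xi, continuous ws}.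
Proof.
move=> x0; apply: cvgV; first by rewrite gt_eqF// sqrtr_gt0 normr_gt0.
by apply: continuous_comp; [exact: norm_continuous|exact: sqrt_continuous].
Qed.

Lemma wscos_cont t x xi : xi != 0 -> {for xi, continuous (fun z => ws z * cos (t * z ^+ 3 + x * z))}.
Proof.
move=> x0; apply: cvgM; first exact: ws_cont.
by apply: derivable_cont; exact: ex_derive.
Qed.

Lemma ws_pos_bound t (x a b : R) : x != 0 -> 0 < a -> a <= b ->
  `|Rintegral mu `[a, b] (fun z => ws z * cos (t * z ^+ 3 + x * z))| <= 60 / Num.sqrt `|x|.
Proof.
move=> x0 a0 ab.
have [|z /andP[az _]|-> _] := @Rintegral_FTC R (fun z => ws z * cos (t * z ^+ 3 + x * z))
  (fun z => 2 * vdcJ t x (Num.sqrt z)) a b ab.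
- by move=> z /andP[az _]; apply: ws_pos_derive; exact: lt_le_trans az.
- by apply: wscos_cont; rewrite gt_eqF// (lt_le_trans a0).
rewrite -mulrBr normrM normr_nat.
by have := @vdcJ_bound t x _ _ x0 (sqrtr_ge0 a) (sqrtr_ge0 b); lra.
Qed.

Lemma ws_neg_bound t (x a b : R) : x != 0 -> b < 0 -> a <= b ->
  `|Rintegral mu `[a, b] (fun z => ws z * cos (t * z ^+ 3 + x * z))| <= 60 / Num.sqrt `|x|.
Proof.
move=> x0 b0 ab.
have [|z /andP[_ zb]|-> _] := @Rintegral_FTC R (fun z => ws z * cos (t * z ^+ 3 + x * z))
  (fun z => - 2 * vdcJ t x (Num.sqrt (- z))) a b ab.
- by move=> z /andP[_ zb]; apply: ws_neg_derive; exact: le_lt_trans b0.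
- by apply: wscos_cont; rewrite lt_eqF// (le_lt_trans zb).
rewrite -mulrBr normrM normrN normr_nat.
by have := @vdcJ_bound t x _ _ x0 (sqrtr_ge0 (- a)) (sqrtr_ge0 (- b)); lra.
Qed.

(** The primitive 2 sqrt is not differentiable at 0, so the interval is exhausted by sets [D n] that
    avoid (-1/(n+1), 1/(n+1)); the missing point contributes nothing. *)
Lemma ws_int_le (d : R) : 0 <= d -> (\int[mu]_x (\1_`[- d, d] x * ws x)%:E <= (4 * Num.sqrt d)%:E)%E.
Proof.
move=> d0.
pose D (n : nat) := `[n.+1%:R^-1, d]%classic `|` `[- d, - n.+1%:R^-1]%classic : set R.
have nV n : 0 < n.+1%:R^-1 :> R by rewrite invr_gt0.
have DE : \bigcup_n D n = `[- d, d] `\ 0.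
  apply/seteqP; split=> [x [n _]|x /=].
    rewrite /D/= !in_itv/= => -[|] /andP[h1 h2].
      have x0 := lt_le_trans (nV n) h1; split; last by apply/eqP; rewrite gt_eqF.
      by rewrite h2 andbT (le_trans _ (ltW x0))// oppr_le0.
    have x0 : x < 0 by rewrite (le_lt_trans h2)// oppr_lt0.
    split; last by apply/eqP; rewrite lt_eqF.
    by rewrite h1/= (le_trans (ltW x0)).
  rewrite in_itv/= => -[/andP[h1 h2] /eqP x0].
  have nx : 0 < `|x| by rewrite normr_gt0.
  exists (Num.truncn `|x|^-1) => //; rewrite /D/= !in_itv/=.
  have h : (Num.truncn `|x|^-1).+1%:R^-1 <= `|x|.
    by rewrite invf_ple ?posrE// ltW// truncnS_gt.
  have [x1|x1] := leP 0 x; [left|right].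
    by move: h; rewrite (ger0_norm x1) h2 => ->.
  by move: h; rewrite (ltr0_norm x1) h1/= lerNr => ->.
have -> : (\int[mu]_x (\1_`[- d, d] x * ws x)%:E = \int[mu]_(x in \bigcup_n D n) (ws x)%:E)%E.
  rewrite [RHS]integral_mkcond; apply: eq_integral => x _; rewrite patchE DE.
  have [->|x0] := eqVneq x 0.
    by rewrite /ws normr0 sqrtr0 invr0 mulr0; case: ifP.
  rewrite indicE; case: ifPn => [|h].
    by rewrite inE/= => -[h _]; rewrite mem_set// mul1r.
  rewrite memNset ?mul0r//; apply: contraNnot h => h.
  by rewrite inE; split => //; exact/eqP.
apply: integral_bigcup_le.
- exact: ws_meas.
- exact: ws_ge0.
- by move=> n; apply: measurableU.
- move=> m n mn; apply/subsetPset => x; rewrite /D/= !in_itv/=.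
  have h : n.+1%:R^-1 <= m.+1%:R^-1 :> R by rewrite lef_pV2 ?posrE// ler_nat.
  move=> [|] /andP[h1 h2]; [left|right]; rewrite ?h1 ?h2 ?andbT/=.
    exact: le_trans h1.
  by apply: (le_trans h2); rewrite lerN2.
move=> n; rewrite ge0_integral_setU//; last 3 first.
- by apply/measurable_EFinP/measurable_funTS; exact: ws_meas.
- by move=> x _; rewrite lee_fin ws_ge0.
- apply/disj_setPS => x [/=]; rewrite !in_itv/= => /andP[h1 _] /andP[_ h2].
  have h3 : n.+1%:R^-1 <= - n.+1%:R^-1 :> R := le_trans h1 h2.
  by move: (nV n) h3; move: (n.+1%:R^-1) => u; lra.
have -> : 4 * Num.sqrt d = 2 * Num.sqrt d + 2 * Num.sqrt d by lra.
rewrite EFinD; apply: leeD.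
  have [nd|dn] := leP n.+1%:R^-1 d; last first.
    by rewrite set_itv_ge ?integral_set0 ?lee_fin ?mulr_ge0 ?sqrtr_ge0// bnd_simp -ltNge.
  have dF z : n.+1%:R^-1 <= z <= d -> is_derive z 1 (fun z => 2 * Num.sqrt z) (ws z).
    move=> /andP[nz _]; have z0 := lt_le_trans (nV n) nz.
    have d1 := is_derive1_sqrt z0.
    apply: is_derive_eq; rewrite !scaleRE /ws (gtr0_norm z0) invfM mulrA divff// mul1r//.
  have [|e i] := Rintegral_FTC nd dF.
    by move=> z /andP[nz _]; apply: ws_cont; rewrite gt_eqF// (lt_le_trans (nV n)).
  rewrite -[leLHS]fineK; last exact: (integrable_fin_num _ i).
  rewrite lee_fin -/(Rintegral _ _ _) e lerBlDr lerDl mulr_ge0// sqrtr_ge0.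
have [nd|dn] := leP (- d) (- n.+1%:R^-1); last first.
  by rewrite set_itv_ge ?integral_set0 ?lee_fin ?mulr_ge0 ?sqrtr_ge0// bnd_simp -ltNge.
have dF z : - d <= z <= - n.+1%:R^-1 -> is_derive z 1 (fun z => - 2 * Num.sqrt (- z)) (ws z).
  move=> /andP[_ nz]; have z0 : 0 < - z by rewrite oppr_gt0 (le_lt_trans nz)// oppr_lt0.
  have d1 := is_derive1_sqrt z0.
  have d2 : is_derive z 1 (fun z : R => - z) (-1) by apply: is_derive_eq.
  have d3 := is_derive1_comp d1 d2.
  have d4 : is_derive z 1 (fun z => Num.sqrt (- z)) ((2 * Num.sqrt (- z))^-1 * -1) by exact: d3.
  apply: is_derive_eq; rewrite !scaleRE /ws -(normrN z) (gtr0_norm z0) invfM.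
  by rewrite mulrN1 mulrNN mulrA divff// mul1r.
have [|e i] := Rintegral_FTC nd dF.
  by move=> z /andP[_ nz]; apply: ws_cont; rewrite lt_eqF// (le_lt_trans nz)// oppr_lt0.
rewrite -[leLHS]fineK; last exact: (integrable_fin_num _ i).
rewrite lee_fin -/(Rintegral _ _ _) e !opprK.
by have := sqrtr_ge0 (n.+1%:R^-1 : R); move: (Num.sqrt (n.+1%:R^-1)) => u; lra.
Qed.

Lemma ws_integ (d : R) : integ (fun x => \1_`[- d, d] x * ws x).
Proof.
have [d0|d0] := leP 0 d; last first.
  apply: (@eq_integ _ (fun=> 0)); last exact: integrable0.
  by move=> x; rewrite set_itv_ge ?indic0 ?mul0r// bnd_simp -ltNge; lra.
apply: integ_ge0P.
- by apply: measurable_funM; [exact: measurable_indic|exact: ws_meas].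
- by move=> x; rewrite mulr_ge0 ?ws_ge0//; have /andP[] := @indic_le1 R `[- d, d]%classic x.
- by rewrite (le_lt_trans (ws_int_le d0))// ltry.
Qed.

Lemma Rintegral_split (a b c : R) (f : R -> R) : a <= b -> b <= c ->
  mu.-integrable `[a, c] (EFin \o f) ->
  Rintegral mu `[a, c] f = Rintegral mu `[a, b] f + Rintegral mu `[b, c] f.
Proof.
move=> ab bc fi.
have := @Rintegral_itvB R f (BLeft a) (BRight c) b fi; rewrite !bnd_simp => /(_ ab bc).
rewrite Rintegral_itv_obnd_cbnd; first by move=> <-; ring.
by apply: integrableS fi => // z /=; rewrite !in_itv/= => /andP[/ltW bz ->]; rewrite (le_trans ab).
Qed.

Definition wsB (B xi : R) : R := \1_`[- B, B] xi * ws xi.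

(** 2 pi times the kernel of |D|^(-1/2) e^(-t d_x^3) cut at |xi| <= B. The phase is odd and the
    weight even, so that no sine part appears. *)
Definition airy_kernel (B t x : R) : R := Int (fun xi => wsB B xi * cos (t * xi ^+ 3 + x * xi)).

(** The cut at [e] stays away from 0, where the primitive is singular, and [e] <= 1/|x| makes the
    weight over [-e, e] contribute at most 4 / sqrt |x|. The two outer pieces contribute 60 each,
    hence 124, for all B and t. *)
Lemma airy_kernel_bound (B t x : R) : 0 < B -> x != 0 ->
  `|airy_kernel B t x| <= 124 / Num.sqrt `|x|.
Proof.
move=> B0 x0; pose f xi := ws xi * cos (t * xi ^+ 3 + x * xi).
have mc : measurable_fun setT (fun xi : R => cos (t * xi ^+ 3 + x * xi)).
  by apply: continuous_measurable_fun => z; apply: derivable_cont; exact: ex_derive.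
have s0 : 0 < Num.sqrt `|x| by rewrite sqrtr_gt0 normr_gt0.
pose e := Num.min B `|x|^-1.
have e0 : 0 < e by rewrite lt_min B0 invr_gt0 normr_gt0.
have eB : e <= B by rewrite ge_min lexx.
have ex : Num.sqrt e <= (Num.sqrt `|x|)^-1.
  by rewrite -sqrtrV// ler_wsqrtr// ge_min lexx orbT.
have near0 : `|Int (fun xi => \1_`[- e, e] xi * f xi)| <= 4 / Num.sqrt `|x|.
  rewrite (@eq_Int _ _ (fun xi => \1_`[- e, e] xi * ws xi * cos (t * xi ^+ 3 + x * xi))); last first.
    by move=> xi; rewrite /f mulrA.
  apply: (le_trans (norm_Int_kernel (ws_integ e) mc (fun=> norm_cos_le1 _))).
  rewrite mul1r -lee_fin EFin_Int; last exact/integ_norm/ws_integ.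
  apply: (@le_trans _ _ (4 * Num.sqrt e)%:E).
    apply: le_trans (ws_int_le (ltW e0)); rewrite le_eqVlt; apply/orP; left; apply/eqP.
    apply: eq_integral => xi _; rewrite ger0_norm//.
    by apply: mulr_ge0; [have /andP[] := @indic_le1 R `[- e, e]%classic xi|exact: ws_ge0].
  by rewrite lee_fin ler_wpM2l.
have fi a b : - B <= a -> b <= B -> mu.-integrable `[a, b] (EFin \o f).
  move=> Ba bB; apply: (@integrableS _ _ _ mu `[- B, B]%classic) => //.
    by move=> z /=; rewrite !in_itv/= => /andP[h1 h2]; rewrite (le_trans Ba h1) (le_trans h2).
  apply/integ_indic => //.
  apply: (@eq_integ _ (fun xi => \1_`[- B, B] xi * ws xi * cos (t * xi ^+ 3 + x * xi))).
    by move=> xi; rewrite /f -[LHS]mulrA.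
  exact: integMbd (ws_integ B) mc (fun=> norm_cos_le1 _).
have -> : airy_kernel B t x = Rintegral mu `[- B, - e] f + Rintegral mu `[e, B] f +
    Int (fun xi => \1_`[- e, e] xi * f xi).
  rewrite /airy_kernel (@eq_Int _ _ (fun xi => \1_`[- B, B] xi * f xi)); last first.
    by move=> xi; rewrite /f /wsB -[LHS]mulrA.
  rewrite !Int_indic// (@Rintegral_split (- B) (- e) B)//; last 3 first.
  - by rewrite lerN2.
  - by rewrite (le_trans _ eB)// ge0_cp// ltW.
  - exact: fi.
  rewrite (@Rintegral_split (- e) e B)//; last 2 first.
  - by rewrite ge0_cp// ltW.
  - by apply: fi => //; rewrite lerN2.
  by rewrite addrA [RHS]addrAC.
apply: (le_trans (ler_normD _ _)).
have h1 : `|Rintegral mu `[- B, - e] f| <= 60 / Num.sqrt `|x|.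
  by apply: ws_neg_bound => //; [rewrite oppr_lt0|rewrite lerN2].
have h2 : `|Rintegral mu `[e, B] f| <= 60 / Num.sqrt `|x| by exact: ws_pos_bound.
have := ler_normD (Rintegral mu `[- B, - e] f) (Rintegral mu `[e, B] f).
lra.
Qed.

End kernel.

(** * Fractional integration *)

Section hls.
Context {R : realType}.
Notation mu := (@lebesgue_measure R).
Implicit Types (x y a b : R).

Lemma lebesgue_measure_shift x (A : set R) : measurable A ->
  pushforward mu (fun y : measurableTypeR R => y - x : measurableTypeR R) A = mu A.
Proof.
move=> mA; apply/esym/lebesgue_measure_unique => //=.
  by apply: measurable_funB => //; exact: measurable_cst.
move=> _ mphi [[a b]] _ <-.
rewrite /pushforward.
rewrite (_ : _ @^-1` _ = `]a + x, b + x]%classic); last first.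
  by apply/seteqP; split=> y /=; rewrite !in_itv/= ltrBrDr lerBlDr.
rewrite !lebesgue_measure_itv/= !lte_fin ltrD2r.
by case: ifP => // _; rewrite -!EFinB; congr EFin; ring.
Qed.

Lemma ge0_integral_shift x (f : R -> \bar R) : measurable_fun setT f -> (forall y, 0 <= f y)%E ->
  (\int[mu]_y f (y - x)%R = \int[mu]_y f y)%E.
Proof.
move=> mf f0.
have mphi : measurable_fun setT (fun y : measurableTypeR R => y - x : measurableTypeR R).
  by apply: measurable_funB => //; exact: measurable_cst.
have := @ge0_integral_pushforward _ _ _ _ R _ mphi mu setT f measurableT mf (fun y _ => f0 y).
rewrite preimage_setT => <-.
by apply: eq_measure_integral => //= A mA _; exact: lebesgue_measure_shift.
Qed.

(** According to whether [v] or [l * u] is larger, one term alone suffices. The exponents are chosen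
    for v = |z|^(-1/2), whose fourth power z^(-2) is integrable at infinity. *)
Lemma young3 (u v l : R) : 0 <= u -> 0 <= v -> 0 < l ->
  u ^+ 3 * v <= l * u ^+ 4 + v ^+ 4 / l ^+ 3.
Proof.
move=> u0 v0 l0; have [h|h] := leP v (l * u).
  apply: (@le_trans _ _ (u ^+ 3 * (l * u))); first by rewrite ler_wpM2l ?exprn_ge0.
  have -> : u ^+ 3 * (l * u) = l * u ^+ 4 by ring.
  by rewrite lerDl divr_ge0 ?exprn_ge0// ltW.
apply: (@le_trans _ _ (v ^+ 4 / l ^+ 3)); last by rewrite lerDr mulr_ge0 ?exprn_ge0// ltW.
rewrite ler_pdivlMr ?exprn_gt0//.
have -> : u ^+ 3 * v * l ^+ 3 = (l * u) ^+ 3 * v by ring.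
rewrite [v ^+ 4]exprSr ler_wpM2r// lerXn2r ?nnegrE//; first by rewrite mulr_ge0// ltW.
exact: ltW.
Qed.
Lemma ws4 (z : R) : ws z ^+ 4 = (z ^+ 2)^-1.
Proof.
by rewrite /ws exprVn (exprM _ 2 2) sqr_sqrtr// real_normK ?num_real.
Qed.

Variable h : R -> R.
Hypotheses (mh : measurable_fun setT h) (h0 : forall x, 0 <= h x).
Variable J : R.
Hypotheses (J0 : 0 < J) (hJ : (\int[mu]_x (h x ^+ 4)%:E <= (J ^+ 2)%:E)%E).

Let cst : R := 5 + 2 * pi.

(* The integral is split at |y - x| = J^2 / H^4: the bound H is used inside, and
   Young's inequality with h in L^4 outside. *)
Lemma hls_point x H : 0 < H ->
  (\int[mu]_y (Num.min (h y) H ^+ 3 * ws (y - x))%:E <= (cst * H * J)%:E)%E.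
Proof.
(* With these parameters the three contributions are multiples of H J: 4 H^3 sqrt d = 4 H J inside,
   l J^2 = H J from h^4, and 2 pi / (d l^3) = 2 pi H J from the tail. Their sum is [cst * H * J]. *)
move=> H0; pose d := J ^+ 2 / H ^+ 4; pose l := H / J.
have d0 : 0 < d by rewrite divr_gt0 ?exprn_gt0.
have l0 : 0 < l by rewrite divr_gt0.
pose f1 y := \1_`[- d, d] y * ws y.
pose f2 y := (1 + (d^-1 * (y - x)) ^+ 2)^-1.
have mf1 : measurable_fun setT f1.
  by apply: measurable_funM; [exact: measurable_indic|exact: ws_meas].
have mf1x : measurable_fun setT (fun y => f1 (y - x)).
  by apply: (measurableT_comp mf1); apply: measurable_funB => //.
have f10 y : 0 <= f1 y.
  by apply: mulr_ge0; [have /andP[] := @indic_le1 R `[- d, d]%classic y|exact: ws_ge0].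
have den u : 0 < 1 + u ^+ 2 :> R by rewrite ltr_pwDl// sqr_ge0.
have f20 y : 0 <= f2 y by rewrite invr_ge0 ltW.
have mf2 : measurable_fun setT f2.
  apply: continuous_measurable_fun => u; apply: derivable_cont; apply: derivableV.
    by rewrite gt_eqF.
  exact: ex_derive.
have mh4 : measurable_fun setT (fun y => h y ^+ 4) by exact: measurable_funX.
have h40 y : 0 <= h y ^+ 4 by rewrite exprn_ge0.
pose c2 := 2 / (d ^+ 2 * l ^+ 3).
have c20 : 0 <= c2 by rewrite divr_ge0// mulr_ge0// exprn_ge0// ltW.
apply: (@le_trans _ _ (\int[mu]_y (H ^+ 3 * f1 (y - x) + (l * h y ^+ 4 + c2 * f2 y))%:E)%E).
  apply: nnint_le => y; rewrite lee_fin; first by rewrite mulr_ge0 ?ws_ge0// exprn_ge0// le_min h0 ltW.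
  set m := Num.min _ _.
  have m0 : 0 <= m by rewrite le_min h0 ltW.
  have [zd|dz] := leP `|y - x| d.
    have -> : f1 (y - x) = ws (y - x).
      by rewrite /f1 indicE mem_set ?mul1r//= in_itv/= -ler_norml.
    apply: (@le_trans _ _ (H ^+ 3 * ws (y - x))).
      by rewrite ler_wpM2r ?ws_ge0// lerXn2r ?nnegrE ?(ltW H0)// ge_min lexx orbT.
    by rewrite lerDl addr_ge0// mulr_ge0// ltW.
  apply: (@le_trans _ _ (l * h y ^+ 4 + c2 * f2 y)); last by rewrite lerDr mulr_ge0// exprn_ge0// ltW.
  apply: (@le_trans _ _ (h y ^+ 3 * ws (y - x))).
    by rewrite ler_wpM2r ?ws_ge0// lerXn2r ?nnegrE// ge_min lexx.
  apply: (le_trans (young3 (h0 y) (ws_ge0 _) l0)); rewrite lerD2l ws4 /c2 /f2.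
  set z := y - x; have zz : d ^+ 2 <= z ^+ 2.
    by rewrite -(real_normK (num_real z)) lerXn2r ?nnegrE// ltW.
  have d2 : 0 < d ^+ 2 by rewrite exprn_gt0.
  have z2 : 0 < z ^+ 2 := lt_le_trans d2 zz.
  (* As |z| > d, z^(-2) is at most 2 / (d^2 + z^2), a multiple of the Lorentzian of width d. *)
  have -> : 2 / (d ^+ 2 * l ^+ 3) * (1 + (d^-1 * z) ^+ 2)^-1 = 2 / (d ^+ 2 + z ^+ 2) / l ^+ 3.
    by field; rewrite !gt_eqF//= addr_gt0.
  apply: ler_wpM2r; first by rewrite invr_ge0 exprn_ge0// ltW.
  rewrite -[leLHS]div1r ler_pdivrMr// mulrAC ler_pdivlMr; last by rewrite addr_gt0.
  lra.
rewrite nnintD; last 4 first.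
- by apply: measurable_funM mf1x.
- by apply: measurable_funD; apply: measurable_funM => //.
- by move=> y; rewrite mulr_ge0// exprn_ge0// ltW.
- by move=> y; rewrite addr_ge0// mulr_ge0// ltW.
rewrite nnintD; last 4 first.
- by apply: measurable_funM mh4.
- by apply: measurable_funM mf2.
- by move=> y; rewrite mulr_ge0// ltW.
- by move=> y; rewrite mulr_ge0.
rewrite (nnintZl mf1x)//; last by rewrite exprn_ge0// ltW.
rewrite (nnintZl mh4)//; last exact: ltW.
rewrite (nnintZl mf2)//.
rewrite (@ge0_integral_shift x (fun y => (f1 y)%:E)); last 2 first.
- exact/measurable_EFinP.
- by move=> y; rewrite lee_fin.
have sd : Num.sqrt d = J / H ^+ 2.
  have -> : d = (J / H ^+ 2) ^+ 2 by rewrite /d exprMn exprVn -exprM.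
  by rewrite sqrtr_sqr ger0_norm// divr_ge0 ?exprn_ge0// ltW.
have -> : cst * H * J = H ^+ 3 * (4 * Num.sqrt d) + (l * J ^+ 2 + c2 * (pi / d^-1)).
  by rewrite sd /c2 /cst /d /l; field; rewrite !gt_eqF.
rewrite !EFinD; apply: leeD.
  rewrite [leRHS]EFinM; apply: lee_wpmul2l; last exact/ws_int_le/ltW.
  by rewrite lee_fin exprn_ge0// ltW.
apply: leeD.
  by rewrite [leRHS]EFinM; apply: lee_wpmul2l => //; rewrite lee_fin ltW.
rewrite [leRHS]EFinM; apply: lee_wpmul2l; first by rewrite lee_fin.
by apply: integral_lorentz_le; rewrite invr_gt0.
Qed.

(** The kernel is bounded off the diagonal only; for fixed x the diagonal is one point, a null
    set. *)
Lemma integral_ne_le x (f g : R -> R) : measurable_fun setT f -> measurable_fun setT g ->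
  (forall y, 0 <= f y) -> (forall y, 0 <= g y) -> (forall y, y != x -> f y <= g y) ->
  (\int[mu]_y (f y)%:E <= \int[mu]_y (g y)%:E)%E.
Proof.
move=> mf mg f0 g0 fg.
have mD : measurable (setT `\ x : set R) by apply: measurableD => //; exact: measurable_set1.
rewrite -(@integral_setD1 _ (fun y => (f y)%:E) x setT) //; last first.
  by apply/measurable_funTS/measurable_EFinP.
rewrite integral_mkcond; apply: nnint_le => y; rewrite patchE; case: ifPn => //.
- by rewrite lee_fin.
- by rewrite inE/= => -[_ /eqP yx]; rewrite lee_fin fg.
- by move=> _; have -> : (point : \bar R) = 0%E by []; rewrite lee_fin.
Qed.

Variables (kap : R * R -> R) (c : R).
Hypotheses (mk : measurable_fun setT kap) (k0 : forall z : R * R, 0 <= kap z)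
  (c0 : 0 <= c) (kc : forall x y, y != x -> kap (x, y) <= c * ws (y - x)).

(* By symmetry, h y <= h x may be assumed; then h y = min (h y) (h x) and
   hls_point applies with H = h x. *)
Lemma hls : (\int[mu]_x \int[mu]_y (h x ^+ 3 * h y ^+ 3 * kap (x, y))%:E <=
  (2 * c * cst * J ^+ 3)%:E)%E.
Proof.
pose g (z : R * R) := c * h z.1 ^+ 3 * (Num.min (h z.2) (h z.1) ^+ 3 * ws (z.2 - z.1)).
have cst0 : 0 <= cst by rewrite addr_ge0// mulr_ge0// pi_ge0.
have mh1 : measurable_fun setT (fun z : R * R => h z.1) by apply: (measurableT_comp mh); exact: measurable_fst.
have mh2 : measurable_fun setT (fun z : R * R => h z.2) by apply: (measurableT_comp mh); exact: measurable_snd.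
have mg : measurable_fun setT g.
  apply: measurable_funM.
    by apply: measurable_funM => //; exact: measurable_funX.
  apply: measurable_funM.
    by apply: measurable_funX; exact: measurable_minr.
  apply: (measurableT_comp (@ws_meas R)).
  by apply: measurable_funB; [exact: measurable_snd|exact: measurable_fst].
have m0 x y : 0 <= Num.min (h y) (h x) by rewrite le_min !h0.
have g0 (z : R * R) : 0 <= g z.
  apply: mulr_ge0; first by rewrite mulr_ge0// exprn_ge0.
  by apply: mulr_ge0; [rewrite exprn_ge0|exact: ws_ge0].
have mgs := meas_swap mg.
have mF : measurable_fun setT (fun z : R * R => h z.1 ^+ 3 * h z.2 ^+ 3 * kap z).
  by apply: measurable_funM mk; apply: measurable_funM; exact: measurable_funX.
have F0 x y : 0 <= h x ^+ 3 * h y ^+ 3 * kap (x, y) by rewrite !mulr_ge0// exprn_ge0.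
have mE : measurable_fun setT (fun z => (g z)%:E) by exact/measurable_EFinP.
have mEs : measurable_fun setT (fun z => (g (z.2, z.1))%:E) by exact/measurable_EFinP.
have b1 : (\int[mu]_x \int[mu]_y (g (x, y))%:E <= (c * cst * J ^+ 3)%:E)%E.
  have -> : c * cst * J ^+ 3 = c * cst * J * J ^+ 2 by ring.
  apply: (@le_trans _ _ (\int[mu]_x (c * cst * J * h x ^+ 4)%:E)%E).
    apply: nnint_le => x; first by apply: nnint_ge0 => y; rewrite lee_fin.
    rewrite /g/= nnintZl; last 3 first.
    - apply: measurable_funM.
        by apply: measurable_funX; apply: measurable_minr => //; exact: measurable_cst.
      by apply: (measurableT_comp (@ws_meas R)); exact: measurable_funB.
    - by move=> y; apply: mulr_ge0; [rewrite exprn_ge0|exact: ws_ge0].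
    - by rewrite mulr_ge0// exprn_ge0.
    have := h0 x; rewrite le_eqVlt => /predU1P[<-|hx].
      by rewrite !expr0n/= !mulr0 mul0e.
    have -> : c * cst * J * h x ^+ 4 = c * h x ^+ 3 * (cst * h x * J) by ring.
    rewrite [leRHS]EFinM; apply: lee_wpmul2l; last exact: hls_point.
    by rewrite lee_fin mulr_ge0// exprn_ge0.
  rewrite nnintZl; last 3 first.
  - exact: measurable_funX.
  - by move=> x; rewrite exprn_ge0.
  - by rewrite !mulr_ge0// ltW.
  by rewrite [leRHS]EFinM; apply: lee_wpmul2l => //; rewrite lee_fin !mulr_ge0// ltW.
have b2 : (\int[mu]_x \int[mu]_y (g (y, x))%:E <= (c * cst * J ^+ 3)%:E)%E.
  apply: le_trans b1; by rewrite (@tonelli _ (fun z => (g z)%:E)).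
have -> : 2 * c * cst * J ^+ 3 = c * cst * J ^+ 3 + c * cst * J ^+ 3 by ring.
rewrite EFinD; apply: le_trans (leeD b1 b2).
rewrite -nnintDe; last 4 first.
- by apply: (@meas_tonelli _ (fun z => (g z)%:E)).
- by apply: (@meas_tonelli _ (fun z => (g (z.2, z.1))%:E)) => // z; rewrite lee_fin; exact: g0.
- by move=> x; apply: nnint_ge0 => y; rewrite lee_fin.
- by move=> x; apply: nnint_ge0 => y; rewrite lee_fin.
apply: nnint_le => x; first by apply: nnint_ge0 => y; rewrite lee_fin.
have mg1 := measurable_pair1 x mg; have mg2 := measurable_pair1 x mgs.
rewrite -nnintD//.
apply: (@integral_ne_le x) => //.
- exact: (measurable_pair1 x mF).
- exact: measurable_funD.
- by move=> y; rewrite addr_ge0.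
move=> y yx; rewrite /g/=.
have wsE : ws (x - y) = ws (y - x) by rewrite /ws distrC.
rewrite wsE [Num.min (h x) (h y)]minC.
apply: (@le_trans _ _ (h x ^+ 3 * h y ^+ 3 * (c * ws (y - x)))).
  by rewrite ler_wpM2l ?kc// mulr_ge0// exprn_ge0.
set m := Num.min _ _; have m3 : 0 <= m ^+ 3 := exprn_ge0 3 (m0 x y).
have -> : c * h x ^+ 3 * (m ^+ 3 * ws (y - x)) + c * h y ^+ 3 * (m ^+ 3 * ws (y - x)) =
  (h x ^+ 3 * m ^+ 3 + h y ^+ 3 * m ^+ 3) * (c * ws (y - x)) by ring.
apply: ler_wpM2r; first by rewrite mulr_ge0// ws_ge0.
rewrite /m; have [|] := leP (h y) (h x) => _.
  by rewrite lerDl mulr_ge0// exprn_ge0.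
by rewrite [leLHS]mulrC lerDr mulr_ge0// exprn_ge0.
Qed.

End hls.

(** * The maximal estimate *)

Section maximal.
Context {R : realType}.
Notation mu := (@lebesgue_measure R).

(* |xi|^(-1/4) on 0 < |xi| <= B, and 0 elsewhere; in particular vB B 0 = 0. *)
Definition vB (B xi : R) : R := Num.sqrt (wsB B xi).

Lemma wsB_ge0 (B xi : R) : 0 <= wsB B xi.
Proof. by apply: mulr_ge0; [have /andP[] := @indic_le1 R `[- B, B]%classic xi|exact: ws_ge0]. Qed.

Lemma vB_sqr B xi : vB B xi ^+ 2 = wsB B xi.
Proof. by rewrite sqr_sqrtr// wsB_ge0. Qed.

Lemma vB_meas B : measurable_fun setT (vB B).
Proof.
apply: (measurableT_comp (f := @Num.sqrt R)).
  by apply: continuous_measurable_fun; exact: sqrt_continuous.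
exact: integ_meas (ws_integ B).
Qed.

Lemma vB_out (B xi : R) : B < `|xi| -> vB B xi = 0.
Proof.
move=> h; rewrite /vB /wsB indicE memNset ?mul0r ?sqrtr0//=.
by rewrite in_itv/= -ler_norml; apply/negP; rewrite -ltNge.
Qed.

Lemma norm_cosB (a b : R) : `|cos a - cos b| <= `|a - b|.
Proof.
wlog ab : a b / b <= a => [hw|].
  by have [/hw//|/ltW/hw h] := leP b a; rewrite distrC [leRHS]distrC.
have [c _ ->] := @derive_MVT R cos (fun z => - sin z) b a ab (fun z _ => is_derive_cos z).
by rewrite normrM normrN ler_piMl// norm_sin_le1.
Qed.

Section fixed.
Variables (F : R -> R) (S B beta : R).
Hypotheses (mF : measurable_fun setT F) (S0 : 0 < S) (B0 : 0 < B)
  (FS : (\int[mu]_x (F x ^+ 2)%:E <= (S ^+ 2)%:E)%E).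

Let FF xi := F xi * vB B xi.

Let F2i : integ (fun xi => F xi ^+ 2).
Proof.
apply: integ_ge0P; [exact: measurable_funX|by move=> x; exact: sqr_ge0|].
by rewrite (le_lt_trans FS)// ltry.
Qed.

Lemma max_integ : integ FF.
Proof.
apply: (@integ_le _ _ (fun xi => 2^-1 * F xi ^+ 2 + 2^-1 * wsB B xi)).
- by apply: measurable_funM => //; exact: vB_meas.
- by move=> xi; rewrite -vB_sqr normrM; exact: amgm_norm.
- by apply: integD; apply: integZ => //; exact: ws_integ.
Qed.

Let ph (t x xi : R) := t * xi ^+ 3 + x * xi + beta.

(** The shift [beta] will be 0 or -pi/2, so that real and imaginary parts of the wave are covered by
    one statement. *)
Definition osc t x := Int (fun xi => FF xi * cos (ph t x xi)).

Let M0 := Int (fun xi => `|FF xi|).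

Let mcos t x : measurable_fun setT (fun xi => cos (ph t x xi)).
Proof. by apply: continuous_measurable_fun => z; apply: derivable_cont; exact: ex_derive. Qed.

Lemma osc_bd t x : `|osc t x| <= M0.
Proof.
have := norm_Int_kernel max_integ (mcos t x) (fun=> norm_cos_le1 _).
by rewrite mul1r.
Qed.

Section linearized.
Variable tau : R -> R.
Hypothesis mtau : measurable_fun setT tau.

Let Phi (z : R * R) := ph (tau z.2) z.2 z.1.

Let mPhi : measurable_fun setT Phi.
Proof.
apply: measurable_funD; last exact: measurable_cst.
apply: measurable_funD; apply: measurable_funM.
- by apply: (measurableT_comp mtau); exact: measurable_snd.
- by apply: measurable_funX; exact: measurable_fst.
- exact: measurable_snd.
- exact: measurable_fst.
Qed.

Let k (z : R * R) := cos (Phi (z.2, z.1)).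

Let mk : measurable_fun setT k.
Proof. by apply: (measurableT_comp (@measurable_cosT R)); exact: meas_swap mPhi. Qed.

Let k1 z : `|k z| <= 1. Proof. exact: norm_cos_le1. Qed.

Let W x := osc (tau x) x.

Lemma maxW_meas : measurable_fun setT W.
Proof.
apply: (@meas_Int _ _ _ (fun z : R * R => FF z.2 * k z)).
by apply: measurable_funM mk; apply: (measurableT_comp (integ_meas max_integ)); exact: measurable_snd.
Qed.

Variable L : R.
Let D := `[- L, L]%classic : set R.
Let h x := \1_D x * `|W x|.
Let G x := \1_D x * W x ^+ 3.

Let mh : measurable_fun setT h.
Proof.
apply: measurable_funM; first by apply: measurable_indic; exact: measurable_itv.
by apply: measurableT_comp => //; exact: maxW_meas.
Qed.

Let h0 x : 0 <= h x.
Proof. by rewrite mulr_ge0//; have /andP[] := @indic_le1 R D x. Qed.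

Let Wn n x : `|W x ^+ n| <= M0 ^+ n.
Proof. by rewrite normrX lerXn2r ?nnegrE// ?osc_bd// (le_trans _ (osc_bd 0 0)). Qed.

Let Gi : integ G.
Proof. by apply: integ_itv_bd (Wn 3); apply: measurable_funX; exact: maxW_meas. Qed.

Let hG x : `|G x| = h x ^+ 3.
Proof.
rewrite /G /h normrM normrX exprMn; congr (_ * _).
by rewrite indicE; case: (_ \in _); rewrite /= ?normr1 ?normr0 ?expr1n ?expr0n.
Qed.

Let h4E x : h x ^+ 4 = \1_D x * W x ^+ 4.
Proof.
rewrite /h exprMn -normrX ger0_norm ?exprn_even_ge0//; congr (_ * _).
by rewrite indicE; case: (_ \in _); rewrite /= ?expr1n ?expr0n.
Qed.

Let h4i : integ (fun x => h x ^+ 4).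
Proof.
apply: (@eq_integ _ (fun x => \1_D x * W x ^+ 4)) => [x|]; first by rewrite h4E.
by apply: integ_itv_bd (Wn 4); apply: measurable_funX; exact: maxW_meas.
Qed.

Let P xi := Int (fun x => G x * k (x, xi)).

Let max_dual : Int (fun x => h x ^+ 4) = Int (fun xi => FF xi * P xi).
Proof.
rewrite -(Int_swap Gi max_integ mk k1); apply: eq_Int => x.
by rewrite h4E /G -/(osc (tau x) x) -/(W x) -mulrA -exprSr.
Qed.

Let mP : measurable_fun setT P.
Proof.
apply: (@meas_Int _ _ _ (fun z : R * R => G z.2 * k (z.2, z.1))).
apply: measurable_funM; last exact: meas_swap mk.
by apply: (measurableT_comp (integ_meas Gi)); exact: measurable_snd.
Qed.

Let Pbd xi : `|P xi| <= Int (fun x => `|G x|).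
Proof.
have := norm_Int_kernel Gi (measurable_pair2 xi mk) (fun x => k1 (x, xi)).
by rewrite mul1r.
Qed.

Let wP2i : integ (fun xi => wsB B xi * P xi ^+ 2).
Proof.
apply: (integMbd (M := Int (fun x => `|G x|) ^+ 2) (ws_integ B)); first exact: measurable_funX.
by move=> xi; rewrite normrX lerXn2r ?nnegrE ?Int_ge0.
Qed.

(** The constant 2 c (5 + 2 pi) of [hls] for c = 124, the bound on the Airy kernel. *)
Definition linearized_const : R := 2 * 124 * (5 + 2 * pi).

(** Adding the square of the sine part only enlarges the left-hand side and makes TT* applicable.
    The kernel is then [airy_kernel] at time tau x - tau y and position x - y; [beta] cancels, and
    the bound is uniform in time, whence the freedom in [tau]. *)
Let kernel_bound J : 0 < J -> Int (fun x => h x ^+ 4) <= J ^+ 2 ->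
  Int (fun xi => wsB B xi * P xi ^+ 2) <= linearized_const * J ^+ 3.
Proof.
move=> J0 hJ; rewrite -lee_fin.
have wi := ws_integ B.
pose Ps xi := Int (fun x => G x * sin (Phi (xi, x))).
apply: (@le_trans _ _ (Int (fun xi => wsB B xi * (P xi ^+ 2 + Ps xi ^+ 2)))%:E).
  rewrite lee_fin; apply: le_Int => //.
    have mPs : measurable_fun setT Ps.
      apply: (@meas_Int _ _ _ (fun z : R * R => G z.2 * sin (Phi z))).
      apply: measurable_funM; first by apply: (measurableT_comp (integ_meas Gi)); exact: measurable_snd.
      exact: (measurableT_comp (@measurable_sinT R)).
    apply: (integMbd (M := Int (fun x => `|G x|) ^+ 2 + Int (fun x => `|G x|) ^+ 2) wi).
      by apply: measurable_funD; exact: measurable_funX.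
    move=> xi; rewrite (le_trans (ler_normD _ _))// !normrX lerD// lerXn2r ?nnegrE ?Int_ge0//.
    have := @norm_Int_kernel _ G (fun x => sin (Phi (xi, x))) 1 Gi.
    rewrite mul1r; apply; last by move=> x; exact: norm_sin_le1.
    by apply: (measurableT_comp (@measurable_sinT R)); exact: measurable_pair1.
  by move=> xi; rewrite ler_wpM2l ?wsB_ge0// lerDl sqr_ge0.
apply: (le_trans (TTstar_le wi Gi mPhi)).
have -> : linearized_const * J ^+ 3 = 2 * 124 * (5 + 2 * pi) * J ^+ 3 by [].
under eq_integral do under eq_integral do rewrite !hG.
apply: (@hls R h mh h0 J J0 _ (fun z => `|TTker (wsB B) Phi z.1 z.2|) 124) => //.
- by rewrite -EFin_Int// lee_fin.
- have wi' : integ (wsB B) := wi; have mK := TTker_meas wi' mPhi.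
  exact: measurableT_comp.
- move=> x y yx /=.
  have -> : TTker (wsB B) Phi x y = airy_kernel B (tau x - tau y) (x - y).
    by apply: eq_Int => xi; congr (_ * cos _); rewrite /Phi /ph/=; ring.
  rewrite /ws distrC; apply: airy_kernel_bound => //.
  by rewrite subr_eq0 eq_sym.
Qed.

(* TT*: for W x = osc (tau x) x on an interval D, duality writes the integral of W^4 as
   the pairing of F with the adjoint applied to W^3.  The kernel of the square of the
   latter is O(|x - y|^(-1/2)), so that hls bounds it by the integral of W^4 to the
   power 3/2; the integral of W^4 is finite because D is bounded. *)
Lemma max_lin_itv : (\int[mu]_(x in D) (W x ^+ 4)%:E <= ((linearized_const * S ^+ 2) ^+ 2)%:E)%E.
Proof.
have -> : (\int[mu]_(x in D) (W x ^+ 4)%:E = (Int (fun x => h x ^+ 4))%:E)%E.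
  rewrite EFin_Int// integral_mkcond; apply: eq_integral => x _.
  by rewrite h4E patchE indicE; case: ifPn => _; rewrite ?mul1r ?mul0r.
rewrite lee_fin; set I := Int _.
have I0 : 0 <= I by apply: Int_ge0 => x; rewrite exprn_ge0.
have linearized_const0 : 0 <= linearized_const by rewrite /linearized_const mulr_ge0// addr_ge0// mulr_ge0// pi_ge0.
move: I0; rewrite le_eqVlt => /predU1P[<-|Ip]; first by rewrite sqr_ge0.
pose J := Num.sqrt I; have J0 : 0 < J by rewrite sqrtr_gt0.
have J2 : J ^+ 2 = I by rewrite sqr_sqrtr// ltW.
have kb : Int (fun xi => wsB B xi * P xi ^+ 2) <= linearized_const * J ^+ 3.
  by apply: kernel_bound => //; rewrite J2.
(* Cauchy-Schwarz in the weighted form 2 a b <= l a^2 + b^2 / l, applied under the integral. *)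
have cs (l : R) : 0 < l -> 2 * I <= l * S ^+ 2 + l^-1 * (linearized_const * J ^+ 3).
  move=> l0; have F2 : Int (fun xi => F xi ^+ 2) <= S ^+ 2 by rewrite -lee_fin EFin_Int.
  apply: (@le_trans _ _ (l * Int (fun xi => F xi ^+ 2) + l^-1 * Int (fun xi => wsB B xi * P xi ^+ 2))).
    rewrite /I max_dual -!IntZ//; last first.
      apply: (integMbd (M := Int (fun x => `|G x|)) max_integ) => //.
    rewrite -IntD; [|exact: integZ|exact: integZ].
    apply: le_Int.
    - apply: integZ; exact: (integMbd max_integ mP Pbd).
    - by apply: integD; exact: integZ.
    move=> xi; rewrite /FF -vB_sqr.
    have := sqr_ge0 (l * F xi - vB B xi * P xi).
    have -> : l * F xi ^+ 2 + l^-1 * (vB B xi ^+ 2 * P xi ^+ 2) =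
      2 * (F xi * vB B xi * P xi) + l^-1 * (l * F xi - vB B xi * P xi) ^+ 2.
      by field; rewrite gt_eqF.
    by move=> q; rewrite lerDl mulr_ge0// invr_ge0 ltW.
  by apply: lerD; apply: ler_wpM2l => //; rewrite ?invr_ge0 ltW.
(* This [l] makes the first term equal to I, half of the left-hand side. What remains is J^2 <=
   [linearized_const] S^2 J, from which the positive real J is divided out. *)
have := cs (J ^+ 2 / S ^+ 2); rewrite divr_gt0 ?exprn_gt0// => /(_ isT).
have -> : J ^+ 2 / S ^+ 2 * S ^+ 2 = I by rewrite -J2 divfK// gt_eqF// exprn_gt0.
have -> : (J ^+ 2 / S ^+ 2)^-1 * (linearized_const * J ^+ 3) = linearized_const * S ^+ 2 * J.
  by field; rewrite !gt_eqF.
move=> q; have q2 : J ^+ 2 <= linearized_const * S ^+ 2 * J by rewrite J2; lra.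
have q3 : J <= linearized_const * S ^+ 2 by rewrite -(ler_pM2r J0) -expr2.
by rewrite -J2 lerXn2r ?nnegrE ?(ltW J0)// (le_trans (ltW J0) q3).
Qed.

End linearized.

Lemma max_lin tau : measurable_fun setT tau ->
  (\int[mu]_x (osc (tau x) x ^+ 4)%:E <= ((linearized_const * S ^+ 2) ^+ 2)%:E)%E.
Proof.
move=> mtau.
have UT : \bigcup_n `[- n%:R, n%:R]%classic = [set: R].
  apply/seteqP; split=> // x _; exists (Num.truncn `|x|).+1 => //=.
  by rewrite in_itv/= -ler_norml ltW// truncnS_gt.
rewrite -[in leLHS]UT; apply: integral_bigcup_le => //.
- by apply: measurable_funX; exact: maxW_meas.
- by move=> x; rewrite exprn_even_ge0.
- move=> m n mn; apply/subsetPset => x /=; rewrite !in_itv/= -!ler_norml => h.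
  by rewrite (le_trans h)// ler_nat.
by move=> n; exact: max_lin_itv.
Qed.

Section countable.
Variable r : nat -> R.

(* A time among r 0, ..., r n at which |osc| is largest. *)
Fixpoint argtime (n : nat) (x : R) : R :=
  if n is m.+1 then
    if `|osc (argtime m x) x| < `|osc (r m.+1) x| then r m.+1 else argtime m x
  else r 0.

Lemma argtime_meas n : measurable_fun setT (argtime n).
Proof.
elim: n => [|n IH]; first exact: measurable_cst.
apply: measurable_fun_ifT => //.
by apply: measurable_fun_ltr; apply: measurableT_comp => //; [exact: maxW_meas|exact: (maxW_meas (measurable_cst _))].
Qed.

Let hn n x : R := `|osc (argtime n x) x|.

Let hn0 n x : 0 <= hn n x. Proof. exact: normr_ge0. Qed.

Let hn_nd x : nondecreasing_seq (hn ^~ x).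
Proof.
by apply/nondecreasing_seqP => n; rewrite /hn/=; case: ifP => [/ltW|].
Qed.

Let hn_ub n k x : (k <= n)%N -> `|osc (r k) x| <= hn n x.
Proof.
move=> kn; apply: le_trans (hn_nd x kn); rewrite /hn.
by case: k {kn} => [|k]//=; case: ltP.
Qed.

Let hn_cvg x : cvgn (hn ^~ x).
Proof.
apply: nondecreasing_is_cvgn; first exact: hn_nd.
by exists M0 => _ [n _ <-]; exact: osc_bd.
Qed.

Definition maxfun x : R := limn (hn ^~ x).

Let hn_meas n : measurable_fun setT (hn n).
Proof. by apply: measurableT_comp => //; exact: maxW_meas (argtime_meas n). Qed.

Lemma maxfun_meas : measurable_fun setT maxfun.
Proof. by apply: (measurable_fun_cvg hn_meas) => x _; exact: hn_cvg. Qed.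

Lemma maxfun_ub k x : `|osc (r k) x| <= maxfun x.
Proof.
apply: (le_trans (hn_ub x (leqnn k))).
by apply: nondecreasing_cvgn_le; [exact: hn_nd|exact: hn_cvg].
Qed.

(** Each running maximum is |osc| along the measurable time [argtime n], so [max_lin] bounds it
    independently of n, and monotone convergence gives the limit. *)
Lemma maxfun_int : (\int[mu]_x (maxfun x ^+ 4)%:E <= ((linearized_const * S ^+ 2) ^+ 2)%:E)%E.
Proof.
have cv : (\int[mu]_x (hn n x ^+ 4)%:E @[n --> \oo] --> \int[mu]_x (maxfun x ^+ 4)%:E)%E.
  have -> : (\int[mu]_x (maxfun x ^+ 4)%:E = \int[mu]_x limn (fun n => (hn n x ^+ 4)%:E))%E.
    apply: eq_integral => x _; apply/esym/cvg_lim => //.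
    apply: cvg_EFin; first exact: nearW.
    by apply: (@cvg_comp _ _ _ (hn ^~ x) (fun y => y ^+ 4) _ (nbhs (maxfun x))); [exact: hn_cvg|exact: exprn_continuous].
  apply: (@cvg_monotone_convergence _ _ _ mu setT measurableT (fun n x => (hn n x ^+ 4)%:E)).
  - move=> n; have mX : measurable_fun setT (fun x => hn n x ^+ 4) := measurable_funX 4 (hn_meas n).
    exact/measurable_EFinP.
  - by move=> n x _; rewrite lee_fin; exact: exprn_ge0 (hn0 n x).
  - by move=> x _ m n mn; rewrite lee_fin lerXn2r ?nnegrE ?hn0// hn_nd.
rewrite -(cvg_lim _ cv)//; apply: lime_le; first by apply/cvg_ex; eexists; exact: cv.
apply: nearW => n; apply: le_trans (max_lin (argtime_meas n)).
rewrite le_eqVlt; apply/orP; left; apply/eqP; apply: eq_integral => x _.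
by rewrite /hn -normrX ger0_norm// exprn_even_ge0.
Qed.

End countable.

(** The integrand lives on |xi| <= B, where t xi^3 has speed at most B^3 in t. This constant
    disappears afterwards: only the density of the rational times is drawn from it. *)
Lemma osc_lip t t' x : `|osc t x - osc t' x| <= `|t - t'| * (B ^+ 3 * M0).
Proof.
rewrite /osc -IntB; last 2 first.
- exact: integMbd max_integ (mcos _ _) (fun=> norm_cos_le1 _).
- exact: integMbd max_integ (mcos _ _) (fun=> norm_cos_le1 _).
apply: (le_trans (norm_Int _)).
  apply: integB.
  - exact: integMbd max_integ (mcos _ _) (fun=> norm_cos_le1 _).
  - exact: integMbd max_integ (mcos _ _) (fun=> norm_cos_le1 _).
rewrite mulrA -IntZ; last exact: integ_norm max_integ.
apply: le_Int.
- apply: integ_norm; apply: integB.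
  - exact: integMbd max_integ (mcos _ _) (fun=> norm_cos_le1 _).
  - exact: integMbd max_integ (mcos _ _) (fun=> norm_cos_le1 _).
- by apply: integZ; exact: integ_norm max_integ.
move=> xi; rewrite -mulrBr normrM mulrC.
have [h|h] := leP `|xi| B; last by rewrite /FF vB_out// mulr0 normr0 !mulr0.
apply: ler_wpM2r => //; apply: (le_trans (norm_cosB _ _)).
have -> : ph t x xi - ph t' x xi = (t - t') * xi ^+ 3 by rewrite /ph; ring.
by rewrite normrM normrX ler_wpM2l// lerXn2r ?nnegrE// ltW.
Qed.

Lemma maximal : exists H : R -> R, [/\ measurable_fun setT H,
  forall t x, `|osc t x| <= H x &
  (\int[mu]_x (H x ^+ 4)%:E <= ((linearized_const * S ^+ 2) ^+ 2)%:E)%E].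
Proof.
pose r (n : nat) : R := if unpickle n is Some q then ratr q else 0.
exists (maxfun r); split; [exact: maxfun_meas| |exact: maxfun_int].
move=> t x; apply/ler_addgt0Pr => e e0.
have M00 : 0 <= M0 by rewrite (le_trans _ (osc_bd 0 0)).
pose K := B ^+ 3 * M0 + 1; have K0 : 0 < K by rewrite ltr_pwDr// mulr_ge0// exprn_ge0// ltW.
have tlt : t < t + e / K by rewrite ltrDl divr_gt0.
have [q] := rat_in_itvoo tlt; rewrite in_itv/= => /andP[tq qe].
have rq : r (pickle q) = ratr q by rewrite /r pickleK.
have h1 := maxfun_ub r (pickle q) x; rewrite rq in h1.
have h2 := osc_lip t (ratr q) x.
have h3 : `|t - ratr q| <= e / K by rewrite distrC ger0_norm ?subr_ge0 ?ltW//; lra.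
have h4 : `|t - ratr q| * (B ^+ 3 * M0) <= e.
  apply: (@le_trans _ _ (e / K * K)); last by rewrite divfK// gt_eqF.
  by apply: ler_pM => //; rewrite ?lerDl// mulr_ge0// exprn_ge0// ltW.
have := ler_normD (osc t x - osc (ratr q) x) (osc (ratr q) x); rewrite subrK.
lra.
Qed.

End fixed.
End maximal.

(** * Plancherel upper bound *)

Section fourier_bound.
Context {R : realType}.
Notation mu := (@lebesgue_measure R).
Implicit Types f F : R -> R[i].

Definition csq (z : R[i]) : R := complex.Re z ^+ 2 + complex.Im z ^+ 2.

Lemma csq_ge0 z : 0 <= csq z.
Proof. by rewrite addr_ge0 ?sqr_ge0. Qed.

Lemma normcE (z : R[i]) : normc z = Num.sqrt (csq z).
Proof. by case: z. Qed.

Lemma normc_ge0 (z : R[i]) : 0 <= normc z.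
Proof. by rewrite normcE sqrtr_ge0. Qed.

Lemma normc_sqr (z : R[i]) : normc z ^+ 2 = csq z.
Proof. by rewrite normcE sqr_sqrtr// csq_ge0. Qed.

Lemma csq_meas f : Cmeasurable f -> measurable_fun setT (fun x => csq (f x)).
Proof. by move=> [m1 m2]; apply: measurable_funD; exact: measurable_funX. Qed.

Lemma ReB (z w : R[i]) : complex.Re (z - w) = complex.Re z - complex.Re w.
Proof. by case: z => ? ?; case: w => ? ?. Qed.

Lemma ImB (z w : R[i]) : complex.Im (z - w) = complex.Im z - complex.Im w.
Proof. by case: z => ? ?; case: w => ? ?. Qed.

Lemma csqD (z w : R[i]) : csq (z + w) <= 2 * csq z + 2 * csq w.
Proof. 
case: z => a b; case: w => c d; rewrite /csq/=.
have := sqr_ge0 (a - c); have := sqr_ge0 (b - d); lra.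
Qed.

Lemma Lpnorm2E f : (Lpnorm 2%:E f `^ 2 = \int[mu]_x (csq (f x))%:E)%E.
Proof.
rewrite /Lpnorm poweR_Lnorm//; apply: eq_integral => x _.
rewrite gee0_abs ?lee_fin ?normc_ge0// poweR_EFin.
by rewrite powR_mulrn ?normc_ge0// normc_sqr.
Qed.

Lemma Lpnorm2_le f (n : R) : 0 <= n -> (Lpnorm 2%:E f <= n%:E)%E ->
  (\int[mu]_x (csq (f x))%:E <= (n ^+ 2)%:E)%E.
Proof.
move=> n0 h; rewrite -Lpnorm2E -powR_mulrn// -poweR_EFin.
apply: gt0_ler_poweR => //.
  by rewrite in_itv/= leey andbT; exact: Lnorm_ge0.
by rewrite in_itv/= leey andbT lee_fin.
Qed.

(** Twice the constant 20 pi of [sep_L2], once for the real and once for the imaginary part. *)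
Definition plancherel_const : R := 40 * pi.

Section trunc.
Variables (f : R -> R[i]) (n : R) (A : R).
Hypotheses (mf : Cmeasurable f) (fn : (\int[mu]_x (csq (f x))%:E <= (n ^+ 2)%:E)%E).

Lemma indic_L2_integ (g : R -> R) (a b : R) : measurable_fun setT g ->
  (\int[mu]_x (g x ^+ 2)%:E < +oo)%E -> integ (fun x => \1_`[a, b] x * g x).
Proof.
move=> mg gy.
apply: (@integ_le _ _ (fun x => 2^-1 * \1_`[a, b] x + 2^-1 * g x ^+ 2)).
- by apply: measurable_funM => //; exact: measurable_indic.
- move=> x; rewrite normrM.
  have -> : \1_`[a, b]%classic x = \1_`[a, b]%classic x ^+ 2 :> R.
    by rewrite indicE; case: (_ \in _); rewrite /= ?expr1n ?expr0n.
  have -> : `|\1_`[a, b]%classic x ^+ 2| = `|\1_`[a, b]%classic x| :> R.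
    by rewrite indicE; case: (_ \in _); rewrite /= ?expr1n ?expr0n.
  exact: amgm_norm.
- apply: integD; apply: integZ; first exact: integ_indic_itv.
  by apply: integ_ge0P => //; [exact: measurable_funX|move=> x; exact: sqr_ge0].
Qed.

Let fr x := complex.Re (f x).
Let fi x := complex.Im (f x).

Let re2 : (\int[mu]_x (fr x ^+ 2)%:E <= (n ^+ 2)%:E)%E.
Proof.
by apply: le_trans fn; apply: nnint_le => x; rewrite lee_fin ?sqr_ge0// lerDl sqr_ge0.
Qed.
Let im2 : (\int[mu]_x (fi x ^+ 2)%:E <= (n ^+ 2)%:E)%E.
Proof.
by apply: le_trans fn; apply: nnint_le => x; rewrite lee_fin ?sqr_ge0// lerDr sqr_ge0.
Qed.

Let a x := \1_`[- A, A] x * fr x.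
Let b x := \1_`[- A, A] x * fi x.

Let ai : integ a.
Proof. by apply: indic_L2_integ; [exact: mf.1|rewrite (le_lt_trans re2)// ltry]. Qed.
Let bi : integ b.
Proof. by apply: indic_L2_integ; [exact: mf.2|rewrite (le_lt_trans im2)// ltry]. Qed.

Let indic_sqr_le (g : R -> R) (D : set R) :
  (\int[mu]_x ((\1_D x * g x) ^+ 2)%:E <= \int[mu]_x (g x ^+ 2)%:E)%E.
Proof.
apply: nnint_le => x; rewrite lee_fin ?sqr_ge0// exprMn ler_piMl ?sqr_ge0//.
Qed.

Let Q (h : R -> R) xi := Int (fun x => h x * cos (xi * - x + 0)) ^+ 2 +
                         Int (fun x => h x * sin (xi * - x + 0)) ^+ 2.

Let mN : measurable_fun setT (fun x : R => - x).
Proof. by apply: continuous_measurable_fun => x; apply: derivable_cont; exact: ex_derive. Qed.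

Let sepN (x y : R) : setT x -> setT y -> 1 * `|x - y| <= `|- x - - y|.
Proof. by move=> _ _; rewrite mul1r -opprD normrN. Qed.

Let Qa : (\int[mu]_xi (Q a xi)%:E <= (20 * pi * n ^+ 2)%:E)%E.
Proof.
have := sep_L2 mN (measurable_cst (0 : R)) ltr01 sepN ai (fun x _ => I).
rewrite divr1 => h; apply: (le_trans h); rewrite [leRHS]EFinM; apply: lee_wpmul2l.
  by rewrite lee_fin mulr_ge0// pi_ge0.
exact: le_trans (indic_sqr_le _ _) re2.
Qed.

Let Qb : (\int[mu]_xi (Q b xi)%:E <= (20 * pi * n ^+ 2)%:E)%E.
Proof.
have := sep_L2 mN (measurable_cst (0 : R)) ltr01 sepN bi (fun x _ => I).
rewrite divr1 => h; apply: (le_trans h); rewrite [leRHS]EFinM; apply: lee_wpmul2l.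
  by rewrite lee_fin mulr_ge0// pi_ge0.
exact: le_trans (indic_sqr_le _ _) im2.
Qed.

Let phase (xi x : R) : xi * - x + 0 = - (x * xi). Proof. by ring. Qed.

Let mcos (xi : R) : measurable_fun setT (fun x : R => cos (xi * - x + 0)).
Proof. by apply: continuous_measurable_fun => x; apply: derivable_cont; exact: ex_derive. Qed.
Let msin (xi : R) : measurable_fun setT (fun x : R => sin (xi * - x + 0)).
Proof. by apply: continuous_measurable_fun => x; apply: derivable_cont; exact: ex_derive. Qed.

Let trunc_re xi : complex.Re (truncated_fourier A f xi) =
  Int (fun x => a x * cos (xi * - x + 0)) - Int (fun x => b x * sin (xi * - x + 0)).
Proof.
rewrite /truncated_fourier /Cintegral/= -Int_indic// -IntB; last 2 first.
- exact: integMbd ai (mcos xi) (fun=> norm_cos_le1 _).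
- exact: integMbd bi (msin xi) (fun=> norm_sin_le1 _).
apply: eq_Int => x; rewrite /a /b phase /fr /fi /expi.
by case: (f x) => u v /=; ring.
Qed.

Let trunc_im xi : complex.Im (truncated_fourier A f xi) =
  Int (fun x => b x * cos (xi * - x + 0)) + Int (fun x => a x * sin (xi * - x + 0)).
Proof.
rewrite /truncated_fourier /Cintegral/= -Int_indic// -IntD; last 2 first.
- exact: integMbd bi (mcos xi) (fun=> norm_cos_le1 _).
- exact: integMbd ai (msin xi) (fun=> norm_sin_le1 _).
apply: eq_Int => x; rewrite /a /b phase /fr /fi /expi.
by case: (f x) => u v /=; ring.
Qed.

Let mcx (h : R -> R) : integ h -> measurable_fun setT (fun xi : R => Int (fun x : R => h x * cos (xi * - x + 0))).
Proof.
move=> hi; apply: (@meas_Int _ _ _ (fun z : R * R => h z.2 * cos (z.1 * - z.2 + 0))).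
apply: measurable_funM; first by apply: (measurableT_comp (integ_meas hi)); exact: measurable_snd.
apply: (measurableT_comp (@measurable_cosT R)); apply: measurable_funD; last exact: measurable_cst.
apply: measurable_funM; first exact: measurable_fst.
by apply: (measurableT_comp mN); exact: measurable_snd.
Qed.

Let msx (h : R -> R) : integ h -> measurable_fun setT (fun xi : R => Int (fun x : R => h x * sin (xi * - x + 0))).
Proof.
move=> hi; apply: (@meas_Int _ _ _ (fun z : R * R => h z.2 * sin (z.1 * - z.2 + 0))).
apply: measurable_funM; first by apply: (measurableT_comp (integ_meas hi)); exact: measurable_snd.
apply: (measurableT_comp (@measurable_sinT R)); apply: measurable_funD; last exact: measurable_cst.
apply: measurable_funM; first exact: measurable_fst.
by apply: (measurableT_comp mN); exact: measurable_snd.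
Qed.

Lemma trunc_meas : Cmeasurable (truncated_fourier A f).
Proof.
split.
  by under eq_fun do rewrite trunc_re; apply: measurable_funB; [exact: mcx|exact: msx].
by under eq_fun do rewrite trunc_im; apply: measurable_funD; [exact: mcx|exact: msx].
Qed.

(** [sep_L2] for the phase -x, separated with constant 1, with xi in the role of time. The bound
    does not depend on A. *)
Lemma trunc_le : (\int[mu]_xi (csq (truncated_fourier A f xi))%:E <= (2 * plancherel_const * n ^+ 2)%:E)%E.
Proof.
have mQ (h : R -> R) : integ h -> measurable_fun setT (Q h).
  by move=> hi; apply: measurable_funD; apply: measurable_funX; [exact: mcx|exact: msx].
have Q0 h xi : 0 <= Q h xi by rewrite addr_ge0 ?sqr_ge0.
apply: (@le_trans _ _ (\int[mu]_xi (2 * Q a xi + 2 * Q b xi)%:E)%E).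
  apply: nnint_le => xi; rewrite lee_fin ?csq_ge0// /csq trunc_re trunc_im /Q.
  move: (Int _) (Int _) (Int _) (Int _) => p q r s.
  have := sqr_ge0 (q - p); have := sqr_ge0 (s + r); lra.
rewrite nnintD; last 4 first.
- by apply: measurable_funM => //; exact: mQ.
- by apply: measurable_funM => //; exact: mQ.
- by move=> xi; rewrite mulr_ge0.
- by move=> xi; rewrite mulr_ge0.
rewrite !nnintZl//; [|exact: mQ|exact: mQ].
have -> : 2 * plancherel_const * n ^+ 2 = 2 * (20 * pi * n ^+ 2) + 2 * (20 * pi * n ^+ 2) by rewrite /plancherel_const; ring.
rewrite [leRHS]EFinD; apply: leeD; rewrite [leRHS]EFinM.
  by apply: lee_wpmul2l Qa; rewrite lee_fin.
by apply: lee_wpmul2l Qb; rewrite lee_fin.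
Qed.

End trunc.

(** F is compared with one truncated transform at small L^2 distance. The inequality |z + w|^2 <= 2
    |z|^2 + 2 |w|^2 doubles the constant of [trunc_le], and d^2 = e / 2 compensates for it in the
    error. *)
Lemma plancherel_le f F (n : R) : Cmeasurable f -> (\int[mu]_x (csq (f x))%:E <= (n ^+ 2)%:E)%E ->
  is_fourier f F -> (\int[mu]_x (csq (F x))%:E <= (4 * plancherel_const * n ^+ 2)%:E)%E.
Proof.
move=> mf fn [[mF _] cv].
apply/lee_addgt0Pr => e e0; pose d := Num.sqrt (e / 2).
have d0 : 0 < d by rewrite sqrtr_gt0 divr_gt0.
have [A hA] : exists A, (Lpnorm 2%:E (fun xi => F xi - truncated_fourier A f xi)%R < d%:E)%E.
  apply: (@filter_ex _ (+oo%R : set_system R)).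
  exact: (cv [set y | (y < d%:E)%E] (open_nbhs_nbhs (conj (@open_ereal_lt_ereal R d%:E) _))).
have h1 := Lpnorm2_le (ltW d0) (ltW hA); rewrite sqr_sqrtr in h1; last by rewrite divr_ge0// ltW.
have h2 := trunc_le A mf fn.
have mT := trunc_meas A mf fn.
have mD : Cmeasurable (fun xi => F xi - truncated_fourier A f xi).
  split; [have := measurable_funB mF.1 mT.1|have := measurable_funB mF.2 mT.2];
  by apply: eq_measurable_fun => xi _; rewrite ?ReB ?ImB.
apply: (@le_trans _ _ (\int[mu]_xi (2 * csq (F xi - truncated_fourier A f xi)%R +
    2 * csq (truncated_fourier A f xi))%:E)%E).
  apply: nnint_le => xi; rewrite lee_fin ?csq_ge0//.
  by rewrite -{1}(subrK (truncated_fourier A f xi) (F xi)) csqD.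
rewrite nnintD; last 4 first.
- by apply: measurable_funM => //; exact: csq_meas.
- by apply: measurable_funM => //; exact: csq_meas.
- by move=> xi; rewrite mulr_ge0// csq_ge0.
- by move=> xi; rewrite mulr_ge0// csq_ge0.
rewrite !nnintZl//; [|exact: csq_meas|by move=> xi; exact: csq_ge0|exact: csq_meas|by move=> xi; exact: csq_ge0].
have -> : ((4 * plancherel_const * n ^+ 2)%:E + e%:E = 2%:E * (e / 2)%:E + 2%:E * (2 * plancherel_const * n ^+ 2)%:E)%E.
  by rewrite -!EFinM -!EFinD; congr EFin; field.
by apply: leeD; apply: lee_wpmul2l.
Qed.

Lemma fourier_bound f (n : R) : L2 f -> 0 <= n -> (Lpnorm 2%:E f <= n%:E)%E ->
  Cmeasurable (fourier f) /\ (\int[mu]_x (csq (fourier f x))%:E <= (4 * plancherel_const * n ^+ 2)%:E)%E.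
Proof.
move=> [mf _] n0 fn; rewrite /fourier; case: xgetP => [F _ hF|_].
  split; first by case: hF => -[].
  by apply: plancherel_le mf _ hF; exact: Lpnorm2_le.
(* When the set of representatives is empty, [xget] returns 0 and the bound is trivial. *)
split; first by split; exact: measurable_cst.
have -> : (\int[mu]_x (csq (0 : R[i]))%:E = 0)%E.
  by rewrite integral0_eq// => x _; rewrite /csq/= expr0n/= addr0.
by rewrite lee_fin !mulr_ge0 ?sqr_ge0// pi_ge0.
Qed.

(* R minus ess_support F is a union of open null sets, hence by Lindelof (rational
   balls) a countable one. *)
Lemma ess_support_ae F (K : set R) : ess_support F `<=` K ->
  {ae mu, forall xi, ~ K xi -> F xi = 0}.
Proof.
move=> FK.
pose J (n : nat) : set R := if unpickle n is Some (p, q) then ball (ratr p : R) (ratr q) else set0.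
pose good n := {ae mu, forall xi, J n xi -> F xi = 0}.
have H : {ae mu, forall xi, forall n, good n -> J n xi -> F xi = 0}.
  apply/ae_foralln => n; have [g|ng] := pselect (good n); last by apply: aeW => xi /ng.
  by case: g => N [mN N0 sN]; exists N; split=> // xi /= h; apply: sN => /= h2; apply: h => _.
case: H => N [mN N0 sN]; exists N; split=> // xi /= h; apply: sN => /= h2; apply: h => Kxi.
have : (~` ess_support F) xi by move=> /FK.
rewrite /ess_support setCK => -[U [oU Uae] Uxi].
have [p [q /= [xB BU]]] := open_subball_rat oU (mem_set Uxi).
have JE : J (pickle (p, q)) = ball (ratr p : R) (ratr q) by rewrite /J pickleK.
apply: (h2 (pickle (p, q))); rewrite ?/good JE; last exact: set_mem.
case: Uae => N' [mN' N0' sN']; exists N'; split=> // y /= hy; apply: sN' => /= h3; apply: hy => By.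
by apply: h3; exact: BU.
Qed.

End fourier_bound.

(** * Maximal and smoothing estimates for the Airy flow *)

Section solution.
Context {R : realType}.
Notation mu := (@lebesgue_measure R).

(** [D_airy] with the Fourier transform as a free argument, so that the estimates concern any square
    integrable F vanishing almost everywhere off a bounded set. *)
Definition sol (s t : R) (F : R -> R[i]) : R -> R[i] :=
  inv_fourier (D_mult s (airy_mult t F)).

Lemma ae_Int (f g : R -> R) : measurable_fun setT f -> measurable_fun setT g ->
  {ae mu, forall x, f x = g x} -> Int f = Int g.
Proof.
move=> mf mg [N [mN N0 sN]]; rewrite /Int /Rintegral; congr fine.
apply: (@ae_eq_integral _ _ _ mu setT (EFin \o g) (EFin \o f) measurableT).
- exact/measurable_EFinP.
- exact/measurable_EFinP.
- by exists N; split=> // x /= h; apply: sN => /= h2; apply: h => _; rewrite h2.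
Qed.

Lemma vB_powR (B x : R) : x != 0 -> `|x| <= B -> `|x| `^ (4^-1) * vB B x = 1.
Proof.
move=> x0 xB; rewrite /vB /wsB indicE mem_set/=; last by rewrite in_itv/= -ler_norml.
rewrite mul1r /ws -!powR12_sqrt ?powR_ge0 ?invr_ge0 ?powR_ge0//.
rewrite -powRN -powRrM -powRD; last by rewrite normr_eq0 x0 implybT.
rewrite (_ : 4^-1 + _ = 0) ?powRr0//; by field.
Qed.

Lemma power4_mean (a b c d : R) :
  (a + b + c + d) ^+ 4 <= 64 * (a ^+ 4 + b ^+ 4 + c ^+ 4 + d ^+ 4).
Proof.
have h (u v : R) : (u + v) ^+ 4 <= 8 * (u ^+ 4 + v ^+ 4).
  have h2 (y z : R) : (y + z) ^+ 2 <= 2 * (y ^+ 2 + z ^+ 2) by have := sqr_ge0 (y - z); lra.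
  have -> : 8 * (u ^+ 4 + v ^+ 4) = 4 * (2 * ((u ^+ 2) ^+ 2 + (v ^+ 2) ^+ 2)) by ring.
  apply: le_trans (ler_wpM2l _ (h2 (u ^+ 2) (v ^+ 2))) => //.
  have -> : (u + v) ^+ 4 = ((u + v) ^+ 2) ^+ 2 by ring.
  have := h2 u v; have := sqr_ge0 (u + v); move: (u ^+ 2 + v ^+ 2) ((u + v) ^+ 2) => y z; nra.
have := h (a + b + c) d; rewrite -[a + b + c + d]addrA; have := h (a + b) (c + d).
by have := h a b; have := h c d; rewrite !addrA; lra.
Qed.

(** x^2 + x y + y^2 >= (x^2 + y^2) / 2 whatever the signs, so frequencies near N and near -N are
    separated as well and the annulus is treated in one piece. *)
Lemma cube_sep (N x y : R) : 0 < N -> N <= `|x| -> N <= `|y| ->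
  N ^+ 2 / 2 * `|x - y| <= `|x ^+ 3 - y ^+ 3|.
Proof.
move=> N0 xN yN.
have -> : x ^+ 3 - y ^+ 3 = (x ^+ 2 + x * y + y ^+ 2) * (x - y) by ring.
rewrite normrM; apply: ler_wpM2r => //; apply: le_trans (ler_norm _).
have x2 : N ^+ 2 <= x ^+ 2 by rewrite -[x ^+ 2]real_normK ?num_real// lerXn2r ?nnegrE// ltW.
have y2 : N ^+ 2 <= y ^+ 2 by rewrite -[y ^+ 2]real_normK ?num_real// lerXn2r ?nnegrE// ltW.
have := sqr_ge0 (x + y); have := sqr_ge0 N; lra.
Qed.

Section profile.
Variables (F : R -> R[i]) (m B s g : R) (K : set R).
Hypotheses (mF : Cmeasurable F) (m0 : 0 < m) (B0 : 0 < B)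
  (Fm : (\int[mu]_x (csq (F x))%:E <= (m ^+ 2)%:E)%E)
  (g0 : 0 <= g) (gs : g = s + 4^-1)
  (mK : measurable K) (KB : forall xi, K xi -> `|xi| <= B)
  (FK : {ae mu, forall xi, ~ K xi -> F xi = 0}).

(* |xi|^s h = profile h * |xi|^(-1/4), which is how the maximal estimate is applied. *)
Definition profile (h : R -> R) xi := \1_K xi * (`|xi| `^ g) * h xi.

Let fr x := complex.Re (F x).
Let fi x := complex.Im (F x).
Let S := B `^ g * m.

Let S0 : 0 < S. Proof. by rewrite mulr_gt0// powR_gt0. Qed.

Let mpow (e : R) : measurable_fun setT (fun xi : R => `|xi| `^ e).
Proof. by apply: (measurableT_comp (f := fun y : R => y `^ e)); [exact: measurable_powR|exact: normr_measurable]. Qed.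

Let mprofile (h : R -> R) : measurable_fun setT h -> measurable_fun setT (profile h).
Proof.
by move=> mh; apply: measurable_funM => //; apply: measurable_funM; [exact: meas_indic|exact: mpow].
Qed.

(** As g >= 0, |xi|^g is at most B^g on K. The possible singularity of |xi|^s at 0 is left to the
    factor |xi|^(-1/4). *)
Let profile_le (h : R -> R) : measurable_fun setT h -> (forall x, h x ^+ 2 <= csq (F x)) ->
  (\int[mu]_x (profile h x ^+ 2)%:E <= (S ^+ 2)%:E)%E.
Proof.
move=> mh hF.
apply: (@le_trans _ _ (\int[mu]_x ((B `^ g) ^+ 2 * csq (F x))%:E)%E).
  apply: nnint_le => x; rewrite lee_fin ?sqr_ge0// /profile exprMn.
  apply: ler_pM; rewrite ?sqr_ge0//.
  rewrite lerXn2r ?nnegrE ?powR_ge0// ?mulr_ge0 ?powR_ge0//.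
  rewrite indicE; have [xK|_] := boolP (x \in K); last by rewrite mul0r powR_ge0.
  by rewrite mul1r ge0_ler_powR ?nnegrE// ?(ltW B0)// KB//; exact: set_mem.
rewrite nnintZl; [|exact: csq_meas|by move=> x; exact: csq_ge0|exact: sqr_ge0].
rewrite /S exprMn EFinM; apply: lee_wpmul2l Fm; by rewrite lee_fin sqr_ge0.
Qed.

Let re_csq x : fr x ^+ 2 <= csq (F x).
Proof. by rewrite /csq lerDl sqr_ge0. Qed.

Let im_csq x : fi x ^+ 2 <= csq (F x).
Proof. by rewrite /csq lerDr sqr_ge0. Qed.

Let A1 := profile fr.
Let A2 := profile fi.
Let mA1 : measurable_fun setT A1. Proof. exact: mprofile mF.1. Qed.
Let mA2 : measurable_fun setT A2. Proof. exact: mprofile mF.2. Qed.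
Let A1S : (\int[mu]_x (A1 x ^+ 2)%:E <= (S ^+ 2)%:E)%E.
Proof. exact: profile_le mF.1 re_csq. Qed.
Let A2S : (\int[mu]_x (A2 x ^+ 2)%:E <= (S ^+ 2)%:E)%E.
Proof. exact: profile_le mF.2 im_csq. Qed.

Let ph (t x xi beta : R) := t * xi ^+ 3 + x * xi + beta.

Let mcos t x beta : measurable_fun setT (fun xi => cos (ph t x xi beta)).
Proof. by apply: continuous_measurable_fun => z; apply: derivable_cont; exact: ex_derive. Qed.

Let i1 t x beta : integ (fun xi => A1 xi * vB B xi * cos (ph t x xi beta)).
Proof. exact: integMbd (max_integ B mA1 A1S) (mcos t x beta) (fun=> norm_cos_le1 _). Qed.
Let i2 t x beta : integ (fun xi => A2 xi * vB B xi * cos (ph t x xi beta)).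
Proof. exact: integMbd (max_integ B mA2 A2S) (mcos t x beta) (fun=> norm_cos_le1 _). Qed.

(** The point 0 joins the exceptional set: [vB] vanishes there, whereas |0|^s is 1 when s = 0. *)
Let profile_ae : {ae mu, forall xi, (`|xi| `^ s * fr xi = A1 xi * vB B xi) /\
  (`|xi| `^ s * fi xi = A2 xi * vB B xi)}.
Proof.
case: FK => N [mN N0 sN]; exists (N `|` [set 0]); split.
- exact: measurableU.
- by rewrite measureU0//; exact: lebesgue_measure_set1.
move=> xi /= h; have [->|x0] := eqVneq xi 0; first by right.
left; apply: sN => /= h2; apply: h; rewrite /A1 /A2 /profile /fr /fi indicE.
have [xK|xK] := boolP (xi \in K); last first.
  by rewrite h2 /=; [split; ring|move=> /mem_set xK'; rewrite xK' in xK].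
have e : `|xi| `^ s = `|xi| `^ g * vB B xi.
  have -> : s = g - 4^-1 by rewrite gs addrK.
  rewrite powRD; last by rewrite normr_eq0 x0 implybT.
  congr (_ * _); have := vB_powR x0 (KB (set_mem xK)).
  have p0 : `|xi| `^ 4^-1 != 0 by rewrite powR_eq0 normr_eq0 (negbTE x0).
  by move=> h1; apply: (mulfI p0); rewrite h1 powRN divff.
by rewrite e /=; split; ring.
Qed.

(** Real and imaginary parts of F times cosine and sine of the phase give four integrals, the sine
    being the cosine shifted by -pi/2. Each is an [osc], to which the maximal estimate applies. *)
Let solE t x : sol s t F x = Complex
  ((2 * pi)^-1 * (osc A1 B 0 t x - osc A2 B (- (pi / 2)) t x))
  ((2 * pi)^-1 * (osc A2 B 0 t x + osc A1 B (- (pi / 2)) t x)).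
Proof.
have mG (h k : R -> R) : measurable_fun setT h -> measurable_fun setT k ->
    measurable_fun setT (fun xi : R => `|xi| `^ s * h xi * k xi).
  by move=> mh mk; apply: measurable_funM => //; apply: measurable_funM => //; exact: mpow.
have phE (xi b : R) : ph t x xi 0 - pi / 2 = ph t x xi (- (pi / 2)) by rewrite /ph addr0.
rewrite /osc -IntB; [|exact: i1|exact: i2].
rewrite -IntD; [|exact: i2|exact: i1].
rewrite /sol /inv_fourier /Cintegral /=.
have reE xi : complex.Re (expi (x * xi) * D_mult s (airy_mult t F) xi) =
    `|xi| `^ s * fr xi * cos (ph t x xi 0) - `|xi| `^ s * fi xi * cos (ph t x xi (- (pi / 2))).
  rewrite -phE// cosBpihalf /ph addr0 /D_mult /airy_mult /expi /fr /fi cosD sinD.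
  by case: (F xi) => u v /=; ring.
have imE xi : complex.Im (expi (x * xi) * D_mult s (airy_mult t F) xi) =
    `|xi| `^ s * fi xi * cos (ph t x xi 0) + `|xi| `^ s * fr xi * cos (ph t x xi (- (pi / 2))).
  rewrite -phE// cosBpihalf /ph addr0 /D_mult /airy_mult /expi /fr /fi cosD sinD.
  by case: (F xi) => u v /=; ring.
rewrite (_ : Rintegral mu setT _ = Int (fun xi => A1 xi * vB B xi * cos (ph t x xi 0) -
    A2 xi * vB B xi * cos (ph t x xi (- (pi / 2))))); last first.
  rewrite -[LHS]/(Int _) (eq_Int reE); apply: ae_Int.
  - by apply: measurable_funB; apply: mG => //; [exact: mF.1|exact: mF.2].
  - by apply: measurable_funB; [exact: integ_meas (i1 _ _ _)|exact: integ_meas (i2 _ _ _)].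
  case: profile_ae => N [mN N0 sN]; exists N; split=> // xi /= h; apply: sN => /= h2.
  by apply: h; rewrite h2.1 h2.2.
rewrite (_ : Rintegral mu setT _ = Int (fun xi => A2 xi * vB B xi * cos (ph t x xi 0) +
    A1 xi * vB B xi * cos (ph t x xi (- (pi / 2))))); last first.
  rewrite -[LHS]/(Int _) (eq_Int imE); apply: ae_Int.
  - by apply: measurable_funD; apply: mG => //; [exact: mF.2|exact: mF.1].
  - by apply: measurable_funD; [exact: integ_meas (i2 _ _ _)|exact: integ_meas (i1 _ _ _)].
  case: profile_ae => N [mN N0 sN]; exists N; split=> // xi /= h; apply: sN => /= h2.
  by apply: h; rewrite h2.1 h2.2.
by congr Complex; ring.
Qed.

Let c01 : 0 <= (2 * pi : R)^-1 <= 1.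
Proof.
rewrite invr_ge0 mulr_ge0 ?pi_ge0//= invf_le1 ?mulr_gt0 ?pi_gt0//.
have := @pi_ge2 R; lra.
Qed.

(** Its fourth power is 256 [linearized_const]^2: four maximal functions, times the factor 64 of
    [power4_mean]. *)
Definition maximal_const : R := Num.sqrt (16 * linearized_const).

Lemma sol_maximal : exists H : R -> R, [/\ measurable_fun setT H, forall x, 0 <= H x,
  forall t x, normc (sol s t F x) <= H x &
  (\int[mu]_x (H x ^+ 4)%:E <= ((maximal_const * S) ^+ 4)%:E)%E].
Proof.
have [H1 [m1 b1 n1]] := maximal 0 mA1 S0 B0 A1S.
have [H2 [m2 b2 n2]] := maximal (- (pi / 2)) mA1 S0 B0 A1S.
have [H3 [m3 b3 n3]] := maximal 0 mA2 S0 B0 A2S.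
have [H4 [m4 b4 n4]] := maximal (- (pi / 2)) mA2 S0 B0 A2S.
exists (fun x => H1 x + H2 x + H3 x + H4 x); split.
- by do 3 apply: measurable_funD => //.
- move=> x; have := b1 0 x; have := b2 0 x; have := b3 0 x; have := b4 0 x.
  have := normr_ge0 (osc A1 B 0 0 x); have := normr_ge0 (osc A1 B (- (pi / 2)) 0 x).
  have := normr_ge0 (osc A2 B 0 0 x); have := normr_ge0 (osc A2 B (- (pi / 2)) 0 x); lra.
- move=> t x; rewrite solE normcE /csq/=.
  have := b1 t x; have := b2 t x; have := b3 t x; have := b4 t x.
  move: (osc _ _ _ _ _) (osc _ _ _ _ _) (osc _ _ _ _ _) (osc _ _ _ _ _) => p q u v.
  move: (H1 x) (H2 x) (H3 x) (H4 x) => h1 h2 h3 h4 vh uh qh ph'.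
  have /andP[c0 c1] := c01; move: (2 * pi)^-1 c0 c1 => c c0 c1.
  have hn (y z : R) : Num.sqrt (y ^+ 2 + z ^+ 2) <= `|y| + `|z|.
    rewrite -[leRHS]ger0_norm ?addr_ge0// -sqrtr_sqr ler_wsqrtr// sqrrD !real_normK ?num_real//.
    by have := mulr_ge0 (normr_ge0 y) (normr_ge0 z); lra.
  apply: (le_trans (hn _ _)).
  have hc (y : R) : `|c * y| <= `|y| by rewrite normrM (ger0_norm c0) ler_piMl.
  have := hc (p - v); have := hc (u + q).
  have := ler_normB p v; have := ler_normD u q; lra.
have m4' (h : R -> R) : measurable_fun setT h -> measurable_fun setT (fun x => h x ^+ 4) by exact: measurable_funX.
have e0 (h : R -> R) x : 0 <= h x ^+ 4 by rewrite exprn_even_ge0.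
apply: (@le_trans _ _ (\int[mu]_x (64 * (H1 x ^+ 4 + H2 x ^+ 4 + H3 x ^+ 4 + H4 x ^+ 4))%:E)%E).
  by apply: nnint_le => x; rewrite lee_fin ?power4_mean// exprn_even_ge0.
have z3 x : 0 <= H1 x ^+ 4 + H2 x ^+ 4 + H3 x ^+ 4 by rewrite !addr_ge0.
have z2 x : 0 <= H1 x ^+ 4 + H2 x ^+ 4 by rewrite !addr_ge0.
have z4 x : 0 <= H1 x ^+ 4 + H2 x ^+ 4 + H3 x ^+ 4 + H4 x ^+ 4 by rewrite !addr_ge0.
have y2 : measurable_fun setT (fun x => H1 x ^+ 4 + H2 x ^+ 4) by apply: measurable_funD; exact: m4'.
have y3 : measurable_fun setT (fun x => H1 x ^+ 4 + H2 x ^+ 4 + H3 x ^+ 4) by apply: measurable_funD => //; exact: m4'.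
have y4 : measurable_fun setT (fun x => H1 x ^+ 4 + H2 x ^+ 4 + H3 x ^+ 4 + H4 x ^+ 4) by apply: measurable_funD => //; exact: m4'.
rewrite (nnintZl y4 z4)// (nnintD y3 (m4' _ m4) z3 (e0 H4)) (nnintD y2 (m4' _ m3) z2 (e0 H3)).
rewrite (nnintD (m4' _ m1) (m4' _ m2) (e0 H1) (e0 H2)).
have -> : (maximal_const * S) ^+ 4 = 64 * ((linearized_const * S ^+ 2) ^+ 2 + (linearized_const * S ^+ 2) ^+ 2 + (linearized_const * S ^+ 2) ^+ 2 + (linearized_const * S ^+ 2) ^+ 2).
  rewrite exprMn /maximal_const (_ : Num.sqrt _ ^+ 4 = (16 * linearized_const) ^+ 2); first by ring.
  rewrite (exprM _ 2 2) sqr_sqrtr// /linearized_const !mulr_ge0 ?addr_ge0 ?mulr_ge0 ?pi_ge0//.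
rewrite [leRHS]EFinM; apply: lee_wpmul2l; first by rewrite lee_fin.
rewrite !EFinD; apply: leeD; last exact: n4.
apply: leeD; last exact: n3.
by apply: leeD; [exact: n1|exact: n2].
Qed.

Variable N : R.
Hypotheses (N0 : 0 < N) (KN : forall xi, K xi -> N <= `|xi|).

(** [sep_L2] with phase xi^3 and shift x xi, so that x does not enter the bound. Separation on K
    contributes 2 / N^2, and the square of [vB] contributes N^(-1/2). *)
Let smooth1 (h : R -> R) (x : R) : measurable_fun setT (profile h) ->
  (\int[mu]_x (profile h x ^+ 2)%:E <= (S ^+ 2)%:E)%E ->
  measurable_fun setT (fun t => osc (profile h) B 0 t x ^+ 2 + osc (profile h) B (- (pi / 2)) t x ^+ 2) /\
  (\int[mu]_t (osc (profile h) B 0 t x ^+ 2 + osc (profile h) B (- (pi / 2)) t x ^+ 2)%:E <=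
    (40 * pi * S ^+ 2 / (N ^+ 2 * Num.sqrt N))%:E)%E.
Proof.
move=> mh hS; pose a xi := profile h xi * vB B xi.
have ai : integ a := max_integ B mh hS.
have mc : measurable_fun setT (fun xi : R => xi ^+ 3) by exact: measurable_funX.
have mx : measurable_fun setT (fun xi : R => x * xi) by apply: measurable_funM.
have aD xi : a xi != 0 -> K xi.
  rewrite /a /profile indicE; have [/set_mem//|_] := boolP (xi \in K).
  by rewrite !mul0r eqxx.
have sep y z : K y -> K z -> N ^+ 2 / 2 * `|y - z| <= `|y ^+ 3 - z ^+ 3|.
  by move=> yK zK; apply: cube_sep => //; exact: KN.
have c0 : 0 < N ^+ 2 / 2 by rewrite divr_gt0// exprn_gt0.
have E t : osc (profile h) B 0 t x ^+ 2 + osc (profile h) B (- (pi / 2)) t x ^+ 2 =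
   Int (fun xi => a xi * cos (t * xi ^+ 3 + x * xi)) ^+ 2 + Int (fun xi => a xi * sin (t * xi ^+ 3 + x * xi)) ^+ 2.
  congr (_ ^+ 2 + _ ^+ 2); apply: eq_Int => xi; first by rewrite addr0.
  by rewrite cosBpihalf.
split.
  by apply: eq_measurable_fun (sep_meas mc mx ai) => t _; rewrite E.
under eq_integral do rewrite E.
apply: (le_trans (sep_L2 mc mx c0 sep ai aD)).
have sN : 0 < Num.sqrt N by rewrite sqrtr_gt0.
have -> : 40 * pi * S ^+ 2 / (N ^+ 2 * Num.sqrt N) =
    20 * pi / (N ^+ 2 / 2) * ((Num.sqrt N)^-1 * S ^+ 2) by field; rewrite !gt_eqF.
rewrite [leRHS]EFinM; apply: lee_wpmul2l.
  by rewrite lee_fin divr_ge0 ?(ltW c0)// mulr_ge0// pi_ge0.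
apply: (@le_trans _ _ (\int[mu]_xi ((Num.sqrt N)^-1 * profile h xi ^+ 2)%:E)%E).
  apply: nnint_le => xi; rewrite lee_fin ?sqr_ge0//.
  have [->|/aD xK] := eqVneq (a xi) 0.
    by rewrite expr0n/= mulr_ge0 ?sqr_ge0// invr_ge0 ltW.
  rewrite /a exprMn mulrC; apply: ler_wpM2r; first exact: sqr_ge0.
  rewrite vB_sqr /wsB /ws indicE mem_set/=; last by rewrite in_itv/= -ler_norml KB.
  rewrite mul1r lef_pV2 ?posrE// ?sqrtr_gt0 ?(lt_le_trans N0) ?KN//.
  by rewrite ler_wsqrtr// KN.
rewrite nnintZl; last 3 first.
- exact: measurable_funX.
- by move=> xi; exact: sqr_ge0.
- by rewrite invr_ge0 ltW.
by rewrite [leRHS]EFinM; apply: lee_wpmul2l hS; rewrite lee_fin invr_ge0 ltW.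
Qed.

Lemma sol_smooth x : measurable_fun setT (fun t => csq (sol s t F x)) /\
  (\int[mu]_t (csq (sol s t F x))%:E <= (160 * pi * S ^+ 2 / (N ^+ 2 * Num.sqrt N))%:E)%E.
Proof.
have [q1 l1] := smooth1 x mA1 A1S; have [q2 l2] := smooth1 x mA2 A2S.
have mU (h : R -> R) beta : integ (fun xi => profile h xi * vB B xi) -> measurable_fun setT (fun t => osc (profile h) B beta t x).
  move=> hi.
  apply: (@meas_Int _ _ _ (fun z : R * R => profile h z.2 * vB B z.2 * cos (z.1 * z.2 ^+ 3 + x * z.2 + beta))).
  apply: measurable_funM.
    by apply: (measurableT_comp (integ_meas hi)); exact: measurable_snd.
  apply: (measurableT_comp (@measurable_cosT R)); apply: measurable_funD; last exact: measurable_cst.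
  apply: measurable_funD; apply: measurable_funM.
  - exact: measurable_fst.
  - by apply: measurable_funX; exact: measurable_snd.
  - exact: measurable_cst.
  - exact: measurable_snd.
have u1 := max_integ B mA1 A1S; have u2 := max_integ B mA2 A2S.
have mm : measurable_fun setT (fun t => csq (sol s t F x)).
  under eq_fun do rewrite solE /csq /=.
  by apply: measurable_funD; apply: measurable_funX; apply: measurable_funM => //;
    [apply: measurable_funB|apply: measurable_funD]; exact: mU.
split; first exact: mm.
pose G1 t := osc A1 B 0 t x ^+ 2 + osc A1 B (- (pi / 2)) t x ^+ 2.
pose G2 t := osc A2 B 0 t x ^+ 2 + osc A2 B (- (pi / 2)) t x ^+ 2.
have z1 t : 0 <= G1 t by rewrite addr_ge0 ?sqr_ge0.
have z2 t : 0 <= G2 t by rewrite addr_ge0 ?sqr_ge0.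
apply: (@le_trans _ _ (\int[mu]_t (2 * (G1 t + G2 t))%:E)%E).
  apply: nnint_le => t; rewrite lee_fin ?csq_ge0// solE /csq /G1 /G2 /=.
  move: (osc _ _ _ _ _) (osc _ _ _ _ _) (osc _ _ _ _ _) (osc _ _ _ _ _) => p q u v.
  have /andP[c0 c1] := c01; move: (2 * pi)^-1 c0 c1 => c c0 c1.
  rewrite !exprMn -mulrDr.
  apply: (@le_trans _ _ (1 * ((v - u) ^+ 2 + (q + p) ^+ 2))).
    by apply: ler_wpM2r; [rewrite addr_ge0 ?sqr_ge0|rewrite expr_le1].
  by have := sqr_ge0 (v + u); have := sqr_ge0 (q - p); lra.
have z3 t : 0 <= G1 t + G2 t by rewrite addr_ge0.
rewrite nnintZl//; last exact: measurable_funD.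
rewrite (nnintD q1 q2 z1 z2).
have -> : 160 * pi * S ^+ 2 / (N ^+ 2 * Num.sqrt N) = 2 * (40 * pi * S ^+ 2 / (N ^+ 2 * Num.sqrt N) + 40 * pi * S ^+ 2 / (N ^+ 2 * Num.sqrt N)) by ring.
rewrite [leRHS]EFinM; apply: lee_wpmul2l; first by rewrite lee_fin.
by rewrite EFinD; apply: leeD; [exact: l1|exact: l2].
Qed.

End profile.
End solution.

(** * The bilinear estimate *)

Section mixed.
Context {R : realType}.
Notation mu := (@lebesgue_measure R).

(** The L^infinity norm is defined by cases on whether the whole space is null. *)
Lemma mu_setT_gt0 : (0 < mu [set: R])%E.
Proof.
apply: (@lt_le_trans _ _ (mu `[0 : R, 1]%classic)).
  by rewrite lebesgue_measure_itv/= lte_fin ltr01 -EFinB subr0 lte_fin.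
by apply: le_measure; rewrite ?inE.
Qed.

Lemma normcM (z w : R[i]) : normc (z * w) = normc z * normc w.
Proof. exact: ComplexField.Normc.normcM. Qed.

Lemma Lpnorm_fin_le (b : R) (w : R -> R[i]) (L : R) : 0 < b -> 0 <= L ->
  (\int[mu]_t ((normc (w t)) `^ b)%:E <= L%:E)%E -> (Lpnorm b%:E w <= (L `^ b^-1)%:E)%E.
Proof.
move=> b0 L0 h; rewrite /Lpnorm unlock /= -poweR_EFin; apply: gt0_ler_poweR.
- by rewrite invr_ge0 ltW.
- by rewrite in_itv/= leey andbT integral_ge0// => t _; rewrite poweR_ge0.
- by rewrite in_itv/= leey andbT lee_fin.
by under eq_integral do rewrite ger0_norm ?normc_ge0//.
Qed.

(* e stands for 1/b, so that b = +oo is the case e = 0. *)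
Lemma inner_le (b : \bar R) (e : R) (u v : R -> R[i]) (h k s : R) :
  (0 < b)%E -> (b^-1)%E = e%:E -> 0 <= e -> e <= 3^-1 -> 0 <= h -> 0 <= k -> 0 < s ->
  (forall t, normc (u t) <= h) -> (forall t, normc (v t) <= k) ->
  measurable_fun setT (fun t => csq (v t)) ->
  (\int[mu]_t (csq (v t))%:E <= (s ^+ 2)%:E)%E ->
  (Lpnorm b (fun t => u t * v t)%R <= (h * k `^ (1 - 2 * e) * s `^ (2 * e))%:E)%E.
Proof.
move=> b0 be e0 e3 h0 k0 s0 uh vk mv vs.
move: e0; rewrite le_eqVlt => /predU1P[e0|e0].
  have -> : b = +oo%E by rewrite -[b]inveK be -e0 inve0.
  rewrite -e0 mulr0 subr0 powRr1// powRr0 mulr1 /Lpnorm unlock mu_setT_gt0.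
  apply/ess_supP/aeW => t /=.
  by rewrite lee_fin ger0_norm ?normc_ge0// normcM ler_pM ?normc_ge0.
have -> : b = (e^-1)%:E by rewrite -[b]inveK be inver gt_eqF.
have ei : 3 <= e^-1 by rewrite -[3]invrK lef_pV2 ?posrE.
move: ei; set c := e^-1 => ei.
have c0 : 0 < c by rewrite invr_gt0.
have L0 : 0 <= h `^ c * k `^ (c - 2) by rewrite mulr_ge0 ?powR_ge0.
have -> : h * k `^ (1 - 2 * e) * s `^ (2 * e) = (h `^ c * k `^ (c - 2) * s ^+ 2) `^ c^-1.
  rewrite powRM ?sqr_ge0// powRM ?powR_ge0// -!powRrM divff ?gt_eqF// powRr1//.
  rewrite /c invrK -powR_mulrn ?(ltW s0)// -powRrM mulrBl mulVf ?gt_eqF//.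
apply: Lpnorm_fin_le => //; first by rewrite mulr_ge0// sqr_ge0.
apply: (@le_trans _ _ (\int[mu]_t (h `^ c * k `^ (c - 2) * csq (v t))%:E)%E).
  apply: nnint_le => t; rewrite lee_fin ?powR_ge0// normcM powRM ?normc_ge0//.
  have -> : normc (v t) `^ c = normc (v t) `^ (c - 2) * csq (v t).
    rewrite -normc_sqr -powR_mulrn ?normc_ge0// -powRD ?subrK//.
    by rewrite (gt_eqF c0).
  rewrite mulrA; apply: ler_wpM2r; first exact: csq_ge0.
  have c2 : 0 <= c - 2 by lra.
  by apply: ler_pM; rewrite ?powR_ge0// ge0_ler_powR ?nnegrE ?normc_ge0// (ltW c0).
rewrite nnintZl//; last by move=> t; exact: csq_ge0.
by rewrite EFinM; apply: lee_wpmul2l vs; rewrite lee_fin.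
Qed.

(** The exponents sum to 4, so raising the smaller base to the larger one yields its fourth
    power. *)
Lemma powR_young (x y p : R) : 0 <= x -> 0 <= y -> 0 <= p -> p <= 4 ->
  x `^ p * y `^ (4 - p) <= x ^+ 4 + y ^+ 4.
Proof.
move=> x0 y0 p0 p4; have q0 : 0 <= 4 - p by lra.
have E (z : R) : 0 <= z -> z `^ p * z `^ (4 - p) = z ^+ 4.
  by move=> z0; rewrite -powRD addrC subrK ?powR_mulrn// pnatr_eq0.
have [xy|/ltW yx] := leP x y.
  apply: (@le_trans _ _ (y `^ p * y `^ (4 - p))).
    by apply: ler_wpM2r; rewrite ?powR_ge0// ge0_ler_powR ?nnegrE.
  by rewrite E// lerDr exprn_even_ge0.
apply: (@le_trans _ _ (x `^ p * x `^ (4 - p))).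
  by apply: ler_wpM2l; rewrite ?powR_ge0// ge0_ler_powR ?nnegrE.
by rewrite E// lerDl exprn_even_ge0.
Qed.

(** After [inner_le], the integrand in x is H^p K^(4 - p). H and K are divided by A and B before
    [powR_young], which would otherwise add quantities of different size; each normalised integral
    is then at most 1. The final factor is 2^(1/p) <= 2, as p >= 1. *)
Lemma mixed_le (p e : R) (b : \bar R) (u v : R -> R -> R[i]) (H K : R -> R) (A B s : R) :
  0 < p -> p * (2 - 2 * e) = 4 -> (0 < b)%E -> (b^-1)%E = e%:E -> 0 <= e -> e <= 3^-1 ->
  0 < A -> 0 < B -> 0 < s ->
  measurable_fun setT H -> measurable_fun setT K ->
  (forall x, 0 <= H x) -> (forall x, 0 <= K x) ->
  (forall t x, normc (u t x) <= H x) -> (forall t x, normc (v t x) <= K x) ->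
  (\int[mu]_x (H x ^+ 4)%:E <= (A ^+ 4)%:E)%E ->
  (\int[mu]_x (K x ^+ 4)%:E <= (B ^+ 4)%:E)%E ->
  (forall x, measurable_fun setT (fun t => csq (v t x))) ->
  (forall x, \int[mu]_t (csq (v t x))%:E <= (s ^+ 2)%:E)%E ->
  (mixed_norm p%:E b (fun t x => u t x * v t x)%R <=
    (2 * (A * B `^ (1 - 2 * e) * s `^ (2 * e)))%:E)%E.
Proof.
move=> p0 pe b0 be e0 e3 A0 B0 s0 mH mK H0 K0 uH vK HA KB mv vs.
have p4 : p <= 4 by nra.
have p1 : 1 <= p by nra.
have pE : p * (1 - 2 * e) = 4 - p by lra.
have inn x : (Lpnorm b (fun t => u t x * v t x)%R <= (H x * K x `^ (1 - 2 * e) * s `^ (2 * e))%:E)%E.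
  by apply: inner_le b0 be e0 e3 (H0 x) (K0 x) s0 _ _ (mv x) (vs x) => t.
pose c := A * B `^ (1 - 2 * e) * s `^ (2 * e).
have c0 : 0 < c by rewrite !mulr_gt0// powR_gt0.
have mX (G : R -> R) (a : R) : measurable_fun setT G -> measurable_fun setT (fun x => a^-1 ^+ 4 * G x ^+ 4).
  by move=> mG; apply: measurable_funM => //; exact: measurable_funX.
have X0 (G : R -> R) (a x : R) : 0 <= a^-1 ^+ 4 * G x ^+ 4.
  by rewrite mulr_ge0// exprn_even_ge0.
have key : (\int[mu]_x `|Lpnorm b (fun t => u t x * v t x)%R| `^ p <= (c `^ p * 2)%:E)%E.
  apply: (@le_trans _ _ (\int[mu]_x (c `^ p * (A^-1 ^+ 4 * H x ^+ 4 + B^-1 ^+ 4 * K x ^+ 4))%:E)%E).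
    apply: nnint_le => x; first exact: poweR_ge0.
    rewrite gee0_abs; last exact: Lnorm_ge0.
    have hb : 0 <= H x * K x `^ (1 - 2 * e) * s `^ (2 * e) by rewrite !mulr_ge0 ?powR_ge0.
    apply: (@le_trans _ _ ((H x * K x `^ (1 - 2 * e) * s `^ (2 * e))%:E `^ p)%E).
      apply: gt0_ler_poweR => //; first exact: ltW.
        by rewrite in_itv/= leey andbT; exact: Lnorm_ge0.
      by rewrite in_itv/= leey andbT lee_fin.
    rewrite poweR_EFin lee_fin.
    have -> : H x * K x `^ (1 - 2 * e) * s `^ (2 * e) = c * ((A^-1 * H x) * (B^-1 * K x) `^ (1 - 2 * e)).
      rewrite /c powRM ?invr_ge0 ?(ltW B0)//.
      have -> : B^-1 `^ (1 - 2 * e) = (B `^ (1 - 2 * e))^-1 by rewrite -powR_inv1 ?(ltW B0)// -powRrM mulN1r powRN.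
      have Be : B `^ (1 - 2 * e) != 0 by rewrite gt_eqF// powR_gt0.
      by field; rewrite Be gt_eqF.
    have h1 : 0 <= A^-1 * H x by rewrite mulr_ge0// invr_ge0 ltW.
    have h2 : 0 <= B^-1 * K x by rewrite mulr_ge0// invr_ge0 ltW.
    rewrite powRM ?(ltW c0)//; last by apply: mulr_ge0 => //; exact: powR_ge0.
    apply: ler_wpM2l; first exact: powR_ge0.
    rewrite powRM ?powR_ge0// -powRrM [_ * p]mulrC pE.
    by rewrite -!exprMn; apply: powR_young => //; exact: ltW.
  have mS : measurable_fun setT (fun x => A^-1 ^+ 4 * H x ^+ 4 + B^-1 ^+ 4 * K x ^+ 4).
    by apply: measurable_funD; exact: mX.
  have S0 x : 0 <= A^-1 ^+ 4 * H x ^+ 4 + B^-1 ^+ 4 * K x ^+ 4 by rewrite addr_ge0.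
  rewrite (nnintZl mS S0 (powR_ge0 _ _)) [leRHS]EFinM; apply: lee_wpmul2l.
    by rewrite lee_fin powR_ge0.
  rewrite (nnintD (mX _ A mH) (mX _ B mK) (X0 H A) (X0 K B)).
  have one (G : R -> R) (a : R) : 0 < a -> measurable_fun setT G -> (\int[mu]_x (G x ^+ 4)%:E <= (a ^+ 4)%:E)%E ->
      (\int[mu]_x (a^-1 ^+ 4 * G x ^+ 4)%:E <= 1%:E)%E.
    move=> a0 mG hG; rewrite (@nnintZl R (a^-1 ^+ 4)) ?exprn_even_ge0//; last 2 first.
    - exact: measurable_funX.
    - by move=> x; rewrite exprn_even_ge0.
    have -> : 1%:E = ((a^-1 ^+ 4)%:E * (a ^+ 4)%:E)%E by rewrite -EFinM -exprMn mulVf ?gt_eqF// expr1n.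
    by apply: lee_wpmul2l hG; rewrite lee_fin exprn_even_ge0.
  rewrite (_ : 2 = 1 + 1 :> R)// EFinD; apply: leeD; exact: one.
rewrite /mixed_norm unlock /=.
apply: (@le_trans _ _ ((c `^ p * 2) `^ p^-1)%:E).
  rewrite -poweR_EFin; apply: gt0_ler_poweR => //.
  - by rewrite invr_ge0 ltW.
  - by rewrite in_itv/= leey andbT integral_ge0// => t _; rewrite poweR_ge0.
  - by rewrite in_itv/= leey andbT lee_fin mulr_ge0// powR_ge0.
rewrite lee_fin powRM ?powR_ge0// -powRrM divff ?gt_eqF// powRr1 ?(ltW c0)// mulrC.
apply: ler_wpM2r; first exact: ltW.
by rewrite ler1_powR// ?ler1n// invf_le1.
Qed.

End mixed.

(** * Exponents, constants and conclusion *)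

Section bilinear.
Context {R : realType}.
Notation mu := (@lebesgue_measure R).

Lemma measurable_ball0 (c : R) : measurable [set xi : R | `|xi| <= c].
Proof.
rewrite (_ : [set _ | _] = `[- c, c]%classic) //.
by apply/seteqP; split => xi /=; rewrite in_itv/= -ler_norml.
Qed.

Lemma measurable_annulus (c d : R) : measurable [set xi : R | c <= `|xi| <= d].
Proof.
rewrite (_ : [set _ | _] = [set xi : R | `|xi| <= d] `\` `]- c, c[%classic).
  by apply: measurableD => //; exact: measurable_ball0.
apply/seteqP; split => xi /=; rewrite in_itv/= -ltr_norml.
  by move=> /andP[h1 h2]; split=> //; rewrite ltNge h1.
by move=> [h2 /negP]; rewrite -leNgt h2 andbT.
Qed.

Lemma plancherel_const_gt0 : 0 < @plancherel_const R.
Proof. by rewrite /plancherel_const mulr_gt0// pi_gt0. Qed.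

Lemma maximal_const_gt0 : 0 < @maximal_const R.
Proof.
rewrite /maximal_const sqrtr_gt0 /linearized_const mulr_gt0// mulr_gt0// addr_gt0// mulr_gt0//; exact: pi_gt0.
Qed.

Definition smoothing_const : R := Num.sqrt (160 * pi).

Lemma smoothing_const_gt0 : 0 < smoothing_const.
Proof. by rewrite sqrtr_gt0 mulr_gt0// pi_gt0. Qed.

Lemma exponent_gt0 (theta p : R) : theta <= 1 -> p^-1 = 2^-1 - theta / 6 -> 0 < p.
Proof. by move=> t1 pE; rewrite -invr_gt0 pE; lra. Qed.

Lemma exponent_eq (theta p : R) : theta <= 1 -> p^-1 = 2^-1 - theta / 6 ->
  p * (2 - 2 * (theta / 3)) = 4.
Proof.
move=> t1 pE; have p0 := exponent_gt0 t1 pE.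
by have : p * p^-1 = 1; [rewrite divff ?gt_eqF|rewrite pE; lra].
Qed.

(** The maximal bound k S and the smoothing bound l S N^(-5/4) are weighted by 1 - 2 e and 2 e, so S
    keeps exponent 1 and N gets -2 g. The latter is left as two inverse powers, one of which cancels
    the N^g contained in S. *)
Lemma power_balance (k l S N e g : R) : 0 < k -> 0 < l -> 0 < S -> 0 < N ->
  5 / 4 * (2 * e) = g + g ->
  (k * S) `^ (1 - 2 * e) * (l * S * N `^ (- (5 / 4))) `^ (2 * e) =
  k `^ (1 - 2 * e) * l `^ (2 * e) * S * ((N `^ g)^-1 / N `^ g).
Proof.
move=> k0 l0 S0 N0 eg.
rewrite powRM ?powRM ?mulr_ge0 ?powR_ge0 ?(ltW k0) ?(ltW l0) ?(ltW S0)//.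
rewrite -[(N `^ _) `^ _]powRrM mulNr eg powRN powRD; last by rewrite (gt_eqF N0) implybT.
have SE : S = S `^ (1 - 2 * e) * S `^ (2 * e).
  by rewrite -powRD ?subrK ?powRr1 ?(ltW S0)// (gt_eqF S0) implybT.
by rewrite invfM [S in RHS]SE; ring.
Qed.

Section exponents.
Variables (theta alpha p : R) (b : \bar R).
Hypotheses (t0 : 0 <= theta) (t1 : theta <= 1)
  (aE : alpha = 5 * theta / 12 - 4^-1) (pE : p^-1 = 2^-1 - theta / 6)
  (bE : (b^-1)%E = (theta / 3)%:E) (b0 : (0 < b)%E).

Let g := 5 * theta / 12.
Let e := theta / 3.
Let sC := Num.sqrt (4 * @plancherel_const R).

(** The factor 2 is that of [mixed_le], one [maximal_const] belongs to each wave, [sC] is the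
    Plancherel constant of each datum, and the two 2^g come from the radii 2 M and 2 N. *)
Definition bilinear_const := 2 * maximal_const * maximal_const `^ (1 - 2 * e) * smoothing_const `^ (2 * e) * (sC ^+ 2) * (2 `^ g) ^+ 2.

Let g0 : 0 <= g. Proof. by rewrite /g divr_ge0// mulr_ge0. Qed.
Let e0 : 0 <= e. Proof. by rewrite /e divr_ge0. Qed.
Let sC0 : 0 < sC. Proof. by rewrite sqrtr_gt0 mulr_gt0// plancherel_const_gt0. Qed.

Lemma bilinear_const_gt0 : 0 < bilinear_const.
Proof.
by rewrite /bilinear_const !mulr_gt0 ?exprn_gt0 ?powR_gt0 ?maximal_const_gt0 ?smoothing_const_gt0 ?mulr_gt0 ?powR_gt0.
Qed.

(* Only upper bounds nf, ng > 0 of the norms are used: a vanishing norm would make the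
   normalisations in mixed_le degenerate. *)
Lemma bilinear_pos (M N nf ng : R) (f h : R -> R[i]) : 0 < M -> M <= N -> L2 f -> L2 h ->
  ess_support (fourier f) `<=` [set xi | `|xi| <= 2 * M] ->
  ess_support (fourier h) `<=` [set xi | N <= `|xi| <= 2 * N] ->
  0 < nf -> 0 < ng -> (Lpnorm 2%:E f <= nf%:E)%E -> (Lpnorm 2%:E h <= ng%:E)%E ->
  (mixed_norm p%:E b (fun t x => sol alpha t (fourier f) x * sol alpha t (fourier h) x)%R
   <= (bilinear_const * (M / N) `^ g * nf * ng)%:E)%E.
Proof.
move=> M0 MN Lf Lh sf sh nf0 ng0 fn hn.
have N0 : 0 < N := lt_le_trans M0 MN.
have p0 : 0 < p := exponent_gt0 t1 pE.
have [mF Fn] := fourier_bound Lf (ltW nf0) fn.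
have [mH Hn] := fourier_bound Lh (ltW ng0) hn.
have sq (n : R) : 4 * plancherel_const * n ^+ 2 = (sC * n) ^+ 2.
  by rewrite exprMn sqr_sqrtr// mulr_ge0// ltW// plancherel_const_gt0.
rewrite !sq in Fn Hn.
have mf0 : 0 < sC * nf by rewrite mulr_gt0.
have mh0 : 0 < sC * ng by rewrite mulr_gt0.
have gs : g = alpha + 4^-1 by rewrite aE subrK.
have BM : 0 < 2 * M by rewrite mulr_gt0.
have BN : 0 < 2 * N by rewrite mulr_gt0.
have hK xi : [set xi : R | N <= `|xi| <= 2 * N] xi -> `|xi| <= 2 * N by move=> /= /andP[].
have hN xi : [set xi : R | N <= `|xi| <= 2 * N] xi -> N <= `|xi| by move=> /= /andP[].
have [U [mU U0 uU HU]] := sol_maximal mF mf0 BM Fn g0 gs (measurable_ball0 _)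
  (fun xi h => h) (ess_support_ae sf).
have [V [mV V0 vV HV]] := sol_maximal mH mh0 BN Hn g0 gs (measurable_annulus _ _)
  hK (ess_support_ae sh).
have sm := sol_smooth mH BN Hn g0 gs (measurable_annulus _ _)
  hK (ess_support_ae sh) N0 hN.
set Sf := (2 * M) `^ g * (sC * nf) in HU.
set Sh := (2 * N) `^ g * (sC * ng) in HV sm.
have Sf0 : 0 < Sf by rewrite mulr_gt0// powR_gt0.
have Sh0 : 0 < Sh by rewrite mulr_gt0// powR_gt0.
(* N^(-5/4) is the square root of 1 / (N^2 sqrt N) in [sol_smooth]. *)
pose s := smoothing_const * Sh * N `^ (- (5 / 4)).
have s0 : 0 < s by rewrite !mulr_gt0 ?smoothing_const_gt0// powR_gt0.
have sE : 160 * pi * Sh ^+ 2 / (N ^+ 2 * Num.sqrt N) = s ^+ 2.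
  have -> : s ^+ 2 = smoothing_const ^+ 2 * Sh ^+ 2 * (N `^ (- (5 / 4))) ^+ 2 by rewrite /s; ring.
  rewrite sqr_sqrtr; last by rewrite mulr_ge0// pi_ge0.
  congr (_ * _); rewrite -powR12_sqrt ?(ltW N0)// -powR_mulrn ?(ltW N0)//.
  rewrite -powRD; last by rewrite (gt_eqF N0) implybT.
  rewrite -powRN -powR_mulrn ?powR_ge0// -powRrM; congr (_ `^ _); by field.
rewrite sE in sm.
have A0 : 0 < maximal_const * Sf by rewrite mulr_gt0// maximal_const_gt0.
have B0 : 0 < maximal_const * Sh by rewrite mulr_gt0// maximal_const_gt0.
have e3 : e <= 3^-1 by rewrite /e ler_pdivrMr// mulVf.
have pe : p * (2 - 2 * e) = 4 := exponent_eq t1 pE.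
have := mixed_le p0 pe b0 bE e0 e3 A0 B0 s0 mU mV U0 V0 uU vV HU HV
  (fun x => (sm x).1) (fun x => (sm x).2).
move=> /le_trans; apply; rewrite lee_fin le_eqVlt; apply/orP; left; apply/eqP.
rewrite -mulrA (@power_balance _ _ _ _ _ g) ?maximal_const_gt0 ?smoothing_const_gt0//; last by rewrite /e /g; field.
rewrite /bilinear_const.
have NV : 0 <= N^-1 by rewrite invr_ge0 ltW.
rewrite /Sf /Sh (powRM g (ler0n _ 2) (ltW M0)) (powRM g (ler0n _ 2) (ltW N0)).
rewrite (powRM g (ltW M0) NV).
have -> : N^-1 `^ g = (N `^ g)^-1.
  by rewrite -powR_inv1 ?(ltW N0)// -powRrM mulN1r powRN.
by field; rewrite gt_eqF// powR_gt0.
Qed.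

(** The norms are approached from above by y + r and z + r, positive even if a datum vanishes, and r
    tends to 0. *)
Lemma bilinear (M N : R) (f h : R -> R[i]) : 0 < M -> M <= N -> L2 f -> L2 h ->
  ess_support (fourier f) `<=` [set xi | `|xi| <= 2 * M] ->
  ess_support (fourier h) `<=` [set xi | N <= `|xi| <= 2 * N] ->
  (mixed_norm p%:E b (fun t x => sol alpha t (fourier f) x * sol alpha t (fourier h) x)%R
   <= (bilinear_const * (M / N) `^ g)%:E * Lpnorm 2%:E f * Lpnorm 2%:E h)%E.
Proof.
move=> M0 MN Lf Lh sf sh.
have fE : Lpnorm 2%:E f = (fine (Lpnorm 2%:E f))%:E.
  by rewrite fineK// ge0_fin_numE ?Lf.2//; exact: Lnorm_ge0.
have hE : Lpnorm 2%:E h = (fine (Lpnorm 2%:E h))%:E.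
  by rewrite fineK// ge0_fin_numE ?Lh.2//; exact: Lnorm_ge0.
have F0 : 0 <= fine (Lpnorm 2%:E f) by rewrite fine_ge0//; exact: Lnorm_ge0.
have H0 : 0 <= fine (Lpnorm 2%:E h) by rewrite fine_ge0//; exact: Lnorm_ge0.
have bd := bilinear_pos M0 MN Lf Lh sf sh.
rewrite fE hE in bd *; move: (fine _) (fine _) F0 H0 bd => z y y0 z0 bd.
have N0 : 0 < N := lt_le_trans M0 MN.
have c0 : 0 < bilinear_const * (M / N) `^ g by rewrite mulr_gt0 ?bilinear_const_gt0// powR_gt0// divr_gt0.
move: (bilinear_const * _) c0 bd => c c0 bd.
apply/lee_addgt0Pr => d d0.
have w0 : 0 < c * (y + z + 1) by rewrite mulr_gt0// ltr_wpDl// addr_ge0.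
(* With r <= 1, (y + r) (z + r) exceeds y z by at most r (y + z + 1), so the total error is at most
   d. *)
pose r := Num.min 1 (d / (c * (y + z + 1))).
have r0 : 0 < r by rewrite lt_min ltr01 divr_gt0.
have r1 : r <= 1 by rewrite ge_min lexx.
have rd : r * (c * (y + z + 1)) <= d by rewrite -ler_pdivlMr// ge_min lexx orbT.
apply: (le_trans (bd (y + r) (z + r) _ _ _ _)).
- by rewrite ltr_wpDl.
- by rewrite ltr_wpDl.
- by rewrite lee_fin lerDl ltW.
- by rewrite lee_fin lerDl ltW.
rewrite -!EFinM -EFinD lee_fin.
have h1 : 0 <= c * r * (1 - r) by rewrite !mulr_ge0 ?subr_ge0 ?(ltW c0) ?(ltW r0).
have -> : c * (y + r) * (z + r) = c * y * z + r * (c * (y + z + 1)) - c * r * (1 - r) by ring.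
lra.
Qed.

End exponents.

(** [powR] with exponent 0 is 1 also at the base 0, so the multipliers agree at every xi. *)
Lemma airyE t (f : R -> R[i]) : airy t f = sol 0 t (fourier f).
Proof.
rewrite /airy /sol; congr inv_fourier; apply/funext => xi.
by rewrite /D_mult powRr0 -[Complex 1 0]/(1 : R[i]) mul1r.
Qed.

End bilinear.

Theorem theorem1 (R : realType) :
  (forall (theta : R) (q r : \bar R) (alpha : R),
    0 <= theta -> theta <= 1 ->
    (2%:E <= q)%E -> (2%:E <= r)%E ->
    (q^-1)%E = (theta / 6 + (1 - theta) / 4)%:E ->
    (r^-1)%E = (theta / 6)%:E ->
    ((- alpha)%:E + q^-1 + 3%:E * r^-1)%E = (2^-1)%:E ->
    exists2 C : R, 0 < C &
    forall (M N : R) (f g : R -> R[i]),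
      0 < M -> M <= N -> L2 f -> L2 g ->
      ess_support (fourier f) `<=` [set xi | `|xi| <= 2 * M] ->
      ess_support (fourier g) `<=` [set xi | N <= `|xi| <= 2 * N] ->
      (mixed_norm (q / 2%:E) (r / 2%:E)
         (fun t x => D_airy alpha t f x * D_airy alpha t g x)%R
       <= (C * (M / N) `^ (5 * theta / 12))%:E
          * Lpnorm 2%:E f * Lpnorm 2%:E g)%E)
  /\
  (exists2 C : R, 0 < C &
    forall (M N : R) (f g : R -> R[i]),
      0 < M -> M <= N -> L2 f -> L2 g ->
      ess_support (fourier f) `<=` [set xi | `|xi| <= 2 * M] ->
      ess_support (fourier g) `<=` [set xi | N <= `|xi| <= 2 * N] ->
      (mixed_norm (5 / 2)%:E 5%:E
         (fun t x => airy t f x * airy t g x)%R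
       <= (C * (M / N) `^ 4^-1)%:E
          * Lpnorm 2%:E f * Lpnorm 2%:E g)%E).
Proof.
split=> [theta q r alpha t0 t1 q2 r2 qE rE aE|].
  exists (bilinear_const theta); first exact: bilinear_const_gt0.
  have u0 : theta / 6 + (1 - theta) / 4 != 0 by rewrite gt_eqF//; lra.
  have -> : (q / 2%:E = (((theta / 6 + (1 - theta) / 4)^-1) / 2)%:E)%E.
    by rewrite -[q]inveK qE !inver (negbTE u0) pnatr_eq0/= -EFinM.
  have bE : ((r / 2%:E)^-1 = (theta / 3)%:E)%E.
    (* For theta = 0 one has r = +oo, so the quotient is inverted in the extended reals, under a
       side condition checked by cases on [r]. *)
    rewrite inveM; last first.
      rewrite /inveM_def inver pnatr_eq0/=.
      case: r r2 {rE aE} => [x| |] //= _.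
      by rewrite invr_ge0 ler0n implybT invr_eq0 pnatr_eq0.
    rewrite inveK rE -EFinM; congr EFin; by field.
  have b0 : (0 < r / 2%:E)%E.
    by rewrite mule_gt0 ?(lt_le_trans _ r2)// inver pnatr_eq0/= lte_fin invr_gt0.
  have aE' : alpha = 5 * theta / 12 - 4^-1.
    by move: aE; rewrite qE rE -EFinM -!EFinD => -[]; lra.
  move=> M N f g M0 MN Lf Lg sf sg.
  apply: (bilinear t0 t1 aE' _ bE b0 M0 MN Lf Lg sf sg).
  by rewrite invfM invrK invrK; lra.
(* At theta = 3/5 the exponents are q = 5, r = 10 and alpha = 0, and 5 theta / 12 = 1/4. *)
have t0 : 0 <= 3 / 5 :> R by lra.
have t1 : 3 / 5 <= 1 :> R by lra.
exists (bilinear_const (3 / 5)); first exact: bilinear_const_gt0.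
move=> M N f g M0 MN Lf Lg sf sg.
have -> : 4^-1 = 5 * (3 / 5) / 12 :> R by field.
rewrite (_ : (fun t x => airy t f x * airy t g x)%R =
    (fun t x => sol 0 t (fourier f) x * sol 0 t (fourier g) x)%R); last first.
  by apply/funext => t; apply/funext => x; rewrite !airyE.
apply: (bilinear t0 t1 _ _ _ _ M0 MN Lf Lg sf sg) => //.
- by field.
- by field.
- by rewrite inver pnatr_eq0/=; congr EFin; field.
Qed.
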